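(* Let $1\le p,q\le\infty$ with $\frac1p+\frac1q\le 1$, let $X_1,\dots,X_n,Y$ be Banach spaces and let $T:X_1\times\dots\times X_n\to Y$ be a multilinear operator. The following are equivalent: (i) $T$ is $\pi$-$(p,q)$-dominated. (ii) For any $w^*$-compact norming subsets $K\subset B_{\mathcal L(X_1,\dots,X_n)}$ and $L\subset B_{Y^{**}}$ there exist a positive constant $C$ and regular Borel probability measures $\mu$ on $K$ and $\nu$ on $L$ such that $$|\langle y^*, T(x)-T(z)\rangle|\le C\left(\int_K|\psi(x)-\psi(z)|^p\,d\mu(\psi)\right)^{\frac1p}\left(\int_L|y^{**}(y^* )|^q\,d\nu(y^{**})\right)^{\frac1q}$$ for all $x=(x^1,\dots,x^n)$, $z=(z^1,\dots,z^n)$ in $X_1\times\dots\times X_n$ and all $y^*\in Y^*$ (the first integral factor is replaced by $\pi(x^1\otimes\dots\otimes x^n-z^1\otimes\dots\otimes z^n)$ if $p=\infty$, and the second by $\|y^*\|$ if $q=\infty$). (iii) $T$ factors as $T=B\circ A$, where $Z$ is a Banach space, $A:X_1\times\dots\times X_n\to Z$ is a Lipschitz $p$-summing multilinear operator, and $B:A(X_1\times\dots\times X_n)\to Y$ is a Lipschitz function (the domain carrying the metric of $Z$) whose adjoint linear operator $B^*:Y^*\to (A(X_1\times\dots\times X_n))^*$ is $q$-summing. Under these circumstances $$D_{p,q}^\pi(T)=\inf C=\inf \pi_p^{Lip}(A)\,\pi_q(B^* ),$$ where the first infimum is taken over all constants $C$ as in (ii) (for any given $K$ and $L$) and the second over all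 factorizations as in (iii).
   Context: All Banach spaces are over the same field $\mathbb K\in\{\mathbb R,\mathbb C\}$; $s^*$ denotes the conjugate exponent of $s\in[1,\infty]$, $\frac1s+\frac1{s^*}=1$; $B_X$ is the closed unit ball of $X$. $\mathcal L(X_1,\dots,X_n)$ is the Banach space of bounded multilinear forms on $X_1\times\dots\times X_n$ with the sup norm; it is identified with the dual of the completed projective tensor product, which defines its $w^*$-topology. $\pi$ is the projective tensor norm. A (nonempty) subset of the unit ball of a dual space $E^*$ is norming if $\|e\|$ is the supremum of $|e^*(e)|$ over $e^*$ in the subset, for every $e\in E$; here $E$ is the projective tensor product of $X_1,\dots,X_n$ in the case of $K$, and $E=Y^*$ in the case of $L$. For finite sequences, $\|(x_i^1\otimes\dots\otimes x_i^n-z_i^1\otimes\dots\otimes z_i^n)_{i=1}^m\|_p^{w,\pi}=\sup_{\varphi\in B_{\mathcal L(X_1,\dots,X_n)}}\big(\sum_{i=1}^m|\varphi(x_i^1,\dots,x_i^n)-\varphi(z_i^1,\dots,z_i^n)|^p\big)^{1/p}$ and $\|(y_i^* )_{i=1}^m\|_q^w=\sup_{y^{**}\in B_{Y^{**}}}\big(\sum_{i=1}^m|y^{**}(y_i^* )|^q\big)^{1/q}$ (with maxima over $i$ in place of sums when the exponent is $\infty$). Let $r\in[1,\infty]$ be determined by $1=\frac1r+\frac1p+\frac1q$. A multilinear operator $T:X_1\times\dots\times X_n\to Y$ is $\pi$-$(p,q)$-dominated if there is $C>0$ with $$\|(\langle y_i^*,T(x_i^1,\dots,x_i^n)-T(z_i^1,\dots,z_i^n)\rangle)_{i=1}^m\|_{r^*}\le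 C\,\|(x_i^1\otimes\dots\otimes x_i^n-z_i^1\otimes\dots\otimes z_i^n)_{i=1}^m\|_p^{w,\pi}\,\|(y_i^* )_{i=1}^m\|_q^w$$ for all finite sequences $(x_i^1,\dots,x_i^n)_{i=1}^m,(z_i^1,\dots,z_i^n)_{i=1}^m$ in $X_1\times\dots\times X_n$ and $(y_i^* )_{i=1}^m$ in $Y^*$; $\|\cdot\|_{r^*}$ is the $\ell_{r^*}^m$ norm. $D_{p,q}^\pi(T)$ is the infimum of such $C$. A multilinear operator $A:X_1\times\dots\times X_n\to Z$ is Lipschitz $p$-summing if there is $C>0$ with $\big(\sum_{i=1}^m\|A(x_i)-A(z_i)\|^p\big)^{1/p}\le C\,\|(x_i^1\otimes\dots\otimes x_i^n-z_i^1\otimes\dots\otimes z_i^n)_{i=1}^m\|_p^{w,\pi}$ for all finite sequences $x_i=(x_i^1,\dots,x_i^n)$, $z_i=(z_i^1,\dots,z_i^n)$ in $X_1\times\dots\times X_n$ (maximum over $i$ on the left if $p=\infty$); $\pi_p^{Lip}(A)$ is the least such $C$. For a bounded multilinear $A:X_1\times\dots\times X_n\to Z$, $(A(X_1\times\dots\times X_n))^*$ is the Banach space (pointwise operations, Lipschitz norm) of all Lipschitz functions $\psi:A(X_1\times\dots\times X_n)\to\mathbb K$ such that $\psi\circ A$ is multilinear. If $B:A(X_1\times\dots\times X_n)\to Y$ is Lipschitz and $B\circ A$ is multilinear, its adjoint is the bounded linear operator $B^*:Y^*\to(A(X_1\times\dots\times X_n))^*$, $B^*(y^* )=y^*\circ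 B$. $\pi_q(\cdot)$ is the usual absolutely $q$-summing norm of a linear operator; for $q=\infty$, $\infty$-summing means bounded and $\pi_\infty=\|\cdot\|$. *)

(* Defs.v *)
From HB Require Import structures.
From mathcomp Require Import all_boot all_order all_algebra.
From mathcomp Require Import complex.
From mathcomp Require Import all_classical all_reals all_analysis.

Set Implicit Arguments.
Unset Strict Implicit.
Unset Printing Implicit Defensive.

Import Order.TTheory GRing.Theory Num.Theory.
Import numFieldNormedType.Exports.

Local Open Scope classical_set_scope.
Local Open Scope ring_scope.

Variant scalar_kind := RealScalars | ComplexScalars.

Definition scalars (R : realType) (k : scalar_kind) : numFieldType :=
  match k with RealScalars => R | ComplexScalars => R[i] end.

Definition real_part (R : realType) (k : scalar_kind) : scalars R k -> R :=
  match k return scalars R k -> R with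
  | RealScalars => id
  | ComplexScalars => @complex.Re R
  end.

Definition of_real (R : realType) (k : scalar_kind) : R -> scalars R k :=
  match k return R -> scalars R k with
  | RealScalars => id
  | ComplexScalars => real_complex R
  end.

(* The norm of a normed module over K takes its values in K itself; [nrm] is
   the same norm, read in R. *)
Definition nrm (R : realType) (k : scalar_kind)
  (V : normedModType (scalars R k)) (v : V) : R := real_part `|v|.

Section nrm_theory.
Variables (R : realType) (k : scalar_kind).
Local Notation K := (scalars R k).

Lemma of_realD (a b : R) : of_real k (a + b) = of_real k a + of_real k b.
Proof. by case: k => //=; rewrite rmorphD. Qed.

Lemma of_realM (a b : R) : of_real k (a * b) = of_real k a * of_real k b.
Proof. by case: k => //=; rewrite rmorphM. Qed.

Lemma ler_of_real (a b : R) : (of_real k a <= of_real k b) = (a <= b).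
Proof. by case: k => //=; rewrite lecR. Qed.

Lemma of_realK (a : R) : real_part (of_real k a) = a.
Proof. by case: k. Qed.

Lemma of_real_inj : injective (of_real k : R -> K).
Proof. exact: can_inj of_realK. Qed.

Lemma real_partK (l : K) : 0 <= l -> of_real k (real_part l) = l.
Proof.
case: k l => //= -[a b]; rewrite lecE/= => /andP[/eqP b0 _].
by apply/eqP; rewrite eq_complex/= b0 !eqxx.
Qed.

Lemma of_real0 : of_real k 0 = 0 :> K.
Proof. by case: k. Qed.

Lemma of_real1 : of_real k 1 = 1 :> K.
Proof. by case: k. Qed.

Lemma nrmE (V : normedModType K) (v : V) : of_real k (nrm v) = `|v|.
Proof. by rewrite /nrm real_partK. Qed.

Section normed.
Variable V : normedModType K.
Implicit Types (u v : V) (l : K).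

Lemma nrm_ge0 v : 0 <= nrm v.
Proof. by rewrite -ler_of_real nrmE of_real0. Qed.

Lemma ler_nrmD u v : nrm (u + v) <= nrm u + nrm v.
Proof. by rewrite -ler_of_real of_realD !nrmE ler_normD. Qed.

Lemma nrm0 : nrm (0 : V) = 0.
Proof. by apply: of_real_inj; rewrite nrmE normr0 of_real0. Qed.

Lemma nrmN v : nrm (- v) = nrm v.
Proof. by apply: of_real_inj; rewrite !nrmE normrN. Qed.

Lemma nrm0_eq0 v : nrm v = 0 -> v = 0.
Proof. by move=> v0; apply/eqP; rewrite -normr_eq0 -nrmE v0 of_real0. Qed.

Lemma nrmZ l v : nrm (l *: v) = nrm (l : K^o) * nrm v.
Proof. by apply: of_real_inj; rewrite of_realM !nrmE normrZ. Qed.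

End normed.

Lemma nrm_of_real (a : R) : 0 <= a -> nrm (of_real k a : K^o) = a.
Proof.
move=> a0; apply: of_real_inj; rewrite nrmE.
by rewrite [LHS]ger0_norm// -of_real0 ler_of_real.
Qed.

End nrm_theory.

Section dual.
Variables (R : realType) (k : scalar_kind).
Local Notation K := (scalars R k).
Variable V : normedModType K.

Definition bounded_linear (f : V -> K^o) : Prop :=
  linear f /\ exists M : R, forall v, nrm (f v) <= M * nrm v.

Definition dual_pred : {pred V -> K^o} := [pred f | `[< bounded_linear f >]].

Record dual := Dual { dual_fun :> V -> K^o ; _ : dual_fun \in dual_pred }.

HB.instance Definition _ := [isSub for dual_fun].
HB.instance Definition _ := [Equality of dual by <:].
HB.instance Definition _ := [Choice of dual by <:].

Lemma dualP (f : dual) : bounded_linear f.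
Proof. by case: f => f /= /[!inE]. Qed.

Lemma dual_submod_closed : submod_closed dual_pred.
Proof.
split=> [|a f g]; rewrite !inE.
  split; last by exists 0 => v; rewrite /= nrm0 mul0r.
  by move=> a u v; rewrite /= scaler0 addr0.
move=> [lf [M fM]] [lg [N gN]]; split.
  move=> b u v.
  change (a *: f (b *: u + v) + g (b *: u + v) =
          b *: (a *: f u + g u) + (a *: f v + g v)).
  rewrite lf lg !scalerDr !scalerA [a * b]mulrC !addrA; congr (_ + _).
  by rewrite addrAC.
exists (nrm (a : K^o) * M + N) => v.
apply: (le_trans (ler_nrmD (a *: f v) (g v))).
by rewrite nrmZ mulrDl -mulrA lerD// ler_wpM2l// nrm_ge0.
Qed.

HB.instance Definition _ :=
  GRing.isSubmodClosed.Build K (V -> K^o) dual_pred dual_submod_closed.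
HB.instance Definition _ := [SubChoice_isSubLmodule of dual by <:].

Definition dual_norm (f : dual) : R :=
  sup [set nrm (f v) | v in [set v | nrm v <= 1]].

Lemma dual_norm_has_sup (f : dual) :
  has_sup [set nrm (f v) | v in [set v | nrm v <= 1]].
Proof.
split; first by exists (nrm (f 0)), 0 => //=; rewrite nrm0.
have [_ [M fM]] := dualP f; exists `|M| => _ [v /= v1 <-].
apply: (le_trans (fM v)); apply: (@le_trans _ _ (`|M| * nrm v)).
  by rewrite ler_wpM2r ?nrm_ge0// ler_norm.
by rewrite ler_piMr.
Qed.

Lemma dual_linear (f : dual) : linear f.
Proof. by have [] := dualP f. Qed.

Lemma dual0 (f : dual) : f 0 = 0.
Proof.
have := dual_linear f 1 0 0; rewrite !scale1r addr0 => /esym/eqP.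
by rewrite -subr_eq0 addrK => /eqP.
Qed.

Lemma dualZ (f : dual) a v : f (a *: v) = a *: f v.
Proof. by have := dual_linear f a v 0; rewrite !addr0 dual0 addr0. Qed.

Lemma dual_normP (f : dual) v : nrm (f v) <= dual_norm f * nrm v.
Proof.
have [v0|v_neq0] := eqVneq (nrm v) 0.
  by rewrite (nrm0_eq0 v0) dual0 !nrm0 mulr0.
have v_gt0 : 0 < nrm v by rewrite lt_def v_neq0 nrm_ge0.
rewrite -ler_pdivrMr//.
have h : nrm (of_real k (nrm v)^-1 : K^o) = (nrm v)^-1.
  by rewrite nrm_of_real// invr_ge0 nrm_ge0.
apply: sup_ubound; first by have [] := dual_norm_has_sup f.
exists (of_real k (nrm v)^-1 *: v); last by rewrite dualZ nrmZ h mulrC.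
by rewrite /= nrmZ h mulVf.
Qed.

Lemma dual_norm_le (f : dual) M :
  (forall v, nrm v <= 1 -> nrm (f v) <= M) -> dual_norm f <= M.
Proof.
move=> fM; apply: ge_sup; first by have [] := dual_norm_has_sup f.
by move=> _ [v /= v1 <-]; exact: fM.
Qed.

Lemma dual_norm_ge0 (f : dual) : 0 <= dual_norm f.
Proof.
apply: (@le_trans _ _ (nrm (f 0))); first exact: nrm_ge0.
apply: sup_ubound; first by have [] := dual_norm_has_sup f.
by exists 0 => //=; rewrite nrm0.
Qed.

Lemma dual_normD (f g : dual) : dual_norm (f + g) <= dual_norm f + dual_norm g.
Proof.
apply: dual_norm_le => v v1.
apply: (le_trans (ler_nrmD (f v) (g v))).
by apply: lerD; (apply: le_trans; first exact: dual_normP);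
  rewrite ler_piMr// dual_norm_ge0.
Qed.

Lemma dual_normZ_le a (f : dual) :
  dual_norm (a *: f) <= nrm (a : K^o) * dual_norm f.
Proof.
apply: dual_norm_le => v v1.
change (nrm (a *: f v) <= nrm (a : K^o) * dual_norm f).
rewrite nrmZ ler_wpM2l ?nrm_ge0//.
by apply: (le_trans (dual_normP _ _)); rewrite ler_piMr// dual_norm_ge0.
Qed.

Lemma dual_normZ a (f : dual) :
  dual_norm (a *: f) = nrm (a : K^o) * dual_norm f.
Proof.
apply/eqP; rewrite eq_le dual_normZ_le/=.
have [->|a0] := eqVneq a 0; first by rewrite (nrm0 (K^o)) mul0r dual_norm_ge0.
have na_gt0 : 0 < nrm (a : K^o).
  by rewrite lt_def nrm_ge0 andbT; apply: contra_neq a0 => /nrm0_eq0.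
rewrite -[X in dual_norm X](@scalerK _ _ _ a0 f) mulrC -ler_pdivlMr//.
apply: (le_trans (dual_normZ_le _ _)); rewrite mulrC ler_wpM2l ?dual_norm_ge0//.
rewrite -[leRHS]mul1r ler_pdivlMr// -(nrmZ a^-1 (a : K^o)).
rewrite [_ *: _]mulVf//; apply: (eq_ind 1 (fun x => x <= 1)) => //.
by apply/esym; rewrite -[X in nrm X]of_real1 nrm_of_real.
Qed.

Lemma dual_norm0_eq0 (f : dual) : dual_norm f = 0 -> f = 0.
Proof.
move=> f0; apply/val_inj/funext => v /=; apply: nrm0_eq0.
by apply/eqP; rewrite eq_le nrm_ge0 andbT -(mul0r (nrm v)) -f0 dual_normP.
Qed.

Let normD (f g : dual) :
  of_real k (dual_norm (f + g)) <= of_real k (dual_norm f) + of_real k (dual_norm g).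
Proof. by rewrite -of_realD ler_of_real dual_normD. Qed.

Let normZ (a : K) (f : dual) :
  of_real k (dual_norm (a *: f)) = `|a| * of_real k (dual_norm f).
Proof. by rewrite dual_normZ of_realM nrmE. Qed.

Let norm0_eq0 (f : dual) : of_real k (dual_norm f) = 0 -> f = 0.
Proof. by rewrite -(of_real0 R k) => /of_real_inj/dual_norm0_eq0. Qed.

HB.instance Definition _ := Lmodule_isNormed.Build K dual normD normZ norm0_eq0.

Lemma dual_nrmE (f : dual) : nrm f = dual_norm f.
Proof. exact: of_realK. Qed.

End dual.

Section multilinear.
Variables (R : realType) (k : scalar_kind).
Local Notation K := (scalars R k).
Variables (n : nat) (X : 'I_n.+1 -> completeNormedModType K).

(* [dfwith x i v] is the family [x] whose [i]-th entry is replaced by [v : X i]. *)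
Definition multilinear (W : lmodType K) (f : (forall i, X i) -> W) : Prop :=
  forall (i : 'I_n.+1) (x : forall i, X i), linear (fun v : X i => f (dfwith x i v)).

Record mform := MForm {
  mform_fun :> (forall i, X i) -> K^o;
  mform_multilinear : multilinear mform_fun }.

Record bmform := BMForm {
  bmform_form :> mform;
  bmform_bounded :
    exists M : R, forall x, nrm (bmform_form x) <= M * \prod_i nrm (x i) }.

HB.instance Definition _ := gen_eqMixin bmform.
HB.instance Definition _ := gen_choiceMixin bmform.

Definition bmform_norm (phi : bmform) : R :=
  sup [set nrm (phi x) | x in [set x : forall i, X i | forall i, nrm (x i) <= 1]].

Definition bmform_ball : set bmform := [set phi | bmform_norm phi <= 1].

(* A tensor is a functional on the space of all multilinear forms; the
   algebraic tensor product is the span of the elementary tensors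
   [tens x : phi |-> phi x].  By multilinearity (there is at least one factor),
   scalars can be absorbed into the elementary tensors. *)
Definition tens (x : forall i, X i) : mform -> K := fun phi => phi x.

Definition represents (s : seq (forall i, X i)) (u : mform -> K) : Prop :=
  u = \sum_(x <- s) tens x.

Definition is_tensor (u : mform -> K) : Prop := exists s, represents s u.

Definition proj_norm (u : mform -> K) : R :=
  inf [set \sum_(x <- s) \prod_i nrm (x i) | s in [set s | represents s u]].

(* An element of the completed projective tensor product is given by a
   [proj_norm]-Cauchy sequence of tensors.  Equivalent Cauchy sequences are not
   identified: [ctensor_norm] and [ctensor_pairing] do not separate them. *)
Record ctensor := CTensor {
  ctensor_seq :> nat -> mform -> K;
  ctensor_tensor : forall j, is_tensor (ctensor_seq j);
  ctensor_cauchy : forall e : R, 0 < e -> exists N : nat,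
    forall i j : nat, (N <= i)%N -> (N <= j)%N ->
      proj_norm (ctensor_seq i - ctensor_seq j) < e }.

Definition ctensor_norm (u : ctensor) : R := lim (proj_norm (u j) @[j --> \oo]).

Definition ctensor_pairing (phi : bmform) (u : ctensor) : K :=
  lim ((u j phi : K^o) @[j --> \oo]).

End multilinear.

Section sigma_op.
Variables (R : realType) (k : scalar_kind).
Local Notation K := (scalars R k).
Variables (n : nat) (X : 'I_n.+1 -> completeNormedModType K).
Variables (Z : normedModType K) (A : (forall i, X i) -> Z).

Definition to_range (x : forall i, X i) : range A :=
  exist _ (A x) (mem_set (imageT A x)).

Variable W : normedModType K.

Definition lipschitz_bound (B : range A -> W) (M : R) : Prop :=
  0 <= M /\ forall a b, nrm (B a - B b) <= M * nrm (\val a - \val b).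

Definition lip_multilinear (B : range A -> W) : Prop :=
  (exists M, lipschitz_bound B M) /\ multilinear (B \o to_range).

Definition sigma_op_pred : {pred range A -> W} :=
  [pred B | `[< lip_multilinear B >]].

Record sigma_op := SigmaOp {
  sigma_op_fun :> range A -> W;
  _ : sigma_op_fun \in sigma_op_pred }.

HB.instance Definition _ := [isSub for sigma_op_fun].
HB.instance Definition _ := [Equality of sigma_op by <:].
HB.instance Definition _ := [Choice of sigma_op by <:].

Lemma sigma_opP (B : sigma_op) : lip_multilinear B.
Proof. by case: B => B /= /[!inE]. Qed.

Lemma sigma_op_submod_closed : submod_closed sigma_op_pred.
Proof.
split=> [|a f g]; rewrite !inE.
  split; last by move=> i x b u v; rewrite /= scaler0 addr0.
  by exists 0; split => // u v; rewrite /= subrr nrm0 mul0r.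
move=> [[M [M0 fM]] lf] [[N [N0 gN]] lg]; split; last first.
  move=> i x b u v; set y := fun v => to_range (dfwith x i v).
  change (a *: f (y (b *: u + v)) + g (y (b *: u + v)) =
     b *: (a *: f (y u) + g (y u)) + (a *: f (y v) + g (y v))).
  have := lf i x b u v; rewrite /= => ->; have := lg i x b u v; rewrite /= => ->.
  rewrite !scalerDr !scalerA [a * b]mulrC !addrA; congr (_ + _).
  by rewrite addrAC.
exists (nrm (a : K^o) * M + N); split.
  by rewrite addr_ge0// mulr_ge0// nrm_ge0.
move=> u v.
change (nrm (a *: f u + g u - (a *: f v + g v)) <=
  (nrm (a : K^o) * M + N) * nrm (\val u - \val v)).
rewrite opprD addrACA -scalerBr; apply: (le_trans (ler_nrmD _ _)).
by rewrite nrmZ mulrDl -mulrA lerD// ler_wpM2l// nrm_ge0.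
Qed.

HB.instance Definition _ :=
  GRing.isSubmodClosed.Build K (range A -> W) sigma_op_pred sigma_op_submod_closed.
HB.instance Definition _ := [SubChoice_isSubLmodule of sigma_op by <:].

Definition lip_norm (B : sigma_op) : R := inf [set M | lipschitz_bound B M].

Lemma lip_norm_has_inf (B : sigma_op) : has_inf [set M | lipschitz_bound B M].
Proof.
by split; [have [] := sigma_opP B|exists 0 => M []].
Qed.

Lemma lip_norm_ge0 (B : sigma_op) : 0 <= lip_norm B.
Proof. by apply: lb_le_inf; [have [] := sigma_opP B|move=> M []]. Qed.

Lemma lip_norm_le (B : sigma_op) M : lipschitz_bound B M -> lip_norm B <= M.
Proof. by move=> BM; apply: ge_inf => //; exists 0 => ? []. Qed.

Lemma lip_normP (B : sigma_op) : lipschitz_bound B (lip_norm B).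
Proof.
split=> [|a b]; first exact: lip_norm_ge0.
have [/[dup] ab ->|ab0] := eqVneq (nrm (\val a - \val b)) 0.
  have -> : a = b by apply/val_inj/eqP; rewrite -subr_eq0 (nrm0_eq0 ab).
  by rewrite subrr nrm0 mulr0.
have ab_gt0 : 0 < nrm (\val a - \val b) by rewrite lt_def ab0 nrm_ge0.
rewrite -ler_pdivrMr//; apply: lb_le_inf; first by have [] := sigma_opP B.
by move=> M [_ /(_ a b) BM]; rewrite ler_pdivrMr.
Qed.

Lemma lip_normD (B C : sigma_op) : lip_norm (B + C) <= lip_norm B + lip_norm C.
Proof.
apply: lip_norm_le; split=> [|a b]; first by rewrite addr_ge0 ?lip_norm_ge0.
change (nrm (B a + C a - (B b + C b)) <=
  (lip_norm B + lip_norm C) * nrm (\val a - \val b)).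
rewrite opprD addrACA; apply: (le_trans (ler_nrmD _ _)).
by rewrite mulrDl lerD//; have [_] := lip_normP B; have [_] := lip_normP C.
Qed.

Lemma lip_normZ_le a (B : sigma_op) :
  lip_norm (a *: B) <= nrm (a : K^o) * lip_norm B.
Proof.
apply: lip_norm_le; split=> [|u v].
  by rewrite mulr_ge0 ?lip_norm_ge0 ?nrm_ge0.
change (nrm (a *: B u - a *: B v) <=
  nrm (a : K^o) * lip_norm B * nrm (\val u - \val v)).
rewrite -scalerBr nrmZ -mulrA ler_wpM2l ?nrm_ge0//.
by have [_] := lip_normP B.
Qed.

Lemma lip_normZ a (B : sigma_op) :
  lip_norm (a *: B) = nrm (a : K^o) * lip_norm B.
Proof.
apply/eqP; rewrite eq_le lip_normZ_le/=.
have [->|a0] := eqVneq a 0; first by rewrite (nrm0 (K^o)) mul0r lip_norm_ge0.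
have na_gt0 : 0 < nrm (a : K^o).
  by rewrite lt_def nrm_ge0 andbT; apply: contra_neq a0 => /nrm0_eq0.
rewrite -[X in lip_norm X](@scalerK _ _ _ a0 B) mulrC -ler_pdivlMr//.
apply: (le_trans (lip_normZ_le _ _)); rewrite mulrC ler_wpM2l ?lip_norm_ge0//.
rewrite -[leRHS]mul1r ler_pdivlMr// -(nrmZ a^-1 (a : K^o)).
rewrite [_ *: _]mulVf//; apply: (eq_ind 1 (fun x => x <= 1)) => //.
by apply/esym; rewrite -[X in nrm X]of_real1 nrm_of_real.
Qed.

Lemma to_range_surj (a : range A) : exists x, a = to_range x.
Proof.
case: a => z zA; have [x _ xz] := set_mem zA.
by exists x; apply: val_inj => /=.
Qed.

Lemma multilinear0 (f : (forall i, X i) -> W) : multilinear f ->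
  f (fun=> 0) = 0.
Proof.
move=> /(_ ord0 (fun=> 0) 1 0 0); rewrite !scale1r addr0 => /esym/eqP.
rewrite -subr_eq0 addrK => /eqP <-; congr f; apply: functional_extensionality_dep.
move=> i; have [<-|i0] := eqVneq ord0 i; first by rewrite dfwithin.
by rewrite dfwithout.
Qed.

Lemma lip_norm0_eq0 (B : sigma_op) : lip_norm B = 0 -> B = 0.
Proof.
move=> B0; apply/val_inj/funext => a /=; have [_ Bm] := sigma_opP B.
rewrite -[RHS](multilinear0 Bm) /=; apply/eqP; rewrite -subr_eq0; apply/eqP.
apply: nrm0_eq0; apply/eqP; rewrite eq_le nrm_ge0 andbT.
have [_ /(_ a (to_range (fun=> 0)))] := lip_normP B.
by rewrite B0 mul0r.
Qed.

Let normD (B C : sigma_op) :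
  of_real k (lip_norm (B + C)) <= of_real k (lip_norm B) + of_real k (lip_norm C).
Proof. by rewrite -of_realD ler_of_real lip_normD. Qed.

Let normZ (a : K) (B : sigma_op) :
  of_real k (lip_norm (a *: B)) = `|a| * of_real k (lip_norm B).
Proof. by rewrite lip_normZ of_realM nrmE. Qed.

Let norm0_eq0 (B : sigma_op) : of_real k (lip_norm B) = 0 -> B = 0.
Proof. by rewrite -(of_real0 R k) => /of_real_inj/lip_norm0_eq0. Qed.

HB.instance Definition _ :=
  Lmodule_isNormed.Build K sigma_op normD normZ norm0_eq0.

Lemma sigma_op_nrmE (B : sigma_op) : nrm B = lip_norm B.
Proof. exact: of_realK. Qed.

End sigma_op.

Section adjoint.
Variables (R : realType) (k : scalar_kind).
Local Notation K := (scalars R k).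
Variables (n : nat) (X : 'I_n.+1 -> completeNormedModType K).
Variables (Z : normedModType K) (A : (forall i, X i) -> Z).
Variables (Y : normedModType K) (B : sigma_op A Y).

Lemma adjoint_subproof (y : dual Y) : (y \o B) \in @sigma_op_pred R k n X Z A K^o.
Proof.
rewrite !inE; have [[M [M0 BM]] Bm] := sigma_opP B.
have yl := dual_linear y; split.
  exists (dual_norm y * M); split; first by rewrite mulr_ge0// dual_norm_ge0.
  move=> a b /=; have -> : y (B a) - y (B b) = y (B a - B b).
    by rewrite addrC -scaleN1r -yl scaleN1r addrC.
  apply: (le_trans (dual_normP _ _)).
  by rewrite -mulrA ler_wpM2l// dual_norm_ge0.
move=> i x a u v; have /= := Bm i x a u v => ->; exact: yl.
Qed.

Definition adjoint (y : dual Y) : sigma_op A K^o := SigmaOp (adjoint_subproof y).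

Lemma adjoint_is_linear : linear adjoint.
Proof. by move=> a y1 y2; apply/val_inj/funext. Qed.

HB.instance Definition _ :=
  GRing.isLinear.Build K (dual Y) (sigma_op A K^o) *:%R adjoint adjoint_is_linear.

End adjoint.

(* The [l_s^m] norm of a finite sequence of nonnegative numbers. *)
Definition lnorm (R : realType) (s : \bar R) (m : nat) (a : 'I_m -> R) : R :=
  if s is s'%:E then (\sum_i a i `^ s') `^ s'^-1
  else \big[Num.max/0]_i a i.

(* The exponent [r] such that [1 = 1/r + 1/p + 1/q], where [1/0 = +oo] and
   [1/+oo = 0]. *)
Definition third_exponent (R : realType) (p q : \bar R) : \bar R :=
  (1 - (p^-1 + q^-1))^-1%E.

Section summing.
Variables (R : realType) (k : scalar_kind).
Local Notation K := (scalars R k).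

Definition weak_norm (V : normedModType K) (q : \bar R) (m : nat) (v : 'I_m -> V) : R :=
  sup [set lnorm q (fun i => nrm (f (v i))) | f in [set f : dual V | nrm f <= 1]].

Definition summing_bound (V W : normedModType K) (q : \bar R)
    (u : {linear V -> W}) (C : R) : Prop :=
  0 < C /\
  if q is _%:E then
    forall (m : nat) (v : 'I_m -> V),
      lnorm q (fun i => nrm (u (v i))) <= C * weak_norm q v
  else forall v, nrm (u v) <= C * nrm v.

Definition summing (V W : normedModType K) (q : \bar R) (u : {linear V -> W}) :=
  exists C, summing_bound q u C.

Definition summing_norm (V W : normedModType K) (q : \bar R)
    (u : {linear V -> W}) : R :=
  inf [set C | summing_bound q u C].

Variables (n : nat) (X : 'I_n.+1 -> completeNormedModType K).

Definition weak_proj_norm (p : \bar R) (m : nat) (x z : 'I_m -> forall i, X i) : R :=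
  sup [set lnorm p (fun i => nrm ((phi (x i) : K^o) - phi (z i))) |
        phi in @bmform_ball R k n X].

Definition lip_summing_bound (Z : normedModType K) (p : \bar R)
    (A : (forall i, X i) -> Z) (C : R) : Prop :=
  0 < C /\ forall (m : nat) (x z : 'I_m -> forall i, X i),
    lnorm p (fun i => nrm (A (x i) - A (z i))) <= C * weak_proj_norm p x z.

Definition lip_summing (Z : normedModType K) (p : \bar R)
    (A : (forall i, X i) -> Z) : Prop :=
  exists C, lip_summing_bound p A C.

Definition lip_summing_norm (Z : normedModType K) (p : \bar R)
    (A : (forall i, X i) -> Z) : R :=
  inf [set C | lip_summing_bound p A C].

Definition dominated_bound (Y : normedModType K) (p q : \bar R)
    (T : (forall i, X i) -> Y) (C : R) : Prop :=
  0 < C /\ forall (m : nat) (x z : 'I_m -> forall i, X i) (y : 'I_m -> dual Y),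
    lnorm (hoelder_conjugate (third_exponent p q))
      (fun i => nrm (y i (T (x i) - T (z i)))) <=
    C * weak_proj_norm p x z * weak_norm q y.

Definition dominated (Y : normedModType K) (p q : \bar R)
    (T : (forall i, X i) -> Y) : Prop :=
  exists C, dominated_bound p q T C.

Definition dominated_norm (Y : normedModType K) (p q : \bar R)
    (T : (forall i, X i) -> Y) : R :=
  inf [set C | dominated_bound p q T C].

End summing.

Section weak_star.
Variables (R : realType) (k : scalar_kind).
Local Notation K := (scalars R k).

Definition wstar_dual (V : normedModType K) : topologicalType :=
  initial_topology (fun f : dual V => (f : {ptws V -> K})).

Definition wstar_bmform (n : nat) (X : 'I_n.+1 -> completeNormedModType K) :
    topologicalType :=
  initial_topology (fun phi : bmform X =>
    (ctensor_pairing phi : {ptws ctensor X -> K})).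

(* [D] is a dual space of [E] through the pairing [ev]. *)
Definition norming (D E : Type) (ev : D -> E -> K^o) (normE : E -> R)
    (S : set D) : Prop :=
  S !=set0 /\ forall e, normE e = sup [set nrm (ev d e) | d in S].

Definition wstar_compact_norming_bmform (n : nat)
    (X : 'I_n.+1 -> completeNormedModType K) (S : set (wstar_bmform X)) : Prop :=
  [/\ S `<=` @bmform_ball R k n X, compact S &
      norming (@ctensor_pairing R k n X) (@ctensor_norm R k n X) S].

Definition wstar_compact_norming_dual (V : normedModType K)
    (S : set (wstar_dual V)) : Prop :=
  [/\ S `<=` [set f : dual V | nrm f <= 1], compact S &
      norming (fun (f : dual V) v => f v) (@nrm R k V) S].

End weak_star.

(* A measurable type has to be pointed, hence the nonemptiness proof [S0]. *)
Definition nonempty_set_type (T : topologicalType) (S : set T)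
  (S0 : S !=set0) : Type := set_type S.

Section nonempty_set_type.
Variables (T : topologicalType) (S : set T) (S0 : S !=set0).

HB.instance Definition _ :=
  Topological.copy (nonempty_set_type S0) (set_type S).
HB.instance Definition _ :=
  isPointed.Build (nonempty_set_type S0)
    (exist _ (projT1 (cid S0)) (mem_set (projT2 (cid S0)))).

Definition borel_type := g_sigma_algebraType (@open (nonempty_set_type S0)).

End nonempty_set_type.

Definition regular_borel (R : realType) (T : topologicalType) (S : set T)
    (S0 : S !=set0) (mu : probability (borel_type S0) R) : Prop :=
  forall B : set (borel_type S0), measurable B ->
    mu B = ereal_sup [set mu F | F in
             [set F | @compact (nonempty_set_type S0) F /\ F `<=` B]] /\
    mu B = ereal_inf [set mu U | U in
             [set U | @open (nonempty_set_type S0) U /\ B `<=` U]].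

Section integral_domination.
Variables (R : realType) (k : scalar_kind).
Local Notation K := (scalars R k).
Variables (n : nat) (X : 'I_n.+1 -> completeNormedModType K).
Variables (Y : completeNormedModType K).

Definition multilinear_factor (S : set (wstar_bmform X)) (S0 : S !=set0)
    (mu : probability (borel_type S0) R) (p : \bar R) (x z : forall i, X i) : \bar R :=
  if p is p'%:E then
    ((\int[mu]_psi
        (nrm (((set_val (psi : S) : bmform X) x : K^o)
              - (set_val (psi : S) : bmform X) z) `^ p')%:E) `^ p'^-1)%E
  else (proj_norm (tens x - tens z))%:E.

Definition dual_factor (L : set (wstar_dual (dual Y))) (L0 : L !=set0)
    (nu : probability (borel_type L0) R) (q : \bar R) (y : dual Y) : \bar R :=
  if q is q'%:E then
    ((\int[nu]_f
        (nrm ((set_val (f : L) : dual (dual Y)) y) `^ q')%:E) `^ q'^-1)%E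
  else (nrm y)%:E.

Definition integral_bound (p q : \bar R) (T : (forall i, X i) -> Y)
    (S : set (wstar_bmform X)) (S0 : S !=set0)
    (L : set (wstar_dual (dual Y))) (L0 : L !=set0) (C : R) : Prop :=
  0 < C /\
  exists (mu : probability (borel_type S0) R)
         (nu : probability (borel_type L0) R),
    [/\ regular_borel mu, regular_borel nu &
        forall (x z : forall i, X i) (y : dual Y),
          ((nrm (y (T x - T z)))%:E <=
           C%:E * multilinear_factor mu p x z * dual_factor nu q y)%E].

End integral_domination.

Definition factorization (R : realType) (k : scalar_kind) (n : nat)
    (X : 'I_n.+1 -> completeNormedModType (scalars R k))
    (Y : completeNormedModType (scalars R k)) (p q : \bar R)
    (T : (forall i, X i) -> Y) (Z : completeNormedModType (scalars R k))
    (A : (forall i, X i) -> Z) (B : sigma_op A Y) : Prop :=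
  [/\ multilinear A, lip_summing p A, summing q (adjoint B) &
      forall x, T x = B (to_range A x)].

(* Main.v *)
(** This is Pietsch's domination argument.  By scalar l_p-duality a norming set
    computes weak l_p norms, so (i) bounds sum_j t_j by
    a sup_K sum_j f_j + b sup_L sum_j g_j with t_j = |<y, Tx - Tz>|^s / C^s,
    f_j = |psi(x) - psi(z)|^p, g_j = |y**(y)|^q, s = r*, a = s/p, b = s/q.
    Hahn-Banach turns this into means (positive normalized functionals on bounded
    functions) on K and L, and the freedom to rescale x, z and y gives the product
    form of (ii), for means and with the same constant.  On a compact Hausdorff
    space a mean is dominated, on functions with closed superlevel sets, by a
    regular Borel probability measure, so no representation theorem is needed.
    For (iii), the mean on the unit ball of L(X_1,...,X_n) defines a seminorm on
    the algebraic tensor product through which T factors.  The converse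
    implications are Hoelder's inequality with 1/s = 1/p + 1/q.  As all
    constants are preserved, the infima agree. *)

(* The power s is chosen because the weights s/p and s/q add up to 1. Sums of s-th powers are
   additive under concatenation of sequences, and Young's inequality with these weights splits the
   product of the two weak norms into a sum, which is what a separation argument can handle. An
   exponent [+oo] is the main obstacle: its factor is a norm, not an average of point evaluations.
   Its weight is 0, so the factor is normalized to 1 on the index set of the separation argument,
   and homogeneity restores it afterwards. If both exponents are infinite, the one-term inequality
   is already the claim. The measure bounds the mean from one side only. This is the right side,
   because integrals occur only on the right of (ii), and the way back to (i) starts from measures.
   For fixed K and L the constants of (i) and of (ii) form the same set. In (iii) the constants of
   the two factors vary independently, so only infima can be compared. *)
From HB Require Import structures.
Require Import Defs.
From mathcomp Require Import all_boot all_order all_algebra.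
From mathcomp Require Import finmap complex ring lra.
From mathcomp Require Import all_classical all_reals all_analysis measurable_realfun.

Set Implicit Arguments.
Unset Strict Implicit.
Unset Printing Implicit Defensive.

Import Order.TTheory GRing.Theory Num.Theory.
Import numFieldNormedType.Exports.

Local Open Scope classical_set_scope.
Local Open Scope ring_scope.

(** * The Hahn-Banach theorem relative to a subspace, over both scalar fields *)

Section hahn_banach.
Variables (R : realType) (k : scalar_kind).
Local Notation K := (scalars R k).
Local Notation "r %:K" := (of_real k r) (at level 2, format "r %:K").
Variables (V : lmodType K) (D : set V).
Hypothesis DD : forall u v, D u -> D v -> D (u + v).
Hypothesis DZ : forall (l : K) v, D v -> D (l *: v).

(** Relative to [D], because tensors and bounded functions are singled out in larger function spaces
    by a predicate, and their norms behave well only there. *)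
Definition sublinear (q : V -> R) : Prop :=
  (forall u v, D u -> D v -> q (u + v) <= q u + q v) /\
  (forall a v, 0 < a -> D v -> q (a%:K *: v) = a * q v).

Lemma subspace0 v : D v -> D 0.
Proof. by move=> /(DZ 0); rewrite scale0r. Qed.

Lemma subspaceN v : D v -> D (- v).
Proof. by move=> /(DZ (-1)); rewrite scaleN1r. Qed.

Lemma sublinear0 q v : D v -> sublinear q -> q 0 = 0.
Proof.
move=> /subspace0 D0 [_ /(_ 2 0 (ltr0Sn _ _) D0)]; rewrite scaler0 => q0; lra.
Qed.

Lemma sublinear_ge q v : sublinear q -> D v -> - q (- v) <= q v.
Proof.
move=> sq Dv; have := sq.1 v (- v) Dv (subspaceN Dv).
by rewrite subrr (sublinear0 Dv sq); lra.
Qed.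

(* Lowers [q] as much as possible in the direction [- v0]. *)
Definition lower_at (q : V -> R) (v0 v : V) : R :=
  inf [set q (v + t%:K *: v0) - t * q v0 | t in [set t | 0 <= t]].

Section lower_at.
Variables (q : V -> R) (v0 : V).
Hypotheses (sq : sublinear q) (Dv0 : D v0).

Lemma sublinearZ a v : 0 <= a -> D v -> q (a%:K *: v) = a * q v.
Proof.
rewrite le_eqVlt => /orP[/eqP <-|a0] Dv; last exact: sq.2.
by rewrite of_real0 scale0r mul0r (sublinear0 Dv).
Qed.

(** Subadditivity at v + t v0 and - v. As the bound does not involve [t], the infimum in [lower_at]
    is finite. *)
Lemma lower_at_lb v t : D v -> 0 <= t -> - q (- v) <= q (v + t%:K *: v0) - t * q v0.
Proof.
move=> Dv t0; have DtV : D (t%:K *: v0) by exact: DZ.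
have := sq.1 _ _ (DD Dv DtV) (subspaceN Dv).
by rewrite addrAC subrr add0r sublinearZ//; lra.
Qed.

Lemma lower_at_has_inf v : D v ->
  has_inf [set q (v + t%:K *: v0) - t * q v0 | t in [set t | 0 <= t]].
Proof.
move=> Dv; split; first by eexists; exists 0 => /=.
by exists (- q (- v)) => _ [t /= t0 <-]; exact: lower_at_lb.
Qed.

Lemma lower_atP v t : D v -> 0 <= t ->
  lower_at q v0 v <= q (v + t%:K *: v0) - t * q v0.
Proof.
by move=> Dv t0; apply: ge_inf; [have [] := lower_at_has_inf Dv|exists t].
Qed.

Lemma lower_at_ge v c : D v ->
  (forall t, 0 <= t -> c <= q (v + t%:K *: v0) - t * q v0) -> c <= lower_at q v0 v.
Proof.
move=> Dv h; apply: lb_le_inf; first by have [] := lower_at_has_inf Dv.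
by move=> _ [t /= t0 <-]; exact: h.
Qed.

Lemma lower_at_le v : D v -> lower_at q v0 v <= q v.
Proof.
move=> Dv; have := lower_atP Dv (lexx 0).
by rewrite of_real0 scale0r addr0 mul0r subr0.
Qed.

Lemma sublinear_lower_at : sublinear (lower_at q v0).
Proof.
split=> [u v Du Dv|a v a0 Dv]; last first.
  have Dav : D (a%:K *: v) by exact: DZ.
  apply/eqP; rewrite eq_le; apply/andP; split.
    rewrite -ler_pdivrMl//; apply: lower_at_ge => // t t0.
    have at0 : 0 <= a * t by rewrite mulr_ge0// ltW.
    rewrite ler_pdivrMl//; apply: le_trans (lower_atP Dav at0) _.
    rewrite of_realM -scalerA -scalerDr sq.2//; last exact/DD/DZ.
    by rewrite mulrBr mulrA.
  apply: lower_at_ge => // t t0.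
  have at0 : 0 <= a^-1 * t by rewrite mulr_ge0// invr_ge0 ltW.
  have -> : a%:K *: v + t%:K *: v0 = a%:K *: (v + (a^-1 * t)%:K *: v0).
    by rewrite scalerDr scalerA -of_realM mulVKf ?gt_eqF.
  rewrite sq.2//; last exact/DD/DZ.
  have -> : t * q v0 = a * (a^-1 * t * q v0) by rewrite !mulrA divff ?gt_eqF// mul1r.
  rewrite -mulrBr ler_wpM2l ?(ltW a0)//; apply: lower_atP at0. exact: Dv.
rewrite -lerBlDr; apply: lower_at_ge => // s s0.
rewrite lerBlDr -lerBlDl; apply: lower_at_ge => // t t0.
rewrite lerBlDl; apply: (le_trans (lower_atP (DD Du Dv) (addr_ge0 s0 t0))).
have := sq.1 _ _ (DD Du (DZ s%:K Dv0)) (DD Dv (DZ t%:K Dv0)).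
rewrite of_realD scalerDl addrACA; lra.
Qed.

Lemma lower_atN : lower_at q v0 (- v0) <= - q v0.
Proof.
have := lower_atP (subspaceN Dv0) ler01.
by rewrite of_real1 scale1r addNr (sublinear0 Dv0 sq); lra.
Qed.

End lower_at.

Definition sublinear_below (q : V -> R) := {r : V -> R | sublinear r /\ (forall v, D v -> r v <= q v)}.

(** Zorn's lemma for the reversed pointwise order. The infimum of a chain is finite because each
    member r satisfies r v >= - r (- v) >= - q (- v), and it is subadditive because of any two
    members of a chain the smaller one serves both arguments. *)
Lemma minimal_sublinear (q : V -> R) : sublinear q ->
  exists r, [/\ sublinear r, (forall v, D v -> r v <= q v) &
    forall r', sublinear r' -> (forall v, D v -> r' v <= r v) ->
      forall v, D v -> r' v = r v].
Proof.
move=> sq; have [Dn|/set0P[d Dd]] := eqVneq D set0.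
  by exists q; split => // [r' _ _ v]; rewrite Dn.
pose T := sublinear_below q; pose mk r H : T := exist _ r H.
pose t0 : T := exist _ q (conj sq (fun v _ => lexx (q v))).
pose le (r s : T) : bool := `[< forall v, D v -> sval s v <= sval r v >].
have [] := @ZL_preorder T t0 le.
- by move=> r; apply/asboolP.
- by move=> r s t /asboolP sr /asboolP rt; apply/asboolP => v Dv;
    apply: (le_trans (rt v Dv)); exact: sr.
- move=> A Atot; have [A0|/set0P[a0 Aa0]] := eqVneq A set0.
    by exists t0 => s; rewrite A0.
  pose G v : set R := [set sval r v | r in A].
  have Gi v : D v -> has_inf (G v).
    move=> Dv; split; first by exists (sval a0 v), a0.
    exists (- q (- v)) => _ [[r [sr rq]] _ <-] /=.
    have := sublinear_ge sr Dv; have := rq _ (subspaceN Dv); lra.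
  have Glb v r : D v -> A r -> inf (G v) <= sval r v.
    by move=> Dv Ar; apply: ge_inf; [have [] := Gi v Dv|exists r].
  have Gge v c : D v -> (forall r, A r -> c <= sval r v) -> c <= inf (G v).
    move=> Dv h; apply: lb_le_inf; first by have [] := Gi v Dv.
    by move=> _ [r Ar <-]; exact: h.
  have s1 : sublinear (fun v => inf (G v)).
    split=> [u v Du Dv|a v a0' Dv].
      rewrite -lerBlDr; apply: (Gge) => // r Ar.
      rewrite lerBlDr -lerBlDl; apply: (Gge) => // s As.
      rewrite lerBlDl; case: (Atot _ _ Ar As) => /asboolP h.
        apply: (le_trans (Glb _ _ (DD Du Dv) As)).
        have [[+ _] _] := svalP s => /(_ _ _ Du Dv) => h2; apply: (le_trans h2).
        by rewrite lerD2r h.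
      apply: (le_trans (Glb _ _ (DD Du Dv) Ar)).
      have [[+ _] _] := svalP r => /(_ _ _ Du Dv) => h2; apply: (le_trans h2).
      by rewrite lerD2l h.
    apply/eqP; rewrite eq_le; apply/andP; split.
      rewrite -ler_pdivrMl//; apply: (Gge) => // r Ar.
      rewrite ler_pdivrMl//.
      have [[_ /(_ _ _ a0' Dv) <-] _] := svalP r; exact/Glb/Ar/DZ.
    apply: Gge => [|r Ar]; first exact: DZ.
    have [[_ /(_ _ _ a0' Dv) ->] _] := svalP r.
    by rewrite ler_wpM2l ?(ltW a0')//; exact: Glb.
  have s2 v : D v -> inf (G v) <= q v.
    by move=> Dv; apply: (le_trans (Glb _ _ Dv Aa0)); have [_] := svalP a0; exact.
  exists (mk _ (conj s1 s2)) => s As; apply/asboolP => v Dv /=; exact: Glb.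
move=> [r [sr rq]] rmax; exists r; split => // r' sr' r'r v Dv.
have r'q w : D w -> r' w <= q w by move=> Dw; apply: (le_trans (r'r w Dw)); exact: (rq).
have := rmax (mk r' (conj sr' r'q)).
have -> : le (exist _ r (conj sr rq)) (mk r' (conj sr' r'q)) by exact/asboolP.
move=> /(_ isT)/asboolP/= rr'; apply/eqP; rewrite eq_le r'r//=; exact: rr'.
Qed.

(* A minimal sublinear functional [f] is linear: [lower_at f v] is sublinear and
   below [f], so both coincide, and [lower_atN] gives [f (- v) = - f v]. *)
Lemma hahn_banach_real (q : V -> R) : sublinear q ->
  exists f : V -> R, [/\ forall u v, D u -> D v -> f (u + v) = f u + f v,
    forall a v, D v -> f (a%:K *: v) = a * f v & forall v, D v -> f v <= q v].
Proof.
move=> /minimal_sublinear[f [sf fq fmin]]; exists f.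
have fN v : D v -> f (- v) = - f v.
  move=> Dv; apply/eqP; rewrite eq_le; apply/andP; split; last first.
    by have := sublinear_ge sf (subspaceN Dv); rewrite opprK.
  rewrite -(fmin (lower_at f v)); last exact: subspaceN.
  - exact: lower_atN.
  - exact: sublinear_lower_at.
  - by move=> *; exact: lower_at_le.
split => // [u v Du Dv|a v Dv].
  apply/eqP; rewrite eq_le sf.1//=.
  have := sf.1 _ _ (DD Du Dv) (subspaceN Dv); rewrite addrK fN//; lra.
have [a0|a0] := leP 0 a; first exact: sublinearZ.
have -> : a%:K *: v = - ((- a)%:K *: v).
  rewrite -scaleNr; congr (_ *: _); apply/eqP; rewrite -addr_eq0 -of_realD.
  by rewrite subrr of_real0.
by rewrite fN ?sf.2 ?oppr_gt0 ?mulNr ?opprK//; exact: DZ.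
Qed.

(** A linear functional below [lower_at q v0] is at most - q v0 at - v0, hence at least q v0 at
    v0. *)
Lemma hahn_banach_real_at (q : V -> R) v0 : sublinear q -> D v0 ->
  exists f : V -> R, [/\ forall u v, D u -> D v -> f (u + v) = f u + f v,
    forall a v, D v -> f (a%:K *: v) = a * f v, forall v, D v -> f v <= q v &
    f v0 = q v0].
Proof.
move=> sq Dv0; have [f [fD fZ fq]] := hahn_banach_real (sublinear_lower_at sq Dv0).
have fq' v : D v -> f v <= q v.
  by move=> Dv; apply: (le_trans (fq v Dv)); exact: lower_at_le.
exists f; split => //; apply/eqP; rewrite eq_le fq'//=.
have := fZ (-1) v0 Dv0; rewrite (_ : _ *: v0 = - v0).
  by have := fq _ (subspaceN Dv0); have := lower_atN sq Dv0; lra.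
rewrite -scaleN1r; congr (_ *: _); apply/eqP; rewrite -addr_eq0.
by rewrite -[X in _ + X](of_real1 R k) -of_realD addNr of_real0.
Qed.

End hahn_banach.

Section scalar_norm.
Variables (R : realType) (k : scalar_kind).
Local Notation K := (scalars R k).

Lemma nrm_scalarM (a b : K^o) : nrm (a * b : K^o) = nrm a * nrm b.
Proof. exact: nrmZ. Qed.

Lemma nrm_scalar1 : nrm (1 : K^o) = 1.
Proof. by rewrite -[X in nrm X](of_real1 R k) nrm_of_real. Qed.

Lemma nrm_eq0 (V : normedModType K) (v : V) : (nrm v == 0) = (v == 0).
Proof. by apply/eqP/eqP => [/nrm0_eq0|->]; rewrite ?nrm0. Qed.

Lemma nrm_scalarV (a : K^o) : nrm (a^-1 : K^o) = (nrm a)^-1.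
Proof.
have [->|a0] := eqVneq a 0; first by rewrite invr0 nrm0 invr0.
have na : nrm a != 0 by rewrite nrm_eq0.
by apply: (mulIf na); rewrite -nrm_scalarM !mulVf// nrm_scalar1.
Qed.

Lemma nrmB (V : normedModType K) (u v : V) : nrm (u - v) = nrm (v - u).
Proof. by rewrite -nrmN opprB. Qed.

Lemma ler_nrm_sum (V : normedModType K) (I : Type) (s : seq I) (P : pred I) (F : I -> V) :
  nrm (\sum_(i <- s | P i) F i) <= \sum_(i <- s | P i) nrm (F i).
Proof.
elim/big_rec2 : _ => [|i y x _ h]; first by rewrite nrm0.
by apply: (le_trans (ler_nrmD _ _)); rewrite lerD2l.
Qed.

End scalar_norm.

(* Over the complex numbers a real-linear [f] extends to [f v - i f (i v)], and
   testing at the multiple of [v] by the conjugate value bounds its modulus. *)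
Lemma hahn_banach (R : realType) (k : scalar_kind) (V : lmodType (scalars R k))
    (D : set V) (N : V -> R) (v0 : V) :
  (forall u v, D u -> D v -> D (u + v)) ->
  (forall (l : scalars R k) v, D v -> D (l *: v)) ->
  (forall u v, D u -> D v -> N (u + v) <= N u + N v) ->
  (forall (l : scalars R k) v, D v -> N (l *: v) = nrm (l : (scalars R k)^o) * N v) ->
  D v0 ->
  exists F : V -> (scalars R k)^o,
    [/\ forall (l : scalars R k) u v, D u -> D v -> F (l *: u + v) = l *: F u + F v,
      forall v, D v -> nrm (F v) <= N v & nrm (F v0) = N v0].
Proof.
move=> DD DZ ND NZ Dv0.
have N_ge0 v : D v -> 0 <= N v.
  move=> Dv; have := ND _ _ Dv (DZ (-1) _ Dv).
  rewrite NZ// (nrmN (1 : (scalars R k)^o)) nrm_scalar1 mul1r.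
  have -> : v + -1 *: v = 0 :> V by rewrite scaleN1r subrr.
  have -> : N 0 = 0 by rewrite -(scale0r v) NZ// (nrm0 (scalars R k)^o) mul0r.
  lra.
have NN v : D v -> N (- v) = N v.
  by move=> Dv; rewrite -scaleN1r NZ// (nrmN (1 : (scalars R k)^o)) nrm_scalar1 mul1r.
have sN : sublinear D N.
  split => // a v a0 Dv; rewrite NZ// nrm_of_real//; exact: ltW.
have [f [fD fZ fN fv0]] := hahn_banach_real_at DD DZ sN Dv0.
case: k V D N v0 DD DZ ND NZ Dv0 N_ge0 NN sN f fD fZ fN fv0 => /= V D N v0 DD DZ ND NZ Dv0 N_ge0 NN sN f fD fZ fN fv0.
  exists f; split.
  - by move=> l u v Du Dv; rewrite fD ?fZ//; exact: DZ.
  - move=> v Dv; rewrite [leLHS](_ : _ = `|f v|)// ler_norml fN// andbT.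
    by have := fN _ (DZ (-1) _ Dv); rewrite fZ// scaleN1r NN// mulN1r lerNl.
  - by rewrite [LHS](_ : _ = `|f v0|)// fv0 ger0_norm// N_ge0.
have fC (l : R[i]) v : D v ->
    f (l *: v) = complex.Re l * f v + complex.Im l * f ('i%C *: v).
  move=> Dv; rewrite -fZ//-fZ; last exact: DZ.
  rewrite -fD; [|exact: DZ|exact/DZ/DZ].
  congr f; rewrite scalerA -scalerDl; congr (_ *: _).
  by case: l => a b; apply/eqP; rewrite eq_complex/=; apply/andP; split; apply/eqP; ring.
pose F v : R[i]^o := Complex (f v) (- f ('i%C *: v)).
have normcE a b : Normc.normc (Complex a b) = Num.sqrt (a ^+ 2 + b ^+ 2) by [].
have FN v : D v -> Normc.normc (F v) <= N v.
  move=> Dv; have [->|Fv0] := eqVneq (Normc.normc (F v)) 0; first exact: N_ge0.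
  have Fv_gt0 : 0 < Normc.normc (F v) by rewrite lt_def Fv0 normcE sqrtr_ge0.
  rewrite -(ler_pM2l Fv_gt0).
  have := fN (Complex (f v) (f ('i%C *: v)) *: v) (DZ _ _ Dv).
  rewrite NZ// fC// normcE [complex.Re _]/= [complex.Im _]/=.
  have -> : Normc.normc (F v) * Normc.normc (F v) =
     f v * f v + f ('i%C *: v) * f ('i%C *: v).
    rewrite normcE/= -expr2 sqr_sqrtr; first by rewrite sqrrN !expr2.
    by rewrite addr_ge0// sqr_ge0.
  by rewrite /F normcE sqrrN.
exists F; split => //.
- move=> l u v Du Dv; have Dlu := DZ l _ Du.
  have -> : F (l *: u + v) = F (l *: u) + F v.
    rewrite /F scalerDr fD// fD//; [|exact: DZ|exact: DZ].
    by apply/eqP; rewrite eq_complex/= opprD !eqxx.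
  congr (_ + _); rewrite /F scalerA (fC l)// (fC ('i%C * l))//.
  apply/eqP; rewrite eq_complex/=; apply/andP; split; apply/eqP;
   case: l {Dlu} => a b/=; ring.
- apply/eqP; rewrite eq_le FN//= -fv0.
  rewrite (le_trans (ler_norm _))// -sqrtr_sqr ler_wsqrtr// lerDl sqr_ge0//.
Qed.

(** * Young and Hoelder inequalities, and finite l_p norms *)

Section hoelder_sums.
Variable R : realType.
Implicit Types (a b x y : R).

(** Weights replace conjugate exponents so that a weight may be 0, which is how an infinite exponent
    enters; the corresponding factor is then 1, also at base 0. *)
Lemma young_powR x y a b : 0 <= x -> 0 <= y -> 0 <= a -> 0 <= b -> a + b = 1 ->
  x `^ a * y `^ b <= a * x + b * y.
Proof.
move=> x0 y0 a0 b0 ab1.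
have [a_eq0|a_neq0] := eqVneq a 0.
  have -> : b = 1 by lra.
  by rewrite a_eq0 powRr0 mul0r add0r !mul1r powRr1.
have [b_eq0|b_neq0] := eqVneq b 0.
  have -> : a = 1 by lra.
  by rewrite b_eq0 powRr0 mul0r addr0 mulr1 mul1r powRr1.
have := @conjugate_powR R (x `^ a) (y `^ b) a^-1 b^-1 (powR_ge0 _ _) (powR_ge0 _ _).
rewrite !invrK -!powRrM !divff// !powRr1// [x * a]mulrC [y * b]mulrC; apply => //;
by rewrite invr_gt0 lt_def ?a_neq0 ?b_neq0.
Qed.

Lemma hoelder_sum (I : Type) (s : seq I) (P : pred I) (x y : I -> R) a b :
  (forall i, 0 <= x i) -> (forall i, 0 <= y i) ->
  0 <= a -> 0 <= b -> a + b = 1 ->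
  \sum_(i <- s | P i) x i `^ a * y i `^ b <=
  (\sum_(i <- s | P i) x i) `^ a * (\sum_(i <- s | P i) y i) `^ b.
Proof.
move=> x0 y0 a0 b0 ab1; set X := \sum_(i <- s | P i) x i; set Y := \sum_(i <- s | P i) y i.
have X0 : 0 <= X by rewrite sumr_ge0.
have Y0 : 0 <= Y by rewrite sumr_ge0.
have [a_eq0|a_neq0] := eqVneq a 0.
  have -> : b = 1 by lra.
  rewrite a_eq0 powRr0 mul1r powRr1//; apply: ler_sum => i _.
  by rewrite powRr0 mul1r powRr1.
have [b_eq0|b_neq0] := eqVneq b 0.
  have -> : a = 1 by lra.
  rewrite b_eq0 powRr0 mulr1 powRr1//; apply: ler_sum => i _.
  by rewrite powRr0 mulr1 powRr1.
(* If one of the two sums vanishes, so does each of its terms, and with a nonzero exponent the whole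
   left side. *)
have s0 (r : seq I) (z : I -> R) (c : R) (w : I -> R) : (forall i, 0 <= z i) ->
    \sum_(i <- r | P i) z i = 0 -> c != 0 -> \sum_(i <- r | P i) z i `^ c * w i = 0.
  move=> z0; elim: r => [|i l ih]; first by rewrite !big_nil.
  rewrite !big_cons; case: (P i); last exact: ih.
  move=> /eqP; rewrite paddr_eq0 ?sumr_ge0// => /andP[/eqP zi /eqP zl] c0.
  by rewrite zi powR0// mul0r add0r ih.
have [XE|X_neq0] := eqVneq X 0.
  by rewrite s0// mulr_ge0// powR_ge0.
have [YE|Y_neq0] := eqVneq Y 0.
  under eq_bigr do rewrite mulrC; by rewrite s0// mulr_ge0// powR_ge0.
have Xp : 0 < X by rewrite lt_def X_neq0.
have Yp : 0 < Y by rewrite lt_def Y_neq0.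
(* After division by the totals, Young's inequality applies termwise and the terms add up to a + b =
   1. *)
have E i : x i `^ a * y i `^ b = X `^ a * Y `^ b * ((x i / X) `^ a * (y i / Y) `^ b).
  rewrite mulrACA -!powRM ?divr_ge0//.
  by rewrite ![_ * (_ / _)]mulrC !divfK.
under eq_bigr do rewrite E.
rewrite -big_distrr/= ler_piMr ?mulr_ge0 ?powR_ge0//.
apply: (@le_trans _ _ (\sum_(i <- s | P i) (a * (x i / X) + b * (y i / Y)))).
  by apply: ler_sum => i _; apply: young_powR => //; rewrite divr_ge0.
by rewrite big_split/= -!big_distrr/= -!mulr_suml !divff// !mulr1 ab1.
Qed.

End hoelder_sums.

Section lnorm_theory.
Variable R : realType.
Implicit Types (p : \bar R) (M : R).

Lemma ler_powRV (p x M : R) : 0 < p -> 0 <= x -> 0 <= M ->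
  (x `^ p^-1 <= M) = (x <= M `^ p).
Proof.
move=> p0 x0 M0; apply/idP/idP => [h|h].
  have := @ge0_ler_powR _ p (ltW p0) (x `^ p^-1) M.
  rewrite !nnegrE powR_ge0 M0 => /(_ isT isT h).
  by rewrite -powRrM mulVf ?gt_eqF// powRr1.
have := @ge0_ler_powR _ p^-1 _ x (M `^ p).
rewrite !nnegrE powR_ge0 x0 invr_ge0 (ltW p0) => /(_ isT isT isT h).
by rewrite -powRrM mulfV ?gt_eqF// powRr1.
Qed.

Lemma powRVK (p x : R) : 0 < p -> 0 <= x -> (x `^ p^-1) `^ p = x.
Proof. by move=> p0 x0; rewrite -powRrM mulVf ?gt_eqF// powRr1. Qed.

Lemma powRKV (p x : R) : 0 < p -> 0 <= x -> (x `^ p) `^ p^-1 = x.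
Proof. by move=> p0 x0; rewrite -powRrM mulfV ?gt_eqF// powRr1. Qed.

Lemma sum_powR_ge0 (I : Type) (s : seq I) (P : pred I) (a : I -> R) (p : R) :
  0 <= \sum_(i <- s | P i) a i `^ p.
Proof. by apply: sumr_ge0 => i _; exact: powR_ge0. Qed.

Lemma lnorm_ge0 p m (a : 'I_m -> R) : 0 <= lnorm p a.
Proof.
by case: p => [p||] /=; rewrite ?powR_ge0//;
  elim/big_rec: _ => // i x _ x0; rewrite le_max x0 orbT.
Qed.

Lemma lnorm_fin_le (p : R) m (a : 'I_m -> R) M : 0 < p -> 0 <= M ->
  (lnorm p%:E a <= M) = (\sum_i a i `^ p <= M `^ p).
Proof. by move=> p0 M0; rewrite /= ler_powRV// sum_powR_ge0. Qed.

Lemma lnorm_pinfty_le m (a : 'I_m -> R) M : 0 <= M ->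
  lnorm +oo%E a <= M <-> forall i, a i <= M.
Proof.
move=> M0; split=> [h i|h]; last first.
  by rewrite /=; elim/big_rec: _ => // i x _ xM; rewrite ge_max h.
by apply: le_trans h => /=; rewrite (bigD1 i)//= le_max lexx.
Qed.

Lemma ge1_cases p : (1 <= p)%E -> p = +oo%E \/ exists2 p' : R, p = p'%:E & 1 <= p'.
Proof.
by case: p => [p'||]//; [rewrite lee_fin => h; right; exists p'|left].
Qed.

Lemma lnorm_le_mono p m (a b : 'I_m -> R) : (1 <= p)%E ->
  (forall i, 0 <= a i <= b i) -> lnorm p a <= lnorm p b.
Proof.
move=> /ge1_cases[->|[p' -> p1]] ab.
  apply/lnorm_pinfty_le => [|i]; first exact: lnorm_ge0.
  have /andP[_ /le_trans] := ab i; apply.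
  by have /(lnorm_pinfty_le _ (lnorm_ge0 +oo%E b)) := lexx (lnorm +oo%E b).
have p0 : 0 < p' by lra.
rewrite lnorm_fin_le ?lnorm_ge0// powRVK ?sum_powR_ge0//.
apply: ler_sum => i _; have /andP[a0 abi] := ab i.
by rewrite ge0_ler_powR ?nnegrE//; [lra|exact: le_trans abi].
Qed.

Lemma lnorm_le_coord p m (a : 'I_m -> R) i : (1 <= p)%E -> 0 <= a i -> a i <= lnorm p a.
Proof.
move=> /ge1_cases[->|[p' -> p1]] a0.
  by have /(lnorm_pinfty_le _ (lnorm_ge0 +oo%E a)) := lexx (lnorm +oo%E a).
have p0 : 0 < p' by lra.
rewrite -(powRKV p0 a0) ge0_ler_powR ?nnegrE ?powR_ge0 ?invr_ge0 ?sum_powR_ge0//; first lra.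
by rewrite (bigD1 i)//= lerDl sum_powR_ge0.
Qed.

(** A crude bound that makes the suprema in the weak norms finite. *)
Lemma lnorm_le_sum p m (a : 'I_m -> R) M : (1 <= p)%E -> 0 <= M ->
  (forall i, 0 <= a i <= M) -> lnorm p a <= m%:R * M.
Proof.
move=> /ge1_cases[->|[p' -> p1]] M0 aM.
  apply/lnorm_pinfty_le => [|i]; first by rewrite mulr_ge0.
  have /andP[_ /le_trans] := aM i; apply.
  by rewrite ler_peMl// ler1n (leq_trans _ (ltn_ord i)).
have p0 : 0 < p' by lra.
rewrite lnorm_fin_le ?mulr_ge0// powRM//.
apply: (@le_trans _ _ (\sum_(i < m) M `^ p')).
  apply: ler_sum => i _; have /andP[a0 abi] := aM i.
  by rewrite ge0_ler_powR ?nnegrE//; lra.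
rewrite sumr_const card_ord -[leLHS]mulr_natl ler_wpM2r ?powR_ge0//.
case: (m) => [|m']; first by rewrite powR_ge0.
by rewrite le1r_powR// ler1n.
Qed.

End lnorm_theory.

Lemma scalar_phase (R : realType) (k : scalar_kind) (b : (scalars R k)^o) :
  exists u : (scalars R k)^o, nrm u = 1 /\ u * b = of_real k (nrm b).
Proof.
have [->|b0] := eqVneq b 0.
  by exists 1; rewrite nrm_scalar1 nrm0 mulr0 of_real0.
have nb0 : nrm b != 0 by rewrite nrm_eq0.
exists (of_real k (nrm b) * b^-1); split; last by rewrite mulfVK.
apply: (mulIf nb0); rewrite mul1r -nrm_scalarM mulfVK//.
by rewrite nrm_of_real// nrm_ge0.
Qed.

(* If the family [c s], [s : I], is norming for the coefficients [b], testing
   against the extremal coefficients [|b i| ^ (p - 1)] of the duality between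
   [l_p] and [l_p*] shows that it computes the [l_p] norm of [b] as well. *)
Lemma lnorm_norming (R : realType) (k : scalar_kind) (p : \bar R) (m : nat)
    (b : 'I_m -> (scalars R k)^o) (I : Type) (c : I -> 'I_m -> (scalars R k)^o) (M : R) :
  (1 <= p)%E -> 0 <= M ->
  (forall (a : 'I_m -> (scalars R k)^o) (M' : R), 0 <= M' ->
    (forall s, nrm (\sum_i a i * c s i : (scalars R k)^o) <= M') ->
    nrm (\sum_i a i * b i : (scalars R k)^o) <= M') ->
  (forall s, lnorm p (fun i => nrm (c s i)) <= M) -> lnorm p (fun i => nrm (b i)) <= M.
Proof.
move=> /ge1_cases[->|[p' -> p1]] M0 ab cM.
  apply/lnorm_pinfty_le => // i.
  have sumE (d : 'I_m -> (scalars R k)^o) :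
      \sum_j (if j == i then 1 else 0 : (scalars R k)^o) * d j = d i.
    by rewrite (bigD1 i)//= eqxx mul1r big1 ?addr0// => j /negbTE ->; rewrite mul0r.
  have := ab (fun j => if j == i then 1 else 0) M M0; rewrite sumE; apply => s.
  by rewrite sumE; have /lnorm_pinfty_le := cM s; exact.
have p0 : 0 < p' by lra.
pose u i := projT1 (cid (scalar_phase (b i))).
have u1 i : nrm (u i) = 1 by have [] := projT2 (cid (scalar_phase (b i))).
have ub i : u i * b i = of_real k (nrm (b i)) by have [] := projT2 (cid (scalar_phase (b i))).
pose a i : (scalars R k)^o := of_real k (nrm (b i) `^ (p' - 1)) * u i.
pose B := \sum_i nrm (b i) `^ p'.
have B0 : 0 <= B by exact: sum_powR_ge0.
have aE i : nrm (a i) = nrm (b i) `^ (p' - 1).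
  by rewrite nrm_scalarM u1 mulr1 nrm_of_real// powR_ge0.
have abE : \sum_i a i * b i = of_real k B.
  rewrite /B (big_morph (of_real k) (@of_realD R k) (of_real0 R k)).
  apply: eq_bigr => i _; rewrite -mulrA ub -of_realM mulrC mulr_powRB1//.
  exact: nrm_ge0.
(* The bound is Hoelder's inequality with weights 1 - 1/p and 1/p. Dividing the outcome by its first
   factor leaves B^(1/p) <= M. *)
have := ab a (B `^ (1 - p'^-1) * M).
rewrite abE nrm_of_real// => h.
have {h} : B <= B `^ (1 - p'^-1) * M.
  apply: h => [|s]; first by rewrite mulr_ge0 ?powR_ge0.
  apply: (le_trans (ler_nrm_sum _ _ _)).
  have pE : p' - 1 = p' * (1 - p'^-1) by rewrite mulrBr mulr1 mulfV ?gt_eqF.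
  under eq_bigr => i _.
    rewrite nrm_scalarM aE pE powRrM.
    rewrite -[X in _ * X](@powRKV _ p') ?nrm_ge0//; over.
  have p'1 : p'^-1 <= 1 by rewrite invf_le1.
  apply: (le_trans (hoelder_sum _ _ _ _ _ _ _)) => [i|i||||].
  - exact: powR_ge0.
  - exact: powR_ge0.
  - lra.
  - by rewrite invr_ge0 ltW.
  - lra.
  - by rewrite ler_wpM2l ?powR_ge0//; exact: cM.
rewrite /lnorm -/B => BM; have [->|B_neq0] := eqVneq B 0.
  by rewrite powR0 ?invr_eq0 ?gt_eqF.
have Bp : 0 < B by rewrite lt_def B_neq0.
rewrite -(ler_pM2l (powR_gt0 (1 - p'^-1) Bp)) -powRD; last by rewrite B_neq0 implybT.
by rewrite subrK powRr1.
Qed.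

(** * Means and the abstract Pietsch argument *)

Section means.
Variables (R : realType).

Definition bounded_real (I : Type) (f : I -> R) : Prop :=
  exists M, forall i, `|f i| <= M.

Lemma bounded_realD (I : Type) (f g : I -> R) :
  bounded_real f -> bounded_real g -> bounded_real (fun i => f i + g i).
Proof.
move=> [M fM] [N gN]; exists (M + N) => i.
by rewrite (le_trans (ler_normD _ _))// lerD.
Qed.

Lemma bounded_realZ (I : Type) a (f : I -> R) :
  bounded_real f -> bounded_real (fun i => a * f i).
Proof. by move=> [M fM]; exists (`|a| * M) => i; rewrite normrM ler_wpM2l. Qed.

Lemma bounded_real_cst (I : Type) a : bounded_real (fun _ : I => a).
Proof. by exists `|a|. Qed.

Lemma bounded_real_ge0 (I : Type) (f : I -> R) M : (forall i, 0 <= f i <= M) -> bounded_real f.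
Proof. by move=> fM; exists M => i; have /andP[? ?] := fM i; rewrite ger0_norm. Qed.

Lemma bounded_real_sum (I J : Type) (s : seq J) (f : J -> I -> R) :
  (forall j, bounded_real (f j)) -> bounded_real (fun i => \sum_(j <- s) f j i).
Proof.
move=> fb; elim: s => [|j s ih].
  by exists 0 => i; rewrite big_nil normr0.
have [M h] := bounded_realD (fb j) ih.
by exists M => i; rewrite big_cons.
Qed.

(** On indicators this is a finitely additive probability. The functional is total, so its laws are
    asked only for bounded functions. *)
Record mean (I : Type) := Mean {
  mean_fun :> (I -> R) -> R;
  meanD : forall f g, bounded_real f -> bounded_real g ->
    mean_fun (fun i => f i + g i) = mean_fun f + mean_fun g;
  meanZ : forall a f, bounded_real f -> mean_fun (fun i => a * f i) = a * mean_fun f;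
  ler_mean : forall f g, bounded_real f -> bounded_real g ->
    (forall i, f i <= g i) -> mean_fun f <= mean_fun g;
  mean1 : mean_fun (fun=> 1) = 1 }.

Section mean_theory.
Variables (I : Type) (L : mean I).

Lemma mean_cst c : L (fun=> c) = c.
Proof.
rewrite -[RHS]mulr1 -[in RHS](mean1 L) -meanZ; last exact: bounded_real_cst.
by congr (L _); apply/funext => i; rewrite mulr1.
Qed.

Lemma mean_ge0 f : bounded_real f -> (forall i, 0 <= f i) -> 0 <= L f.
Proof. by move=> fb f0; rewrite -(mean_cst 0) ler_mean//; exact: bounded_real_cst. Qed.

Lemma mean_sum (J : Type) (s : seq J) (f : J -> I -> R) :
  (forall j, bounded_real (f j)) ->
  L (fun i => \sum_(j <- s) f j i) = \sum_(j <- s) L (f j).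
Proof.
move=> fb; elim: s => [|j s ih].
  rewrite big_nil -[RHS](mean_cst 0); congr (L _).
  by apply/funext => i; rewrite big_nil.
rewrite big_cons -ih -meanD//; last exact: bounded_real_sum.
by congr (L _); apply/funext => i; rewrite big_cons.
Qed.

Lemma mean_le_cst f c : bounded_real f -> (forall i, f i <= c) -> L f <= c.
Proof. by move=> fb fc; rewrite -[leRHS]mean_cst ler_mean//; exact: bounded_real_cst. Qed.

End mean_theory.

Definition eval_mean (I : Type) (i0 : I) : mean I.
Proof. by exists (fun f => f i0). Defined.

Section pietsch.
Variables (I I' J : Type) (i0 : I) (i0' : I').
Variables (t : J -> R) (f : J -> I -> R) (g : J -> I' -> R) (a b : R).
Hypotheses (a0 : 0 <= a) (b0 : 0 <= b) (ab1 : a + b = 1).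
Hypotheses (f0 : forall j i, 0 <= f j i)
  (g0 : forall j i, 0 <= g j i).
Hypotheses (fb : forall j, bounded_real (f j)) (gb : forall j, bounded_real (g j)).
Hypothesis scale : forall j (c d : R), 0 < c -> 0 < d -> exists j',
  [/\ t j' = c `^ a * d `^ b * t j, forall i, f j' i = c * f j i &
      forall i, g j' i = d * g j i].
Hypothesis dom : forall (s : seq J) (A B : R), 0 <= A -> 0 <= B ->
  (forall i, \sum_(j <- s) f j i <= A) -> (forall i, \sum_(j <- s) g j i <= B) ->
  \sum_(j <- s) t j <= A `^ a * B `^ b.

(** Young's inequality makes [dom] additive. If a weight is 0, the hypothesis on that side does not
    bound the sum; any finite bound will do then, as it is multiplied by 0 and the hypothesis still
    gives a nonnegative right side. *)
Let dom_add (s : seq J) A B :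
  (forall i, a * (\sum_(j <- s) f j i) <= A) ->
  (forall i, b * (\sum_(j <- s) g j i) <= B) -> \sum_(j <- s) t j <= A + B.
Proof.
have bound (c : R) (T : Type) (h : J -> T -> R) (i : T) C : 0 <= c ->
    (forall j i, 0 <= h j i) ->
    (forall j, bounded_real (h j)) -> (forall i, c * (\sum_(j <- s) h j i) <= C) ->
    exists2 D, 0 <= D & (forall i, \sum_(j <- s) h j i <= D) /\ c * D <= C.
  move=> c0 h0 hb hC; have [c_eq0|c_neq0] := eqVneq c 0; last first.
    have cp : 0 < c by rewrite lt_def c_neq0.
    exists (C / c); last first.
      by split=> [l|]; [rewrite ler_pdivlMr// mulrC|rewrite mulrC divfK].
    by rewrite divr_ge0// (le_trans _ (hC i))// mulr_ge0// sumr_ge0.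
  have [M hM] := bounded_real_sum s hb; exists `|M| => //; split=> [l|].
    by rewrite (le_trans (ler_norm _))// (le_trans (hM l))// ler_norm.
  by rewrite c_eq0 mul0r (le_trans _ (hC i))// c_eq0 mul0r.
move=> /(bound _ _ _ i0 _ a0 f0 fb)[A' A'0 [fA aA]].
move=> /(bound _ _ _ i0' _ b0 g0 gb)[B' B'0 [gB bB]].
apply: (le_trans (dom A'0 B'0 fA gB)); apply: (le_trans (young_powR _ _ _ _ _)) => //.
exact: lerD.
Qed.

(** One functional on the disjoint union encodes both means, so Hahn-Banach is applied once. *)
Let V : lmodType R := (I + I')%type -> R^o.
Let D : set V := [set h | bounded_real (h : (I + I')%type -> R)].

(* [q] is the sublinear functional whose linear minorants are the pairs of means
   satisfying the additive form [t j <= a * L (f j) + b * G (g j)]; it is finite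
   because of [dom_add]. *)
Let E (h : V) : set R := [set c | exists s A B,
  [/\ forall i, h (inl i) + a * (\sum_(j <- s) f j i) <= A,
     forall i, h (inr i) + b * (\sum_(j <- s) g j i) <= B &
     c = A + B - \sum_(j <- s) t j]].

Let E_has_inf (h : V) : D h -> has_inf (E h).
Proof.
move=> [M hM]; have hM' l : - M <= h l <= M by rewrite -ler_norml.
split.
  exists (M + M - \sum_(j <- [::]) t j), [::], M, M.
  split=> // i; rewrite big_nil mulr0 addr0.
    by have /andP[] := hM' (inl i).
  by have /andP[] := hM' (inr i).
exists (- M - M) => _ [s [A [B [hA hB ->]]]].
(* Since h >= - M, the constraints on h become those of [dom_add] after a shift by M on each
   side. *)
have := @dom_add s (A + M) (B + M) => h1.
suff : \sum_(j <- s) t j <= A + M + (B + M) by lra.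
by apply: h1 => i; [have := hA i; have /andP[] := hM' (inl i)|
  have := hB i; have /andP[] := hM' (inr i)]; lra.
Qed.

Let scale_seq (s : seq J) c : 0 < c -> exists s',
  [/\ \sum_(j <- s') t j = c * \sum_(j <- s) t j,
    forall i, \sum_(j <- s') f j i = c * \sum_(j <- s) f j i &
    forall i, \sum_(j <- s') g j i = c * \sum_(j <- s) g j i].
Proof.
move=> c0; elim: s => [|j s [s' [ts' fs' gs']]].
  by exists [::]; split=> [|i|i]; rewrite !big_nil mulr0.
have [j' [tj fj gj]] := scale j c0 c0; exists (j' :: s').
have cE : c `^ a * c `^ b = c.
  by rewrite -powRD ?ab1 ?oner_eq0// powRr1// ltW.
by split=> [|i|i]; rewrite !big_cons ?ts' ?fs' ?gs' ?tj ?fj ?gj ?cE mulrDr.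
Qed.

Let q (h : V) : R := inf (E h).

Let q_le (h : V) s A B : D h ->
  (forall i, h (inl i) + a * (\sum_(j <- s) f j i) <= A) ->
  (forall i, h (inr i) + b * (\sum_(j <- s) g j i) <= B) ->
  q h <= A + B - \sum_(j <- s) t j.
Proof.
move=> Dh hA hB; apply: ge_inf; first by have [] := E_has_inf Dh.
by exists s, A, B.
Qed.

Let q_le0 (h : V) A B : D h -> (forall i, h (inl i) <= A) -> (forall i, h (inr i) <= B) ->
  q h <= A + B.
Proof.
move=> Dh hA hB; have := @q_le h [::] A B Dh.
rewrite big_nil subr0; apply => i; rewrite big_nil mulr0 addr0//.
Qed.

Let q_sublinear : sublinear (k := RealScalars) D q.
Proof.
split=> [u v Du Dv|c v c0 Dv].
  have Duv : D (u + v) by exact: bounded_realD.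
  rewrite -lerBlDr; apply: lb_le_inf; first by have [] := E_has_inf Du.
  move=> _ [s [A [B [hA hB ->]]]]; rewrite lerBlDr -lerBlDl.
  apply: lb_le_inf; first by have [] := E_has_inf Dv.
  move=> _ [s' [A' [B' [hA' hB' ->]]]]; rewrite lerBlDl.
  (* Concatenated sequences witness the sum, so [q] is subadditive. *)
  have := @q_le (u + v) (s ++ s') (A + A') (B + B') Duv.
  rewrite big_cat/= => h; suff : q (u + v) <=
     A + A' + (B + B') - (\sum_(j <- s) t j + \sum_(j <- s') t j) by lra.
  apply: h => i; rewrite big_cat/= mulrDr.
    by rewrite [X in X + _](_ : _ = u (inl i) + v (inl i))// addrACA lerD.
  by rewrite [X in X + _](_ : _ = u (inr i) + v (inr i))// addrACA lerD.
have qZ (w : V) e : 0 < e -> D w -> q (e *: w) <= e * q w.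
  move=> e0 Dw; have Dew : D (e *: w) by exact: bounded_realZ.
  rewrite -ler_pdivrMl//; apply: lb_le_inf; first by have [] := E_has_inf Dw.
  move=> _ [s [A [B [hA hB ->]]]]; rewrite ler_pdivrMl//.
  have [s' [ts' fs' gs']] := scale_seq s e0.
  have := @q_le (e *: w) s' (e * A) (e * B) Dew.
  rewrite ts' !mulrBr !mulrDr; apply => i.
    rewrite fs' mulrCA [(e *: w) _]/(e * w (inl i)) -mulrDr ler_pM2l//; exact: hA.
  rewrite gs' mulrCA [(e *: w) _]/(e * w (inr i)) -mulrDr ler_pM2l//; exact: hB.
apply/eqP; rewrite eq_le qZ//=.
have Dcv : D (c *: v) by exact: bounded_realZ.
have := qZ (c *: v) c^-1; rewrite invr_gt0 => /(_ c0 Dcv).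
by rewrite scalerA mulVf ?gt_eqF// scale1r ler_pdivlMl.
Qed.

Let inL (h : I -> R) : V := fun l => if l is inl i then h i else 0.
Let inR (h : I' -> R) : V := fun l => if l is inr i then h i else 0.

Let D_inL h : bounded_real h -> D (inL h).
Proof.
move=> [M hM]; exists `|M| => -[i|i] /=; last by rewrite normr0.
by rewrite (le_trans (hM i))// ler_norm.
Qed.

Let D_inR h : bounded_real h -> D (inR h).
Proof.
move=> [M hM]; exists `|M| => -[i|i] /=; first by rewrite normr0.
by rewrite (le_trans (hM i))// ler_norm.
Qed.

Let DD u v : D u -> D v -> D (u + v).
Proof. exact: bounded_realD. Qed.

Let DZ (c : R) v : D v -> D (c *: v).
Proof. exact: bounded_realZ. Qed.

(** On each summand [q] is at most 0 at nonpositive functions, at most 1 at the constant 1 and at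
    most -1 at the constant -1. A linear minorant is therefore positive and normalized there. *)
Let pietsch_additive : exists (L : mean I) (G : mean I'),
  forall j, t j <= a * L (f j) + b * G (g j).
Proof.
have [phi [phiD phiZ phiq]] :=
  @hahn_banach_real R RealScalars V D DD DZ q q_sublinear.
have mk (T : Type) (emb : (T -> R) -> V) :
    (forall u v, emb (fun i => u i + v i) = emb u + emb v) ->
    (forall c u, emb (fun i => c * u i) = c *: emb u) ->
    (forall u, bounded_real u -> D (emb u)) ->
    (forall u, bounded_real u -> (forall i, u i <= 0) -> q (emb u) <= 0) ->
    q (emb (fun=> 1)) <= 1 -> q (emb (fun=> -1)) <= -1 ->
    exists L : mean T, forall u, L u = phi (emb u).
  move=> eD eZ Demb qn q1 qN1.
  have pD u v : bounded_real u -> bounded_real v ->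
      phi (emb (fun i => u i + v i)) = phi (emb u) + phi (emb v).
    by move=> ub vb; rewrite eD phiD//; exact: Demb.
  have pZ c u : bounded_real u -> phi (emb (fun i => c * u i)) = c * phi (emb u).
    by move=> ub; rewrite eZ -phiZ//; exact: Demb.
  have ple u v : bounded_real u -> bounded_real v -> (forall i, u i <= v i) ->
      phi (emb u) <= phi (emb v).
    move=> ub vb uv.
    have vb' := bounded_realZ (-1) vb.
    rewrite -subr_ge0 -oppr_le0 opprB -mulN1r -pZ// -pD//.
    apply: (le_trans (phiq _ _)); first exact/Demb/bounded_realD.
    by apply: qn => [|i]; [exact: bounded_realD|have := uv i; lra].
  have p1 : phi (emb (fun=> 1)) = 1.
    apply/eqP; rewrite eq_le; apply/andP; split.
      by apply: le_trans q1; apply: phiq; exact/Demb/bounded_real_cst.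
    have := phiq _ (Demb _ (bounded_real_cst T (-1))).
    have -> : phi (emb (fun=> -1)) = - phi (emb (fun=> 1)).
      rewrite -[RHS]mulN1r -pZ; last exact: bounded_real_cst.
      by congr (phi (emb _)); apply/funext => i; rewrite mulr1.
    lra.
  by exists (Mean pD pZ ple p1).
have [] := mk I inL.
- by move=> u v; apply/funext => -[i|i] //=; rewrite -[RHS]/(0 + 0) addr0.
- by move=> c u; apply/funext => -[i|i] //=; rewrite -[RHS]/(c * 0) mulr0.
- exact: D_inL.
- move=> u ub u0; rewrite -[leRHS]addr0; apply: q_le0 => //; exact: D_inL.
- rewrite -[leRHS]addr0; apply: q_le0 => //; exact/D_inL/bounded_real_cst.
- rewrite -[leRHS]addr0; apply: q_le0 => //; exact/D_inL/bounded_real_cst.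
move=> L LE; have [] := mk I' inR.
- by move=> u v; apply/funext => -[i|i] //=; rewrite -[RHS]/(0 + 0) addr0.
- by move=> c u; apply/funext => -[i|i] //=; rewrite -[RHS]/(c * 0) mulr0.
- exact: D_inR.
- move=> u ub u0; rewrite -[leRHS]addr0; apply: q_le0 => //; exact: D_inR.
- rewrite -[leRHS]add0r; apply: q_le0 => //; exact/D_inR/bounded_real_cst.
- rewrite -[leRHS]add0r; apply: q_le0 => //; exact/D_inR/bounded_real_cst.
move=> G GE; exists L, G => j.
have af := bounded_realZ (- a) (fb j); have bg := bounded_realZ (- b) (gb j).
have := meanZ L (- a) (fb j); have := meanZ G (- b) (gb j).
rewrite !LE !GE => Gj Lj.
suff : phi (inL (fun i => - a * f j i)) + phi (inR (fun i => - b * g j i)) <= - t j.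
  by rewrite Lj Gj; lra.
rewrite -phiD; [|exact: D_inL|exact: D_inR].
apply: (le_trans (phiq _ _)); first by apply: DD; [exact: D_inL|exact: D_inR].
(* With the single index j the constraints hold with A = B = 0, so [q] is at most - t j at this
   function. *)
have := @q_le (inL (fun i => - a * f j i) + inR (fun i => - b * g j i)) [:: j] 0 0.
rewrite big_seq1 addr0 add0r; apply; first by apply: DD; [exact: D_inL|exact: D_inR].
- move=> i; rewrite big_seq1 [X in X + _](_ : _ = - a * f j i) ?mulNr ?addNr//.
  by rewrite -[LHS]/(- a * f j i + 0) addr0 mulNr.
- move=> i; rewrite big_seq1 [X in X + _](_ : _ = - b * g j i) ?mulNr ?addNr//.
  by rewrite -[LHS]/(0 + - b * g j i) add0r mulNr.
Qed.

(* Rescaling [j] optimizes the additive inequality into the product form. *)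
Lemma pietsch_means : exists (L : mean I) (G : mean I'),
  forall j, t j <= L (f j) `^ a * G (g j) `^ b.
Proof.
have [L [G tLG]] := pietsch_additive; exists L, G => j.
have x0 : 0 <= L (f j) by exact: mean_ge0.
have y0 : 0 <= G (g j) by exact: mean_ge0.
move: x0 y0; set x := L (f j); set y := G (g j) => x0 y0.
have tcd c d : 0 < c -> 0 < d -> c `^ a * d `^ b * t j <= a * (c * x) + b * (d * y).
  move=> c0 d0; have [j' [<- fj' gj']] := scale j c0 d0; apply: (le_trans (tLG j')).
  have -> : f j' = (fun i => c * f j i) by exact/funext.
  have -> : g j' = (fun i => d * g j i) by exact/funext.
  by rewrite !meanZ.
have [a_eq0|a_neq0] := eqVneq a 0.
  have b1 : b = 1 by rewrite -ab1 a_eq0 add0r.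
  have := tcd 1 1 ltr01 ltr01; by rewrite a_eq0 b1 !powRr0 !powRr1// !mul1r mul0r add0r.
have [b_eq0|b_neq0] := eqVneq b 0.
  have a1 : a = 1 by rewrite -ab1 b_eq0 addr0.
  have := tcd 1 1 ltr01 ltr01; by rewrite b_eq0 a1 !powRr0 !powRr1// !mul1r !mulr1 mul0r addr0.
have ap : 0 < a by rewrite lt_def a_neq0.
have bp : 0 < b by rewrite lt_def b_neq0.
(* If one mean vanishes, letting its scale tend to infinity forces t j <= 0. *)
have blowup e D' : 0 < e -> 0 <= D' -> (forall c, 0 < c -> c `^ e * t j <= D') -> t j <= 0.
  move=> e0 D0 h; rewrite leNgt; apply/negP => tp.
  have Dp : 0 < (D' + 1) / t j by rewrite divr_gt0//; lra.
  have := h _ (powR_gt0 e^-1 Dp).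
  by rewrite (powRVK e0 (ltW Dp)) divfK ?gt_eqF//; lra.
have [x_eq0|x_neq0] := eqVneq x 0.
  rewrite x_eq0 powR0// mul0r; apply: (blowup a (b * y)) => // [|c c0].
    by rewrite mulr_ge0.
  by have := tcd c 1 c0 ltr01; rewrite powR1 mulr1 x_eq0; lra.
have [y_eq0|y_neq0] := eqVneq y 0.
  rewrite y_eq0 powR0// mulr0; apply: (blowup b (a * x)) => // [|c c0].
    by rewrite mulr_ge0.
  by have := tcd 1 c ltr01 c0; rewrite powR1 mul1r y_eq0; lra.
have xp : 0 < x by rewrite lt_def x_neq0.
have yp : 0 < y by rewrite lt_def y_neq0.
(* These scales turn both means into 1, so the right side becomes a + b = 1. *)
have := tcd x^-1 y^-1; rewrite !invr_gt0 => /(_ xp yp).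
rewrite !mulVf// !mulr1 ab1 => h.
have xy : 0 < x `^ a * y `^ b by rewrite mulr_gt0// powR_gt0.
move: h; rewrite -(ler_pM2l xy) mulr1; apply: le_trans.
by rewrite mulrA mulrACA -!powRM ?invr_ge0// !mulfV// !powR1 !mul1r.
Qed.

End pietsch.
End means.

(** * Tensors as functionals on multilinear forms, and the projective norm *)

Section multilinear_theory.
Variables (R : realType) (k : scalar_kind) (n : nat).
Local Notation K := (scalars R k).
Variables (X : 'I_n.+1 -> completeNormedModType K).
Local Notation XX := (forall i, X i).
Local Notation tensor := (mform X -> K^o).

Lemma dfwith_self (x : XX) i : dfwith x i (x i) = x.
Proof.
apply: functional_extensionality_dep => j.
by have [<-|ij] := eqVneq i j; rewrite ?dfwithin// dfwithout.
Qed.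

Section codomain.
Variables (W : lmodType K) (f : XX -> W).
Hypothesis fm : multilinear f.

Lemma multilinear_dfwith0 x i : f (dfwith x i 0) = 0.
Proof.
have := @fm i x 1 0 0; rewrite !scale1r addr0 => /esym/eqP.
by rewrite -subr_eq0 addrK => /eqP.
Qed.

Lemma multilinear_dfwithZ x i c v : f (dfwith x i (c *: v)) = c *: f (dfwith x i v).
Proof. by have := @fm i x c v 0; rewrite !addr0 multilinear_dfwith0 addr0. Qed.

Lemma multilinear_eq0 x i : x i = 0 -> f x = 0.
Proof. by move=> xi; rewrite -(dfwith_self x i) xi multilinear_dfwith0. Qed.

Lemma multilinear_scale (c : 'I_n.+1 -> K) x :
  f (fun i => c i *: x i) = (\prod_i c i) *: f x.
Proof.
suff E (s : seq 'I_n.+1) : uniq s ->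
    f (fun i => if i \in s then c i *: x i else x i) = (\prod_(i <- s) c i) *: f x.
  rewrite -[in RHS]big_enum/= -E ?enum_uniq//; congr f.
  by apply: functional_extensionality_dep => i; rewrite mem_enum.
elim: s => [|j s ih] /=; first by rewrite big_nil scale1r.
move=> /andP[js us]; rewrite big_cons -scalerA -ih//.
rewrite -[X in _ = _ *: f X](dfwith_self _ j) -multilinear_dfwithZ (negbTE js).
congr f; apply: functional_extensionality_dep => i.
have [<-|ij] := eqVneq j i; first by rewrite dfwithin in_cons eqxx.
by rewrite dfwithout// in_cons eq_sym (negbTE ij).
Qed.

End codomain.

Definition scale_ord0 (c : K) (x : XX) : XX := dfwith x ord0 (c *: x ord0).

Lemma multilinear_scale_ord0 (W : lmodType K) (f : XX -> W) c x : multilinear f ->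
  f (scale_ord0 c x) = c *: f x.
Proof. by move=> fm; rewrite multilinear_dfwithZ// dfwith_self. Qed.

Lemma tens_multilinear : multilinear (tens (X := X) : XX -> tensor).
Proof.
move=> i x a u v; apply/funext => phi; rewrite /tens.
exact: (mform_multilinear phi).
Qed.

Lemma tens_scale_ord0 c x : tens (scale_ord0 c x) = (c *: (tens x : tensor)) :> tensor.
Proof. by rewrite (multilinear_scale_ord0 _ _ tens_multilinear). Qed.

Lemma prod_nrm_scale_ord0 c x :
  \prod_i nrm (scale_ord0 c x i) = nrm (c : K^o) * \prod_i nrm (x i).
Proof.
rewrite (bigD1 ord0)//= [in RHS](bigD1 ord0)//= mulrA; congr (_ * _).
  by rewrite /scale_ord0 dfwithin nrmZ.
by apply: eq_bigr => i i0; rewrite /scale_ord0 dfwithout// eq_sym.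
Qed.

Lemma prod_nrm_ge0 (x : XX) : 0 <= \prod_i nrm (x i).
Proof. by apply: prodr_ge0 => i _; exact: nrm_ge0. Qed.

Lemma representsE (s : seq XX) (u : tensor) : represents s u ->
  forall phi, u phi = \sum_(x <- s) phi x.
Proof. by move=> -> phi; rewrite fct_sumE. Qed.

Lemma representsD (s1 s2 : seq XX) (u1 u2 : tensor) :
  represents s1 u1 -> represents s2 u2 -> represents (s1 ++ s2) (u1 + u2).
Proof. by rewrite /represents big_cat/= => -> ->. Qed.

Lemma representsZ c (s : seq XX) (u : tensor) :
  represents s u -> represents (map (scale_ord0 c) s) (c *: u).
Proof.
move=> ->; rewrite /represents big_map.
transitivity (\sum_(x <- s) (c *: (tens x : tensor)) : tensor); first by rewrite scaler_sumr.
by apply: eq_bigr => x _; rewrite tens_scale_ord0.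
Qed.

Lemma represents_tens (x : XX) : represents [:: x] (tens x).
Proof. by rewrite /represents big_seq1. Qed.

Lemma is_tensor_tens x : is_tensor (tens x : tensor).
Proof. by exists [:: x]; exact: represents_tens. Qed.

Lemma is_tensorD (u v : tensor) : is_tensor u -> is_tensor v -> is_tensor (u + v : tensor).
Proof. by move=> [s su] [s' sv]; exists (s ++ s'); exact: representsD. Qed.

Lemma is_tensorZ c (u : tensor) : is_tensor u -> is_tensor (c *: u : tensor).
Proof. by move=> [s su]; exists (map (scale_ord0 c) s); exact: representsZ. Qed.

Lemma is_tensorB (u v : tensor) : is_tensor u -> is_tensor v -> is_tensor (u - v : tensor).
Proof. by move=> hu hv; rewrite -scaleN1r; apply: is_tensorD => //; exact: is_tensorZ. Qed.

Lemma is_tensor0 : is_tensor (0 : tensor).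
Proof. by exists [::]; rewrite /represents big_nil. Qed.

Lemma is_tensor_sum (I : Type) (s : seq I) (u : I -> tensor) :
  (forall i, is_tensor (u i)) -> is_tensor (\sum_(i <- s) u i : tensor).
Proof. by move=> h; elim/big_ind: _ => //; [exact: is_tensor0|exact: is_tensorD]. Qed.

Definition seq_cost (s : seq XX) : R := \sum_(x <- s) \prod_i nrm (x i).

Lemma seq_cost_ge0 s : 0 <= seq_cost s.
Proof. by apply: sumr_ge0 => x _; exact: prod_nrm_ge0. Qed.

Section projective_norm.
Implicit Types u v : tensor.

Lemma proj_norm_le u s : represents s u -> proj_norm u <= seq_cost s.
Proof.
move=> su; apply: ge_inf; last by exists s.
by exists 0 => _ [s' _ <-]; exact: seq_cost_ge0.
Qed.

Lemma le_proj_norm u c : is_tensor u ->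
  (forall s, represents s u -> c <= seq_cost s) -> c <= proj_norm u.
Proof.
move=> [s su] h; apply: lb_le_inf; first by exists (seq_cost s), s.
by move=> _ [s' s'u <-]; exact: h.
Qed.

Lemma proj_norm_ge0 u : is_tensor u -> 0 <= proj_norm u.
Proof. by move=> tu; apply: le_proj_norm => // s _; exact: seq_cost_ge0. Qed.

Lemma proj_normD u v : is_tensor u -> is_tensor v ->
  proj_norm (u + v : tensor) <= proj_norm u + proj_norm v.
Proof.
move=> tu tv; rewrite -lerBlDr; apply: le_proj_norm => // s su.
rewrite lerBlDr -lerBlDl; apply: le_proj_norm => // s' sv; rewrite lerBlDl.
by rewrite /seq_cost -big_cat; apply: proj_norm_le; exact: representsD.
Qed.

Lemma proj_norm_tens x : proj_norm (tens x : tensor) <= \prod_i nrm (x i).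
Proof. by have := proj_norm_le (represents_tens x); rewrite /seq_cost big_seq1. Qed.

Lemma proj_norm0 : proj_norm (0 : tensor) = 0.
Proof.
apply/eqP; rewrite eq_le proj_norm_ge0 ?andbT; last exact: is_tensor0.
have h : represents [::] (0 : tensor) by rewrite /represents big_nil.
by have := proj_norm_le h; rewrite /seq_cost big_nil.
Qed.

Let proj_normZ_le c u : is_tensor u ->
  proj_norm (c *: u : tensor) <= nrm (c : K^o) * proj_norm u.
Proof.
move=> tu; have [->|c0] := eqVneq c 0.
  by rewrite scale0r proj_norm0 (nrm0 K^o) mul0r.
have c_gt0 : 0 < nrm (c : K^o) by rewrite lt_def nrm_ge0 (nrm_eq0 (c : K^o)) c0.
rewrite -ler_pdivrMl//; apply: le_proj_norm => // s su; rewrite ler_pdivrMl//.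
apply: (le_trans (proj_norm_le (representsZ c su))).
rewrite /seq_cost big_map big_distrr/=.
by apply: ler_sum => x _; rewrite prod_nrm_scale_ord0.
Qed.

Lemma proj_normZ c u : is_tensor u ->
  proj_norm (c *: u : tensor) = nrm (c : K^o) * proj_norm u.
Proof.
move=> tu; apply/eqP; rewrite eq_le proj_normZ_le//=.
have [->|c0] := eqVneq c 0.
  by rewrite (nrm0 K^o) mul0r; apply: proj_norm_ge0; exact: is_tensorZ.
have c_gt0 : 0 < nrm (c : K^o) by rewrite lt_def nrm_ge0 (nrm_eq0 (c : K^o)) c0.
have := proj_normZ_le c^-1 (is_tensorZ c tu).
by rewrite scalerA mulVf// scale1r nrm_scalarV ler_pdivlMl.
Qed.

End projective_norm.
End multilinear_theory.

(** * Duality: norming functionals for vectors and for tensors *)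

Section dual_theory.
Variables (R : realType) (k : scalar_kind).
Local Notation K := (scalars R k).
Variable V : normedModType K.

Lemma dual_ballP (f : dual V) : nrm f <= 1 <-> forall v, nrm (f v) <= nrm v.
Proof.
rewrite dual_nrmE; split=> [f1 v|h].
  by apply: (le_trans (dual_normP f v)); rewrite ler_piMl// nrm_ge0.
by apply: dual_norm_le => v v1; apply: (le_trans (h v)).
Qed.

Lemma dualB (f : dual V) u v : f (u - v) = f u - f v.
Proof. by rewrite addrC -scaleN1r (dual_linear f) scaleN1r addrC. Qed.

Lemma dual_sum (f : dual V) (I : Type) (s : seq I) (c : I -> K^o) (v : I -> V) :
  f (\sum_(i <- s) (c i : K) *: v i) = \sum_(i <- s) c i * f (v i).
Proof.
elim: s => [|i s ih]; first by rewrite !big_nil dual0.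
by rewrite !big_cons (dual_linear f) ih.
Qed.

Lemma dual_bound_subproof (f : V -> K^o) : linear f ->
  (forall v, nrm (f v) <= nrm v) -> f \in @dual_pred R k V.
Proof.
by move=> fl f1; rewrite !inE; split=> //; exists 1 => v; rewrite mul1r.
Qed.

Lemma dual_of_bound (f : V -> K^o) : linear f -> (forall v, nrm (f v) <= nrm v) ->
  exists2 g : dual V, nrm g <= 1 & forall v, g v = f v.
Proof.
move=> fl f1; exists (Dual (dual_bound_subproof fl f1)) => //.
exact/dual_ballP.
Qed.

Lemma dual_norming v : exists2 f : dual V, nrm f <= 1 & nrm (f v) = nrm v.
Proof.
have [//|//|u w _ _|l w _||F [Fl F1 Fv]] := @hahn_banach R k V setT (@nrm R k V) v.
- exact: ler_nrmD.
- exact: nrmZ.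
- by [].
have [| |f f1 fE] := @dual_of_bound F.
- by move=> a u w; exact: Fl.
- by move=> w; exact: F1.
by exists f => //; rewrite fE.
Qed.

Lemma nrm_le_dual v M : (forall f : dual V, nrm f <= 1 -> nrm (f v) <= M) -> nrm v <= M.
Proof. by move=> h; have [f f1 <-] := dual_norming v; exact: h. Qed.

End dual_theory.

Section bidual.
Variables (R : realType) (k : scalar_kind).
Local Notation K := (scalars R k).
Variable V : normedModType K.

(** The evaluations at vectors of the unit ball belong to the bidual ball and already recover the
    dual norm. *)
Lemma nrm_le_bidual (y : dual V) M :
  (forall f : dual (dual V), nrm f <= 1 -> nrm (f y) <= M) -> nrm y <= M.
Proof.
move=> h; rewrite dual_nrmE; apply: dual_norm_le => v v1.
have [| |f f1 fE] := @dual_of_bound R k (dual V) (fun y : dual V => y v).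
- by [].
- move=> z; apply: (le_trans (dual_normP z v)).
  by rewrite dual_nrmE ler_piMr// dual_norm_ge0.
by rewrite -fE; exact: h.
Qed.

End bidual.

Section tensor_duality.
Variables (R : realType) (k : scalar_kind) (n : nat).
Local Notation K := (scalars R k).
Variables (X : 'I_n.+1 -> completeNormedModType K).
Local Notation XX := (forall i, X i).
Local Notation tensor := (mform X -> K^o).

Lemma bmform_ballP (phi : bmform X) :
  bmform_ball phi <-> forall x, nrm (phi x) <= \prod_i nrm (x i).
Proof.
have [M phiM] := bmform_bounded phi.
have hs : has_sup [set nrm (phi x) | x in [set x : XX | forall i, nrm (x i) <= 1]].
  split; first by exists (nrm (phi (fun=> 0))), (fun=> 0) => //= i; rewrite nrm0.
  exists `|M| => _ [x /= x1 <-]; apply: (le_trans (phiM x)).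
  apply: (@le_trans _ _ (`|M| * \prod_i nrm (x i))).
    by rewrite ler_wpM2r ?prod_nrm_ge0// ler_norm.
  rewrite ler_piMr//; elim/big_rec: _ => // i y _ y1.
  have x1i := x1 i; have xi0 := nrm_ge0 (x i).
  by rewrite (le_trans (ler_wpM2l xi0 y1))// mulr1.
split=> [phi1 x|h]; last first.
  apply: ge_sup; first by have [] := hs.
  move=> _ [x /= x1 <-]; apply: (le_trans (h x)).
  elim/big_rec: _ => // i y _ y1.
  have x1i := x1 i; have xi0 := nrm_ge0 (x i).
  by rewrite (le_trans (ler_wpM2l xi0 y1))// mulr1.
have [[i xi0]|xn0] := pselect (exists i, nrm (x i) = 0).
  by rewrite (multilinear_eq0 (mform_multilinear phi) (nrm0_eq0 xi0)) nrm0 prod_nrm_ge0.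
have xp i : 0 < nrm (x i).
  rewrite lt_def nrm_ge0 andbT; apply/negP => /eqP xi0; by apply: xn0; exists i.
pose c i := of_real k (nrm (x i))^-1.
have nc i : nrm (c i : K^o) = (nrm (x i))^-1 by rewrite nrm_of_real// invr_ge0 ltW.
have : nrm (phi (fun i => c i *: x i)) <= 1.
  apply: le_trans phi1; apply: sup_ubound; first by have [] := hs.
  by exists (fun i => c i *: x i) => //= i; rewrite nrmZ nc mulVf// gt_eqF.
rewrite (multilinear_scale (mform_multilinear phi)) nrmZ.
have -> : nrm (\prod_i c i : K^o) = (\prod_i nrm (x i))^-1.
  rewrite -prodfV; elim/big_rec2: _ => [|i y z _ <-]; first exact: nrm_scalar1.
  by rewrite nrm_scalarM nc.
by rewrite mulrC ler_pdivrMr ?mul1r// prodr_gt0.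
Qed.

Lemma nrm_tensor_le (phi : bmform X) (u : tensor) : bmform_ball phi -> is_tensor u ->
  nrm (u phi : K^o) <= proj_norm u.
Proof.
move=> /bmform_ballP phi1 tu; apply: le_proj_norm => // s su.
rewrite (representsE su); apply: (le_trans (ler_nrm_sum _ _ _)).
by apply: ler_sum => x _; exact: phi1.
Qed.

(** The bound on elementary tensors puts every form dominated by [N] into the unit ball. *)
Definition tensor_seminorm (N : tensor -> R) : Prop :=
  [/\ forall u v, is_tensor u -> is_tensor v -> N (u + v) <= N u + N v,
    forall (l : K) u, is_tensor u -> N (l *: u) = nrm (l : K^o) * N u &
    forall x, N (tens x) <= \prod_i nrm (x i)].

Lemma tensor_hahn_banach (N : tensor -> R) (u : tensor) :
  tensor_seminorm N -> is_tensor u ->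
  exists phi : bmform X, [/\ bmform_ball phi,
    forall v : tensor, is_tensor v -> nrm (v phi : K^o) <= N v &
    nrm (u phi : K^o) = N u].
Proof.
move=> [ND NZ Nle] tu.
have [] := @hahn_banach R k tensor (@is_tensor R k n X) N u.
- exact: is_tensorD.
- exact: is_tensorZ.
- exact: ND.
- exact: NZ.
- exact: tu.
move=> F [Fl FN Fu].
have phim : multilinear (fun x : XX => F (tens x)).
  move=> i x a v w; rewrite (@tens_multilinear _ _ _ _ i x a v w).
  by rewrite Fl//; exact: is_tensor_tens.
have phib : exists M : R, forall x, nrm (MForm phim x) <= M * \prod_i nrm (x i).
  exists 1 => x; rewrite mul1r/=; apply: le_trans (Nle x).
  by apply: FN; exact: is_tensor_tens.
pose phi := BMForm phib.
have F0 : F 0 = 0.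
  have := Fl (-1) 0 0 (is_tensor0 X) (is_tensor0 X).
  by rewrite scaler0 addr0 scaleN1r addNr.
(* The functional F is recovered as evaluation at [phi], because the two agree on elementary tensors
   and these span. *)
have FE v : is_tensor v -> v phi = F v.
  move=> [s sv]; rewrite (representsE sv) sv.
  elim: s {sv} => [|x s ih]; first by rewrite !big_nil F0.
  rewrite !big_cons ih -[tens x + _](_ : 1 *: (tens x : tensor) + \sum_(y <- s) tens y = _);
    last by rewrite scale1r.
  rewrite Fl ?scale1r//; first exact: is_tensor_tens.
  by apply: is_tensor_sum => y; exact: is_tensor_tens.
exists phi; split.
- by apply/bmform_ballP => x; apply: le_trans (Nle x); apply: FN; exact: is_tensor_tens.
- by move=> v tv; rewrite FE//; exact: FN.
- by rewrite FE.
Qed.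

Lemma proj_norm_seminorm : tensor_seminorm (@proj_norm R k n X).
Proof. by split; [exact: proj_normD|exact: proj_normZ|exact: proj_norm_tens]. Qed.

Lemma proj_norm_norming (u : tensor) : is_tensor u ->
  exists2 phi : bmform X, bmform_ball phi & nrm (u phi : K^o) = proj_norm u.
Proof.
by move=> /(tensor_hahn_banach proj_norm_seminorm)[phi [phi1 _ phiu]]; exists phi.
Qed.

End tensor_duality.

(** * Exponents and weak norms *)

Section exponents.
Variable R : realType.
Implicit Types p q : \bar R.

Definition exponent_inv p : R := if p is p'%:E then p'^-1 else 0.

Lemma exponent_inv_ge0 p : (1 <= p)%E -> 0 <= exponent_inv p.
Proof. by move=> /ge1_cases[->|[p' -> p1]] //=; rewrite invr_ge0; lra. Qed.

(** With t = 1/p + 1/q the conjugate of r is s = 1/t. It is infinite exactly for t = 0, that is for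
    p = q = [+oo]; the case t = 1 is r = [+oo], s = 1. *)
Lemma third_exponent_cases p q : (1 <= p)%E -> (1 <= q)%E -> (p^-1 + q^-1 <= 1)%E ->
  [/\ p = +oo%E, q = +oo%E & hoelder_conjugate (third_exponent p q) = +oo%E] \/
  exists s : R, [/\ hoelder_conjugate (third_exponent p q) = s%:E, 1 <= s &
    s * exponent_inv p + s * exponent_inv q = 1].
Proof.
move=> p1 q1 pq1.
have invE r : (1 <= r)%E -> (r^-1 = (exponent_inv r)%:E)%E.
  move=> /ge1_cases[->|[r' -> r1]] /=; first by rewrite invey.
  by rewrite inver; case: eqVneq => // r0; move: r1; rewrite r0 ler10.
have ipos r : (1 <= r)%E -> exponent_inv r = 0 -> r = +oo%E.
  by move=> /ge1_cases[->|[r' -> r1]] //= /eqP; rewrite invr_eq0 => /eqP r0; move: r1; rewrite r0 ler10.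
have -> : third_exponent p q = ((1 - (exponent_inv p + exponent_inv q))%:E)^-1%E.
  by rewrite /third_exponent (invE _ p1) (invE _ q1).
rewrite (invE _ p1) (invE _ q1) -EFinD lee_fin in pq1.
have p0 := exponent_inv_ge0 p1; have q0 := exponent_inv_ge0 q1.
set t := exponent_inv p + exponent_inv q in pq1 *.
have [t0|t_neq0] := eqVneq t 0.
  have h1 : exponent_inv p = 0 by move: p0 q0 t0; rewrite /t; clear; lra.
  have h2 : exponent_inv q = 0 by move: p0 q0 t0; rewrite /t; clear; lra.
  left; split; [exact: ipos|exact: ipos|].
  rewrite t0 subr0 inver oner_eq0 invr1 /hoelder_conjugate eqe /=.
  by rewrite subee//= inve0 mul1e oner_eq0.
have tp : 0 < t by rewrite lt_def t_neq0 addr_ge0.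
right; exists t^-1; split; last by rewrite -mulrDr mulVf.
  have [t1|t_neq1] := eqVneq t 1.
    by rewrite t1 subrr inve0 /hoelder_conjugate/= invr1.
  have t1 : 1 - t != 0 by rewrite subr_eq0 eq_sym.
  rewrite inver (negbTE t1) /hoelder_conjugate /= !eqe invr_eq0 (negbTE t1).
  rewrite -EFinB inver.
  have E : (1 - t)^-1 - 1 = t / (1 - t) by field.
  rewrite E; case: eqVneq => [/eqP|_].
    by rewrite mulf_eq0 invr_eq0 (negbTE t1) (negbTE t_neq0).
  rewrite -EFinM; congr EFin; field; by rewrite t1 t_neq0.
by rewrite invf_ge1.
Qed.

End exponents.

Section weak_norms.
Variables (R : realType) (k : scalar_kind) (n : nat).
Local Notation K := (scalars R k).
Variables (X : 'I_n.+1 -> completeNormedModType K).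
Local Notation XX := (forall i, X i).
Local Notation tensor := (mform X -> K^o).

Definition tens_diff (x z : XX) : tensor := (tens x : tensor) - tens z.

Lemma is_tensor_diff x z : is_tensor (tens_diff x z).
Proof. by apply: is_tensorB; exact: is_tensor_tens. Qed.

Lemma tens_diff_scale c x z : tens_diff (scale_ord0 c x) (scale_ord0 c z) =
  c *: tens_diff x z.
Proof. by rewrite /tens_diff !tens_scale_ord0 scalerBr. Qed.

Lemma nrm_diff_le (phi : bmform X) x z : bmform_ball phi ->
  nrm ((phi x : K^o) - phi z) <= proj_norm (tens_diff x z).
Proof. by move=> phi1; apply: (@nrm_tensor_le _ _ _ _ phi (tens_diff x z)) => //; exact: is_tensor_diff. Qed.

Section proj.
Variables (p : \bar R) (m : nat) (x z : 'I_m -> XX).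
Hypothesis p1 : (1 <= p)%E.

Lemma weak_proj_normP (phi : bmform X) : bmform_ball phi ->
  lnorm p (fun i => nrm ((phi (x i) : K^o) - phi (z i))) <= weak_proj_norm p x z.
Proof.
move=> phi1; apply: sup_ubound; last by exists phi.
pose M := \sum_i proj_norm (tens_diff (x i) (z i)).
exists (m%:R * M) => _ [psi psi1 <-]; apply: lnorm_le_sum => //.
  by apply: sumr_ge0 => i _; apply: proj_norm_ge0; exact: is_tensor_diff.
move=> i; rewrite nrm_ge0 (le_trans (nrm_diff_le _ _ psi1))// /M (bigD1 i)//= lerDl.
by apply: sumr_ge0 => j _; apply: proj_norm_ge0; exact: is_tensor_diff.
Qed.

Lemma weak_proj_norm_le_ball M :
  (forall phi : bmform X, bmform_ball phi ->
    lnorm p (fun i => nrm ((phi (x i) : K^o) - phi (z i))) <= M) ->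
  weak_proj_norm p x z <= M.
Proof.
move=> h; apply: ge_sup; last by move=> _ [phi phi1 <-]; exact: h.
have [phi phi1 _] := proj_norm_norming (is_tensor0 X).
by eexists; exists phi.
Qed.

Lemma weak_proj_norm_ge0 : 0 <= weak_proj_norm p x z.
Proof.
have [phi phi1 _] := proj_norm_norming (is_tensor0 X).
exact: le_trans (lnorm_ge0 _ _) (weak_proj_normP phi1).
Qed.

End proj.

Variable V : normedModType K.

Section weak.
Variables (p : \bar R) (m : nat) (y : 'I_m -> V).
Hypothesis p1 : (1 <= p)%E.

Lemma weak_normP (f : dual V) : nrm f <= 1 ->
  lnorm p (fun i => nrm (f (y i))) <= weak_norm p y.
Proof.
move=> f1; apply: sup_ubound; last by exists f.
pose M := \sum_i nrm (y i).
exists (m%:R * M) => _ [g g1 <-]; apply: lnorm_le_sum => //.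
  by apply: sumr_ge0 => i _; exact: nrm_ge0.
move=> i; rewrite nrm_ge0/= (le_trans ((dual_ballP g).1 g1 _))// /M (bigD1 i)//= lerDl.
by apply: sumr_ge0 => j _; exact: nrm_ge0.
Qed.

Lemma weak_norm_le_ball M :
  (forall f : dual V, nrm f <= 1 -> lnorm p (fun i => nrm (f (y i))) <= M) ->
  weak_norm p y <= M.
Proof.
move=> h; apply: ge_sup; last by move=> _ [f f1 <-]; exact: h.
by eexists; exists 0 => //=; rewrite nrm0.
Qed.

Lemma weak_norm_ge0 : 0 <= weak_norm p y.
Proof.
apply: le_trans (lnorm_ge0 _ _) (@weak_normP 0 _); by rewrite nrm0.
Qed.

End weak.
End weak_norms.

(** Norming tested on tensors rather than on the completion, and for indexed families, so that it
    covers the points of a compact set as well as the whole ball. *)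
Definition tensor_norming (R : realType) (k : scalar_kind) (n : nat)
    (X : 'I_n.+1 -> completeNormedModType (scalars R k)) (I : Type)
    (phi : I -> bmform X) : Prop :=
  (forall i, bmform_ball (phi i)) /\
  forall (u : mform X -> (scalars R k)^o) M, is_tensor u -> 0 <= M ->
    (forall i, nrm (u (phi i) : (scalars R k)^o) <= M) -> proj_norm u <= M.

Definition dual_norming_family (R : realType) (k : scalar_kind)
    (V : normedModType (scalars R k)) (I : Type) (f : I -> dual V) : Prop :=
  (forall i, nrm (f i) <= 1) /\
  forall v M, 0 <= M -> (forall i, nrm (f i v) <= M) -> nrm v <= M.

Section norming_weak.
Variables (R : realType) (k : scalar_kind).
Local Notation K := (scalars R k).

(** A linear combination of the differences is again a tensor, so the norming family controls all
    scalar combinations; [lnorm_norming] passes from these to the l_p norm. *)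
Lemma weak_proj_norm_norming (n : nat) (X : 'I_n.+1 -> completeNormedModType K)
    (I : Type) (phi : I -> bmform X) (p : \bar R) (m : nat) (x z : 'I_m -> forall i, X i) M :
  (1 <= p)%E -> tensor_norming phi -> 0 <= M ->
  (forall s, lnorm p (fun i => nrm ((phi s (x i) : K^o) - phi s (z i))) <= M) ->
  weak_proj_norm p x z <= M.
Proof.
move=> p1 [_ phiN] M0 phiM; apply: weak_proj_norm_le_ball => psi psi1.
apply: (lnorm_norming p1 M0 _ phiM) => a M' M'0 h.
pose u : mform X -> K^o := \sum_i (a i : K) *: tens_diff (x i) (z i).
have tu : is_tensor u by apply: is_tensor_sum => i; apply: is_tensorZ; exact: is_tensor_diff.
have uE (f : bmform X) : u f = \sum_i a i * ((f (x i) : K^o) - f (z i)).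
  by rewrite /u fct_sumE.
rewrite -uE (le_trans (nrm_tensor_le psi1 tu))// phiN// => s.
by rewrite uE.
Qed.

Lemma weak_norm_norming (V : normedModType K) (I : Type) (f : I -> dual V)
    (p : \bar R) (m : nat) (v : 'I_m -> V) M :
  (1 <= p)%E -> dual_norming_family f -> 0 <= M ->
  (forall s, lnorm p (fun i => nrm (f s (v i))) <= M) -> weak_norm p v <= M.
Proof.
move=> p1 [_ fN] M0 fM; apply: weak_norm_le_ball => g g1.
apply: (lnorm_norming p1 M0 _ fM) => a M' M'0 h.
rewrite -dual_sum (le_trans ((dual_ballP g).1 g1 _))// fN// => s.
by rewrite dual_sum.
Qed.

End norming_weak.

(** * The domination theorem with means in place of measures *)

Section mean_domination.
Variables (R : realType) (k : scalar_kind) (n : nat).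
Local Notation K := (scalars R k).
Variables (X : 'I_n.+1 -> completeNormedModType K) (Y : normedModType K).
Local Notation XX := (forall i, X i).
Variables (I I' : Type) (phi : I -> bmform X) (f : I' -> dual (dual Y)).

Definition mean_factor (p : \bar R) (L : mean R I) (x z : XX) : R :=
  if p is p'%:E then L (fun i => nrm ((phi i x : K^o) - phi i z) `^ p') `^ p'^-1
  else proj_norm (tens_diff x z).

Definition mean_dual_factor (q : \bar R) (G : mean R I') (y : dual Y) : R :=
  if q is q'%:E then G (fun i => nrm (f i y) `^ q') `^ q'^-1 else nrm y.

(** Allows normalization by b + e where the norm b may vanish. *)
Lemma le_mul_addgt0 (v a b : R) : 0 <= a ->
  (forall e, 0 < e -> v <= a * (b + e)) -> v <= a * b.
Proof.
move=> a0 h; apply/ler_addgt0Pr => e e0.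
have a1 : 0 < a + 1 by lra.
apply: (le_trans (h (e / (a + 1)) (divr_gt0 e0 a1))).
rewrite mulrDr lerD2l mulrCA ler_piMr ?(ltW e0)// ler_pdivrMr//; lra.
Qed.

Hypotheses (phiN : tensor_norming phi) (fN : dual_norming_family f).

Lemma bounded_mean_factor (p : R) x z : 0 <= p ->
  bounded_real (fun i => nrm ((phi i x : K^o) - phi i z) `^ p).
Proof.
move=> p0; apply: (@bounded_real_ge0 _ _ _ (proj_norm (tens_diff x z) `^ p)) => i.
rewrite powR_ge0 ge0_ler_powR ?nnegrE ?nrm_ge0//.
  by apply: proj_norm_ge0; exact: is_tensor_diff.
exact/nrm_diff_le/phiN.1.
Qed.

Lemma bounded_mean_dual_factor (q : R) y : 0 <= q ->
  bounded_real (fun i => nrm (f i y) `^ q).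
Proof.
move=> q0; apply: (@bounded_real_ge0 _ _ _ (nrm y `^ q)) => i.
rewrite powR_ge0 ge0_ler_powR ?nnegrE ?nrm_ge0//.
exact/(dual_ballP _).1/fN.1.
Qed.

Lemma mean_factor_ge0 p L x z : 0 <= mean_factor p L x z.
Proof.
case: p => [p||]; rewrite ?powR_ge0//;
by apply: proj_norm_ge0; exact: is_tensor_diff.
Qed.

Lemma mean_dual_factor_ge0 q G y : 0 <= mean_dual_factor q G y.
Proof. by case: q => [q||]; rewrite ?powR_ge0// nrm_ge0. Qed.

Variables (p q : \bar R) (T : XX -> Y) (C : R).
Hypotheses (p1 : (1 <= p)%E) (q1 : (1 <= q)%E) (pq1 : (p^-1 + q^-1 <= 1)%E).
Hypotheses (Tm : multilinear T) (TC : dominated_bound p q T C).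

Let C0 : 0 < C. Proof. exact: TC.1. Qed.

(* The two factors at exponent [+oo] are normalized to 1 on admissible triples. *)
Definition admissible (j : XX * XX * dual Y) : Prop :=
  (p = +oo%E -> proj_norm (tens_diff j.1.1 j.1.2) <= 1) /\ (q = +oo%E -> nrm j.2 <= 1).

Let J := {j : XX * XX * dual Y | admissible j}.
Let jx (j : J) : XX := (sval j).1.1.
Let jz (j : J) : XX := (sval j).1.2.
Let jy (j : J) : dual Y := (sval j).2.
Let ip := exponent_inv p.
Let iq := exponent_inv q.

(** For an infinite exponent the power [ip] is 0, so the mean of this zero function contributes the
    factor 1. *)
Let F (x z : XX) (i : I) : R :=
  if p is p'%:E then nrm ((phi i x : K^o) - phi i z) `^ p' else 0.
Let Gf (y : dual Y) (i : I') : R := if q is q'%:E then nrm (f i y) `^ q' else 0.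

Let F_ge0 x z i : 0 <= F x z i.
Proof. by rewrite /F; case: (p) => // r; rewrite powR_ge0. Qed.

Let Gf_ge0 y i : 0 <= Gf y i.
Proof. by rewrite /Gf; case: (q) => // r; rewrite powR_ge0. Qed.

Let F_bounded x z : bounded_real (F x z).
Proof.
rewrite /F; have [->|[p' -> p'1]] := ge1_cases p1; first exact: bounded_real_cst.
by apply: bounded_mean_factor; apply: le_trans p'1.
Qed.

Let Gf_bounded y : bounded_real (Gf y).
Proof.
rewrite /Gf; have [->|[q' -> q'1]] := ge1_cases q1; first exact: bounded_real_cst.
by apply: bounded_mean_dual_factor; apply: le_trans q'1.
Qed.

Let nrm_powR_of_real (c r : R) : nrm (of_real k (c `^ r) : K^o) = c `^ r.
Proof. by rewrite nrm_of_real// powR_ge0. Qed.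

Let T_scale c x z (y : dual Y) : nrm (y (T (scale_ord0 c x) - T (scale_ord0 c z))) =
  nrm (c : K^o) * nrm (y (T x - T z)).
Proof. by rewrite !(multilinear_scale_ord0 _ _ Tm) -scalerBr dualZ nrmZ. Qed.

(** Scale x and z by c^(1/p) and y by d^(1/q). For an infinite exponent this scalar is 1, which
    preserves admissibility. *)
Let scaleJ (j : J) c d : 0 < c -> 0 < d -> exists j' : J,
  [/\ nrm (jy j' (T (jx j') - T (jz j'))) = c `^ ip * d `^ iq * nrm (jy j (T (jx j) - T (jz j))),
      forall i, F (jx j') (jz j') i = c * F (jx j) (jz j) i &
      forall i, Gf (jy j') i = d * Gf (jy j) i].
Proof.
move=> c0 d0; case: j => -[[x z] y] [/= adp adq].
pose c' := of_real k (c `^ ip); pose d' := of_real k (d `^ iq).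
have ad : admissible (scale_ord0 c' x, scale_ord0 c' z, d' *: y).
  split=> [pE|qE] /=.
    rewrite tens_diff_scale proj_normZ; last exact: is_tensor_diff.
    by rewrite nrm_powR_of_real /ip pE powRr0 mul1r adp.
  by rewrite nrmZ nrm_powR_of_real /iq qE powRr0 mul1r adq.
exists (exist _ _ ad); rewrite /jx /jz /jy /=; split=> [|i|i].
- rewrite -[LHS]/(nrm (d' *: y (T (scale_ord0 c' x) - T (scale_ord0 c' z)))).
  by rewrite nrmZ T_scale !nrm_powR_of_real mulrA [d `^ _ * _]mulrC.
- rewrite /F; have [pE|[p' pE p'1]] := ge1_cases p1; rewrite pE; first by rewrite mulr0.
  have p'0 : 0 < p' by rewrite (lt_le_trans ltr01).
  rewrite !(multilinear_scale_ord0 _ _ (mform_multilinear (phi i))) -scalerBr nrmZ.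
  by rewrite nrm_powR_of_real powRM ?powR_ge0 ?nrm_ge0// /ip pE powRVK// ltW.
- rewrite /Gf; have [qE|[q' qE q'1]] := ge1_cases q1; rewrite qE; first by rewrite mulr0.
  have q'0 : 0 < q' by rewrite (lt_le_trans ltr01).
  rewrite dualZ nrmZ.
  by rewrite nrm_powR_of_real powRM ?powR_ge0 ?nrm_ge0// /iq qE powRVK// ltW.
Qed.

(** The norming families bound the weak norms by A^(1/p) and B^(1/q), and the domination inequality
    is divided by C and raised to the power s. For an infinite exponent admissibility bounds the
    weak norm by 1, which is the zeroth power. *)
Let domJ (s : R) : hoelder_conjugate (third_exponent p q) = s%:E -> 1 <= s ->
  forall (l : seq J) A B, 0 <= A -> 0 <= B ->
  (forall i, \sum_(j <- l) F (jx j) (jz j) i <= A) ->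
  (forall i, \sum_(j <- l) Gf (jy j) i <= B) ->
  \sum_(j <- l) (nrm (jy j (T (jx j) - T (jz j))) / C) `^ s <=
  A `^ (s * ip) * B `^ (s * iq).
Proof.
move=> sE s1 l A B A0 B0 FA GB; have s0 : 0 < s by rewrite (lt_le_trans ltr01).
pose m := size l; pose jt (i : 'I_m) := tnth (in_tuple l) i.
have := TC.2 m (jx \o jt) (jz \o jt) (jy \o jt); rewrite sE.
have wp0 := weak_proj_norm_ge0 (jx \o jt) (jz \o jt) p1.
have wq0 := weak_norm_ge0 (jy \o jt) q1.
have wp : weak_proj_norm p (jx \o jt) (jz \o jt) <= A `^ ip.
  apply: (weak_proj_norm_norming p1 phiN); first exact: powR_ge0.
  move=> i; have := FA i; rewrite (big_tnth _ _ l) /F /ip.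
  have [pE|[p' pE p'1]] := ge1_cases p1; rewrite pE => FA'.
    apply/lnorm_pinfty_le => [|j]; first exact: powR_ge0.
    rewrite /= powRr0 (le_trans (nrm_diff_le _ _ (phiN.1 i)))//.
    by have [+ _] := svalP (jt j); apply.
  have p'0 : 0 < p' by rewrite (lt_le_trans ltr01).
  by rewrite lnorm_fin_le ?powR_ge0// powRVK.
have wq : weak_norm q (jy \o jt) <= B `^ iq.
  apply: (weak_norm_norming q1 fN); first exact: powR_ge0.
  move=> i; have := GB i; rewrite (big_tnth _ _ l) /Gf /iq.
  have [qE|[q' qE q'1]] := ge1_cases q1; rewrite qE => GB'.
    apply/lnorm_pinfty_le => [|j]; first exact: powR_ge0.
    rewrite /= powRr0 (le_trans ((dual_ballP _).1 (fN.1 i) _))//.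
    by have [_ +] := svalP (jt j); apply.
  have q'0 : 0 < q' by rewrite (lt_le_trans ltr01).
  by rewrite lnorm_fin_le ?powR_ge0// powRVK.
move=> h; have {h} : lnorm s%:E (fun i => nrm (jy (jt i) (T (jx (jt i)) - T (jz (jt i))))) <=
    C * (A `^ ip * B `^ iq).
  apply: (le_trans h); rewrite -mulrA ler_wpM2l ?(ltW C0)//.
  by apply: ler_pM.
rewrite lnorm_fin_le//; last by rewrite !mulr_ge0 ?powR_ge0// ltW.
rewrite powRM ?(ltW C0)// ?mulr_ge0 ?powR_ge0// powRM ?powR_ge0// -!powRrM => h.
rewrite (big_tnth _ _ l).
have E j : (nrm (jy j (T (jx j) - T (jz j))) / C) `^ s =
   (C `^ s)^-1 * nrm (jy j (T (jx j) - T (jz j))) `^ s.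
  rewrite powRM ?nrm_ge0 ?invr_ge0 ?(ltW C0)// mulrC -powRN.
  by congr (_ * _); rewrite -powR_inv1 ?(ltW C0)// -powRrM mulN1r.
under eq_bigr do rewrite E.
by rewrite -big_distrr/= ler_pdivrMl ?powR_gt0// ![s * _]mulrC.
Qed.

Variables (i0 : I) (i0' : I').

Lemma mean_domination : exists (L : mean R I) (G : mean R I'), forall x z (y : dual Y),
  nrm (y (T x - T z)) <= C * mean_factor p L x z * mean_dual_factor q G y.
Proof.
have [[pE qE sE]|[s [sE s1 sip]]] := third_exponent_cases p1 q1 pq1.
  (* Both exponents are infinite: neither factor involves a mean, so arbitrary means serve and
     sequences of length one suffice. *)
  exists (eval_mean R i0), (eval_mean R i0') => x z y.
  have := TC.2 1 (fun=> x) (fun=> z) (fun=> y); rewrite sE => h.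
  have : nrm (y (T x - T z)) <= lnorm +oo%E (fun _ : 'I_1 => nrm (y (T x - T z))).
    by apply: (@lnorm_le_coord R +oo%E 1 (fun=> _) ord0); rewrite ?leey ?nrm_ge0.
  move=> /le_trans; apply; apply: (le_trans h).
  have C0' := ltW C0.
  rewrite pE qE /=.
  apply: ler_pM; rewrite ?mulr_ge0 ?weak_norm_ge0 ?weak_proj_norm_ge0 ?leey//.
    rewrite ler_wpM2l//; apply: weak_proj_norm_le_ball => psi psi1.
    apply/lnorm_pinfty_le => [|i]; first by apply: proj_norm_ge0; exact: is_tensor_diff.
    exact: nrm_diff_le.
  apply: weak_norm_le_ball => g g1; apply/lnorm_pinfty_le => [|i]; first exact: nrm_ge0.
  exact/(dual_ballP g).1.
have s0 : 0 < s by rewrite (lt_le_trans ltr01).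
have ip0 : 0 <= ip by exact: exponent_inv_ge0.
have iq0 : 0 <= iq by exact: exponent_inv_ge0.
pose t (j : J) := (nrm (jy j (T (jx j) - T (jz j))) / C) `^ s.
have [|||||||||L [G LG]] := @pietsch_means R I I' J i0 i0' t
  (fun j => F (jx j) (jz j)) (fun j => Gf (jy j)) (s * ip) (s * iq).
- by rewrite mulr_ge0// ltW.
- by rewrite mulr_ge0// ltW.
- exact: sip.
- by move=> j i; exact: F_ge0.
- by move=> j i; exact: Gf_ge0.
- by move=> j; exact: F_bounded.
- by move=> j; exact: Gf_bounded.
- move=> j c d c0 d0; have [j' [tj' Fj' Gj']] := scaleJ j c0 d0.
  exists j'; split => //; rewrite /t tj' -mulrA powRM ?mulr_ge0 ?powR_ge0 ?nrm_ge0 ?invr_ge0 ?(ltW C0)//.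
  by rewrite powRM ?powR_ge0// -!powRrM ![_ * s]mulrC.
- exact: domJ.
exists L, G.
have key x z (y : dual Y) : admissible (x, z, y) ->
    nrm (y (T x - T z)) <= C * (L (F x z) `^ ip * G (Gf y) `^ iq).
  move=> ad; have := LG (exist _ _ ad); rewrite /t /jx /jz /jy /=.
  rewrite [s * ip]mulrC [s * iq]mulrC !powRrM -powRM ?powR_ge0//.
  have P0 : 0 <= L (F x z) `^ ip * G (Gf y) `^ iq by rewrite mulr_ge0 ?powR_ge0.
  have N0 : 0 <= nrm (y (T x - T z)) / C by rewrite divr_ge0 ?nrm_ge0// ltW.
  by rewrite -(ler_powRV s0)// ?powR_ge0// powRKV// ler_pdivrMr// mulrC.
(* Removes the normalization of the tensor difference by rescaling x and z; the one of y is removed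
   in the same way at the end. *)
have keyp x z (y : dual Y) : (q = +oo%E -> nrm y <= 1) ->
    nrm (y (T x - T z)) <= C * (mean_factor p L x z * G (Gf y) `^ iq).
  move=> ady; have [pE|[p' pE p'1]] := ge1_cases p1; last first.
    rewrite (_ : mean_factor p L x z = L (F x z) `^ ip); first by apply: key; split => //; rewrite pE.
    by rewrite /mean_factor /F /ip pE.
  have N0 : 0 <= proj_norm (tens_diff x z) by apply: proj_norm_ge0; exact: is_tensor_diff.
  rewrite /mean_factor pE mulrCA [leRHS]mulrC; apply: le_mul_addgt0 => [|e e0].
    by rewrite mulr_ge0 ?powR_ge0// ltW.
  have Ne : 0 < proj_norm (tens_diff x z) + e by rewrite ltr_wpDl.
  pose c := of_real k (proj_norm (tens_diff x z) + e)^-1.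
  have nc : nrm (c : K^o) = (proj_norm (tens_diff x z) + e)^-1.
    by rewrite nrm_of_real// invr_ge0 ltW.
  have ad : admissible (scale_ord0 c x, scale_ord0 c z, y).
    split=> // _ /=; rewrite tens_diff_scale proj_normZ; last exact: is_tensor_diff.
    by rewrite nc mulrC ler_pdivrMr// mul1r lerDl ltW.
  have := key _ _ _ ad; rewrite T_scale nc /ip pE powRr0 mul1r.
  by rewrite mulrC ler_pdivrMr.
move=> x z y; have [qE|[q' qE q'1]] := ge1_cases q1; last first.
  rewrite (_ : mean_dual_factor q G y = G (Gf y) `^ iq).
    by rewrite -mulrA; apply: keyp => //; rewrite qE.
  by rewrite /mean_dual_factor /Gf /iq qE.
rewrite /mean_dual_factor qE; apply: le_mul_addgt0 => [|e e0].
  by rewrite mulr_ge0 ?mean_factor_ge0// ltW.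
have Ne : 0 < nrm y + e by rewrite ltr_wpDl ?nrm_ge0.
pose d := of_real k (nrm y + e)^-1.
have nd : nrm (d : K^o) = (nrm y + e)^-1 by rewrite nrm_of_real// invr_ge0 ltW.
have := keyp x z (d *: y).
rewrite nrmZ nd mulrC ler_pdivrMr// mul1r lerDl (ltW e0) => /(_ (fun=> isT)).
rewrite -[X in nrm X <= _ -> _]/(d *: y (T x - T z)) nrmZ nd.
by rewrite /iq qE powRr0 mulr1 mulrC ler_pdivrMr.
Qed.

End mean_domination.

(** * From a mean on a compact Hausdorff space to a regular Borel probability measure *)

Section regular_measure_of_mean.
Variables (R : realType) (T : ptopologicalType) (L : mean R T).
Hypotheses (hT : hausdorff_space T) (cT : compact [set: T]).
Local Notation BT := (g_sigma_algebraType (@open T)).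

Definition mean_set (F : set T) : R := L \1_F.

Lemma bounded_indic (F : set T) : bounded_real (\1_F : T -> R).
Proof. by exists 1 => x; rewrite indicE; case: (_ \in _); rewrite ?normr0 ?normr1. Qed.

Lemma le_mean_set F G : F `<=` G -> mean_set F <= mean_set G.
Proof.
move=> FG; apply: ler_mean => [||x]; [exact: bounded_indic|exact: bounded_indic|].
rewrite !indicE; have [xF|//] := boolP (x \in F).
by rewrite (mem_set (FG _ (set_mem xF))).
Qed.

Lemma mean_setT : mean_set setT = 1.
Proof. by rewrite -[RHS](mean1 L) /mean_set; congr (L _); apply/funext => x; rewrite indicT. Qed.

Lemma mean_set0 : mean_set set0 = 0.
Proof. by rewrite -[RHS](mean_cst L 0) /mean_set; congr (L _); apply/funext => x; rewrite indic0. Qed.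

Lemma mean_setU_le F G H : F `<=` G `|` H -> mean_set F <= mean_set G + mean_set H.
Proof.
move=> FGH; rewrite /mean_set -meanD; [|exact: bounded_indic|exact: bounded_indic].
apply: ler_mean => [||x]; first exact: bounded_indic.
  by apply: bounded_realD; exact: bounded_indic.
rewrite !indicE; have [xF|_] := boolP (x \in F); last by rewrite addr_ge0.
by have [/mem_set -> |/mem_set ->] := FGH _ (set_mem xF); rewrite ?lerDl ?lerDr.
Qed.

Lemma mean_set_disjoint_le F G H : F `<=` H -> G `<=` H -> F `&` G = set0 ->
  mean_set F + mean_set G <= mean_set H.
Proof.
move=> FH GH FG0; rewrite /mean_set -meanD; [|exact: bounded_indic|exact: bounded_indic].
apply: ler_mean => [||x]; last 1 first.
- rewrite !indicE; have [xF|xF] := boolP (x \in F).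
    have -> : x \in G = false.
      apply/negP => xG; have : (F `&` G) x by split; exact: set_mem.
      by rewrite FG0.
    by rewrite (mem_set (FH _ (set_mem xF))) addr0.
  have [xG|_] := boolP (x \in G); last by rewrite addr0.
  by rewrite (mem_set (GH _ (set_mem xG))) add0r.
- by apply: bounded_realD; exact: bounded_indic.
- exact: bounded_indic.
Qed.

(* Content of an open set, approximated from inside by closed sets; extended to
   an outer measure by approximation from outside by open sets, it turns the
   finitely additive [mean_set] into a regular Borel measure. *)
Definition open_content (U : set T) : R :=
  sup [set mean_set F | F in [set F | closed F /\ F `<=` U]].

Lemma open_content_has_sup U :
  has_sup [set mean_set F | F in [set F | closed F /\ F `<=` U]].
Proof.
split; first by exists (mean_set set0), set0 => //; split; [exact: closed0|].
by exists 1 => _ [F _ <-]; rewrite -mean_setT; exact: le_mean_set.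
Qed.

Lemma open_contentP U F : closed F -> F `<=` U -> mean_set F <= open_content U.
Proof. by move=> cF FU; apply: sup_ubound; [exact: (open_content_has_sup U).2|exists F]. Qed.

Lemma open_content_le U c : (forall F, closed F -> F `<=` U -> mean_set F <= c) ->
  open_content U <= c.
Proof.
move=> h; apply: ge_sup; first exact: (open_content_has_sup U).1.
by move=> _ [F [cF FU] <-]; exact: h.
Qed.

Lemma open_content_adherent U e : 0 < e ->
  exists F, [/\ closed F, F `<=` U & open_content U - e < mean_set F].
Proof.
move=> e0; have [_ [F [cF FU] <-] h] := sup_adherent e0 (open_content_has_sup U).
by exists F.
Qed.

Lemma open_content_ge0 U : 0 <= open_content U.
Proof. by rewrite -mean_set0; apply: open_contentP => //; exact: closed0. Qed.

Lemma le_open_content U V : U `<=` V -> open_content U <= open_content V.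
Proof.
by move=> UV; apply: open_content_le => F cF FU; apply: open_contentP => // x /FU/UV.
Qed.

(** For a closed F inside the union, the closed set F \ V lies in U. Normality puts an open W
    between them with closure in U, and F splits into its part in the closure of W, inside U, and
    its part off W, inside V. *)
Lemma open_contentU U V : open U -> open V ->
  open_content (U `|` V) <= open_content U + open_content V.
Proof.
move=> oU oV; apply: open_content_le => F cF FUV.
have cFV : closed (F `\` V) by apply: closedI => //; exact: open_closedC.
have := compact_normal hT cT cFV.
have nU : set_nbhs (F `\` V) U.
  by apply/set_nbhsP; exists U; split=> // x [/FUV[]].
move=> /(_ U nU)[B /set_nbhsP[W [oW FW WB]] BU].
apply: (@le_trans _ _ (mean_set (F `&` closure W) + mean_set (F `\` W))).
  apply: mean_setU_le => x Fx; have [Wx|Wx] := pselect (W x); last by right.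
  by left; split => //; exact: subset_closure.
apply: lerD; apply: open_contentP.
- by apply: closedI => //; exact: closed_closure.
- by move=> x [_ /(closureS WB)/BU].
- by apply: closedI => //; exact: open_closedC.
- move=> x [Fx nWx]; apply: contrapT => nVx; apply: nWx; exact: FW.
Qed.

Lemma open_content_bigsetU (U : (set T)^nat) N : (forall n, open (U n)) ->
  open_content (\big[setU/set0]_(n < N) U n) <= \sum_(n < N) open_content (U n).
Proof.
move=> oU; elim: N => [|N ih].
  rewrite !big_ord0; apply: open_content_le => F _ F0.
  by rewrite -mean_set0; exact: le_mean_set.
rewrite !big_ord_recr/=; apply: (le_trans (open_contentU _ (oU N))).
  by rewrite -bigcup_mkord; exact: bigcup_open.
by rewrite lerD2r.
Qed.

(** A nearly optimal closed subset of the union is compact, hence covered by finitely many of the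
    open sets; this turns finite into countable subadditivity. *)
Lemma open_content_bigcup (U : (set T)^nat) : (forall n, open (U n)) ->
  ((open_content (\bigcup_n U n))%:E <= \sum_(n <oo) (open_content (U n))%:E)%E.
Proof.
move=> oU; apply/lee_addgt0Pr => e e0.
have [F [cF FU Fe]] := open_content_adherent (\bigcup_n U n) e0.
have cptF : compact F by exact: (subclosed_compact cF cT).
have [D' _ FD'] : finite_subset_cover setT U F.
  by move: cptF; rewrite compact_cover; apply.
(* The successor is there because the finite union runs over indices strictly below [N]. *)
pose N := (\max_(i <- enum_fset D') i).+1.
have FN : F `<=` \big[setU/set0]_(n < N) U n.
  move=> x /FD'[i /= iD' Uix]; rewrite -bigcup_mkord; exists i => //=.
  rewrite /N ltnS; exact: leq_bigmax_seq.
apply: (@le_trans _ _ ((\sum_(n < N) open_content (U n))%:E + e%:E)%E).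
  rewrite -EFinD lee_fin; have := open_contentP cF FN.
  have := open_content_bigsetU N oU; lra.
rewrite leeD2r// -sumEFin.
have := @nneseries_lim_ge R (fun n => (open_content (U n))%:E) xpredT 0 N.
by rewrite big_mkord; apply => n _ _; rewrite lee_fin open_content_ge0.
Qed.

Definition outer_content (A : set T) : R :=
  inf [set open_content U | U in [set U | open U /\ A `<=` U]].

Lemma outer_content_has_inf A :
  has_inf [set open_content U | U in [set U | open U /\ A `<=` U]].
Proof.
split; first by exists (open_content setT), setT => //; split => //; exact: openT.
by exists 0 => _ [U _ <-]; exact: open_content_ge0.
Qed.

Lemma outer_contentP A U : open U -> A `<=` U -> outer_content A <= open_content U.
Proof. by move=> oU AU; apply: ge_inf; [exact: (outer_content_has_inf A).2|exists U]. Qed.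

Lemma outer_content_ge A c : (forall U, open U -> A `<=` U -> c <= open_content U) ->
  c <= outer_content A.
Proof.
move=> h; apply: lb_le_inf; first exact: (outer_content_has_inf A).1.
by move=> _ [U [oU AU] <-]; exact: h.
Qed.

Lemma outer_content_adherent A e : 0 < e ->
  exists U, [/\ open U, A `<=` U & open_content U < outer_content A + e].
Proof.
move=> e0; have [_ [U [oU AU] <-] h] := inf_adherent e0 (outer_content_has_inf A).
by exists U.
Qed.

Lemma outer_content_open U : open U -> outer_content U = open_content U.
Proof.
move=> oU; apply/eqP; rewrite eq_le outer_contentP//=.
by apply: outer_content_ge => V _; exact: le_open_content.
Qed.

Lemma mean_set_le_outer F : closed F -> mean_set F <= outer_content F.
Proof. by move=> cF; apply: outer_content_ge => U oU FU; exact: open_contentP. Qed.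

Lemma le_outer_content A B : A `<=` B -> outer_content A <= outer_content B.
Proof.
by move=> AB; apply: outer_content_ge => U oU BU; apply: outer_contentP => // x /AB/BU.
Qed.

Lemma outer_content_ge0 A : 0 <= outer_content A.
Proof. by apply: outer_content_ge => U _ _; exact: open_content_ge0. Qed.

Let omu (A : set T) : \bar R := (outer_content A)%:E.

Let omu0 : omu set0 = 0%E.
Proof.
rewrite /omu outer_content_open; last exact: open0.
congr EFin; apply/eqP; rewrite eq_le open_content_ge0 andbT.
by apply: open_content_le => F _ F0; rewrite -mean_set0; exact: le_mean_set.
Qed.

Let omu_ge0 A : (0 <= omu A)%E.
Proof. by rewrite lee_fin outer_content_ge0. Qed.

Let le_omu : {homo omu : A B / A `<=` B >-> (A <= B)%E}.
Proof. by move=> A B AB; rewrite lee_fin le_outer_content. Qed.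

Let omu_sigma_subadditive : sigma_subadditive omu.
Proof.
move=> A; apply/lee_addgt0Pr => e e0.
have /choice[U HU] : forall n, exists U, [/\ open U, A n `<=` U &
    open_content U < outer_content (A n) + e / (2 ^ n.+1)%:R].
  by move=> n; apply: outer_content_adherent; rewrite divr_gt0// ltr0n expn_gt0.
have oU n : open (U n) by have [] := HU n.
apply: (@le_trans _ _ (open_content (\bigcup_n U n))%:E).
  rewrite lee_fin; apply: outer_contentP; first exact: bigcup_open.
  by move=> x [n _ Anx]; exists n => //; have [_ + _] := HU n; apply.
apply: (le_trans (open_content_bigcup oU)).
apply: le_trans (epsilon_trick xpredT _ (ltW e0)); last by move=> n; exact: omu_ge0.
  by apply: lee_nneseries => [n _ _|n _]; [rewrite lee_fin open_content_ge0|
  rewrite -EFinD lee_fin; have [_ _ /ltW] := HU n].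
Qed.

Let om : {outer_measure set T -> \bar R} := HB.pack omu
  (isOuterMeasure.Build R T omu omu0 omu_ge0 le_omu omu_sigma_subadditive).

(** Take an almost optimal open V around A, a closed F almost filling V and U together, and a closed
    G almost filling V \ F, which contains A \ U. As F and G are disjoint in V, their means add up
    to at most the content of V; each choice costs e/3. *)
Let open_caratheodory U : open U -> om.-caratheodory U.
Proof.
move=> oU; apply: le_caratheodory_measurable => A.
rewrite -[om _]/((outer_content _)%:E) -[om (A `&` ~` U)]/((outer_content _)%:E).
rewrite -[om A]/((outer_content _)%:E) -EFinD lee_fin.
apply/ler_addgt0Pr => e e0.
have e3 : 0 < e / 3 by rewrite divr_gt0.
have [V [oV AV Ve]] := outer_content_adherent A e3.
have [F [cF FVU Fe]] := open_content_adherent (V `&` U) e3.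
have oVF : open (V `\` F) by apply: openI => //; exact: closed_openC.
have [G [cG GVF Ge]] := open_content_adherent (V `\` F) e3.
have h1 : outer_content (A `&` U) <= open_content (V `&` U).
  by apply: outer_contentP; [exact: openI|exact: setSI].
have h2 : outer_content (A `&` ~` U) <= open_content (V `\` F).
  by apply: outer_contentP => // x [/AV Vx Ux]; split => // /FVU[].
have h3 : mean_set F + mean_set G <= mean_set (F `|` G).
  apply: mean_set_disjoint_le; [exact: subsetUl|exact: subsetUr|].
  by rewrite -subset0 => x [Fx /GVF[_ /(_ Fx)]].
have h4 : mean_set (F `|` G) <= open_content V.
  apply: open_contentP; first exact: closedU.
  by move=> x [/FVU[]|/GVF[]].
lra.
Qed.

Let borel_caratheodory (B : set BT) : measurable B -> om.-caratheodory B.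
Proof.
suff : <<s @open T >> `<=` (om.-caratheodory : set (set T)) by exact.
apply: smallest_sub; last by move=> U; exact: open_caratheodory.
split.
- exact: caratheodory_measurable_set0.
- by move=> A; rewrite setTD; exact: caratheodory_measurable_setC.
- by move=> A; exact: caratheodory_measurable_bigcup.
Qed.

Definition borel_content (B : set BT) : \bar R := (outer_content B)%:E.
Local Notation mu := borel_content.

Let mu_sigma_additive : semi_sigma_additive mu.
Proof.
move=> F mF tF mUF; apply: (@caratheodory_measure_sigma_additive R T om) => //.
- by move=> i; exact: borel_caratheodory.
- exact: borel_caratheodory.
Qed.

Let mu_setT : mu setT = 1%E.
Proof.
rewrite /mu outer_content_open; last exact: openT.
congr EFin; apply/eqP; rewrite eq_le; apply/andP; split.
  by apply: open_content_le => F _ _; rewrite -mean_setT; exact: le_mean_set.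
by rewrite -mean_setT; apply: open_contentP => //; exact: closedT.
Qed.

HB.instance Definition _ := isMeasure.Build _ _ _ mu omu0 omu_ge0 mu_sigma_additive.
HB.instance Definition _ := Measure_isProbability.Build _ _ _ mu mu_setT.

Lemma exists_probability_outer_content : exists P : probability BT R,
  forall B, P B = (outer_content B)%:E.
Proof. by exists mu. Qed.

End regular_measure_of_mean.

(** The sum is e times the number of levels e, 2e, ..., Ne not exceeding r: a discretization of r
    from below, exact up to e when r <= Ne. *)
Lemma layer_cake_full (R : realType) (e r : R) N : 0 < e -> N%:R * e <= r ->
  \sum_(j < N) e * (j.+1%:R * e <= r)%R%:R = N%:R * e.
Proof.
move=> e0 Nr; under eq_bigr => j _.
  rewrite (_ : (_ <= r)%R = true) ?mulr1; last first.
    by rewrite (le_trans _ Nr)// ler_pM2r// ler_nat.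
  over.
by rewrite sumr_const card_ord -[LHS]mulr_natl.
Qed.

Lemma layer_cake_le (R : realType) (e r : R) N : 0 < e -> 0 <= r ->
  \sum_(j < N) e * (j.+1%:R * e <= r)%R%:R <= r.
Proof.
move=> e0 r0; elim: N => [|N ih]; first by rewrite big_ord0.
have [h|h] := leP (N.+1%:R * e) r; first by rewrite layer_cake_full.
by rewrite big_ord_recr/= (lt_geF h) mulr0 addr0.
Qed.

Lemma layer_cake_ge (R : realType) (e r : R) N : 0 < e -> 0 <= r -> r <= N%:R * e ->
  r <= \sum_(j < N) e * (j.+1%:R * e <= r)%R%:R + e.
Proof.
move=> e0 r0; elim: N => [|N ih rN]; first by rewrite big_ord0 mul0r; lra.
rewrite big_ord_recr/=; have [h|h] := leP r (N%:R * e).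
  apply: (le_trans (ih h)); rewrite lerD2r lerDl mulr_ge0// ltW//.
rewrite layer_cake_full//; last exact: ltW.
apply: (le_trans rN); rewrite -natr1 mulrDl mul1r lerD2r lerDl mulr_ge0// ltW//.
Qed.

Section mean_representation.
Variables (R : realType) (T : ptopologicalType) (L : mean R T).
Hypotheses (hT : hausdorff_space T) (cT : compact [set: T]).
Local Notation BT := (g_sigma_algebraType (@open T)).
Local Notation oc := (outer_content L).

Lemma open_measurable_borel (U : set BT) : @open T U -> measurable U.
Proof. by move=> oU; apply: sub_sigma_algebra. Qed.

Lemma closed_measurable_borel (F : set BT) : @closed T F -> measurable F.
Proof.
move=> cF; rewrite -(setCK F); apply: measurableC; apply: open_measurable_borel.
exact: closed_openC.
Qed.

Lemma measurable_superlevel_borel (f : T -> R) :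
  (forall c, closed [set x | c <= f x]) -> measurable_fun [set: BT] (f : BT -> R).
Proof.
move=> cf; apply: (measurability _ (RGenCInfty.measurableE R)) => //.
move=> _ [_ [a ->] <-]; rewrite setTI; apply: closed_measurable_borel.
by have := cf a; congr closed; apply/funext => x; rewrite /preimage/= in_itv/= andbT.
Qed.

Variable P : probability BT R.
Hypothesis PE : forall B, P B = (oc B)%:E.

(** Outer regularity is built into the construction. Inner regularity is outer regularity of the
    complement, since closed sets are compact here. *)
Lemma regular_outer_content (B : set BT) : measurable B ->
  P B = ereal_sup [set P F | F in [set F | @compact T F /\ F `<=` B]] /\
  P B = ereal_inf [set P U | U in [set U | @open T U /\ B `<=` U]].
Proof.
move=> mB; split; apply/eqP; rewrite eq_le; apply/andP; split.
- apply/lee_addgt0Pr => e e0.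
  have [U [oU BU Ue]] := outer_content_adherent L (~` B) e0.
  have PC (A : set BT) : measurable A -> oc (~` A) = 1 - oc A.
    by move=> mA; have := probability_setC P mA; rewrite !PE -EFinB => -[].
  apply: (@le_trans _ _ (P (~` U) + e%:E)%E).
    rewrite !PE -EFinD lee_fin PC; last exact: open_measurable_borel.
    rewrite (outer_content_open L oU); move: Ue; rewrite PC//; lra.
  rewrite leeD2r//; apply: ereal_sup_ubound; exists (~` U) => //; split.
    by apply: (subclosed_compact _ cT) => //; exact: open_closedC.
  by rewrite -[X in _ `<=` X]setCK; exact: subsetC.
- apply: ge_ereal_sup => _ [F [_ FB] <-]; rewrite !PE lee_fin; exact: le_outer_content.
- by apply: le_ereal_inf_tmp => _ [U [_ BU] <-]; rewrite !PE lee_fin; exact: le_outer_content.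
- apply/lee_addgt0Pr => e e0.
  have [U [oU BU Ue]] := outer_content_adherent L B e0.
  apply: (@le_trans _ _ (P U)); first by apply: ereal_inf_lbound; exists U.
  by rewrite !PE -EFinD lee_fin (outer_content_open L oU) ltW.
Qed.

(* Layer cake: up to [e], [f] is a combination of indicators of the closed sets
   [lev e j], on which the measure dominates the mean. *)
Lemma le_mean_integral (f : T -> R) M : (forall c, closed [set x | c <= f x]) ->
  (forall x, 0 <= f x <= M) ->
  ((L f)%:E <= \int[P]_x (f x)%:E)%E.
Proof.
move=> cf fM.
have f0 x : 0 <= f x by have /andP[] := fM x.
have fb : bounded_real f by exact: bounded_real_ge0 fM.
pose lev e (j : nat) := [set x | (j.+1%:R * e <= f x)%R].
have clev e j : @closed T (lev e j) by exact: cf.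
have mf := measurable_superlevel_borel cf.
have M0 : 0 <= M by apply: le_trans (f0 point) _; have /andP[] := fM point.
apply/lee_addgt0Pr => e e0.
have [N Ne] : exists N, M <= N%:R * e.
  by exists (Num.trunc (M / e)).+1; rewrite -ler_pdivrMr// ltW// truncnS_gt.
pose s x := \sum_(j < N) e * \1_(lev e j) x.
have sE x : s x = \sum_(j < N) e * (j.+1%:R * e <= f x)%R%:R.
  by apply: eq_bigr => j _; rewrite indicE /lev mem_setE.
have sb : bounded_real s.
  by apply: bounded_real_sum => j; apply: bounded_realZ; exact: bounded_indic.
apply: (@le_trans _ _ ((L s)%:E + e%:E)%E).
  rewrite -EFinD lee_fin -(mean_cst L e) -meanD//; last exact: bounded_real_cst.
  apply: ler_mean => //; first by apply: bounded_realD => //; exact: bounded_real_cst.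
  move=> x; rewrite sE; apply: layer_cake_ge => //.
  by have /andP[_ /le_trans] := fM x; apply.
rewrite leeD2r//; have mi j : measurable_fun [set: BT] (\1_(lev e j) : BT -> R).
  by apply: measurable_indic; exact: closed_measurable_borel.
apply: (@le_trans _ _ (\int[P]_x (s x)%:E)%E); last first.
  apply: ge0_le_integral => //.
  - by move=> x _; rewrite lee_fin; apply: sumr_ge0 => j _; rewrite mulr_ge0// ltW.
  - apply/measurable_EFinP; apply: measurable_sum => j.
    by apply: measurable_funM => //; exact: measurable_indic.
  - exact/measurable_EFinP.
  - by move=> x _; rewrite lee_fin sE; exact: layer_cake_le.
rewrite /s mean_sum; last by move=> j; apply: bounded_realZ; exact: bounded_indic.
under eq_integral do rewrite -sumEFin.
rewrite ge0_integral_sum//=; last 2 first.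
- by move=> j; apply/measurable_EFinP; exact: measurable_funM.
- by move=> j x _; rewrite lee_fin mulr_ge0// ltW.
rewrite -sumEFin; apply: lee_sum => j _.
under eq_integral do rewrite EFinM.
rewrite ge0_integralZl_EFin; last 4 first.
- exact: measurableT.
- by move=> x _; rewrite lee_fin.
- exact/measurable_EFinP.
- exact: ltW.
rewrite integral_indic//; last exact: closed_measurable_borel.
rewrite setIT meanZ; last exact: bounded_indic.
rewrite [X in (_ <= _ * X)%E]PE -EFinM lee_fin ler_pM2l//.
exact: mean_set_le_outer.
Qed.

End mean_representation.

Lemma mean_representation (R : realType) (T : ptopologicalType) (L : mean R T) :
  hausdorff_space T -> compact [set: T] ->
  exists P : probability (g_sigma_algebraType (@open T)) R,
  (forall B : set (g_sigma_algebraType (@open T)), measurable B ->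
    P B = ereal_sup [set P F | F in [set F | @compact T F /\ F `<=` B]] /\
    P B = ereal_inf [set P U | U in [set U | @open T U /\ B `<=` U]]) /\
  (forall (f : T -> R) M, (forall c, closed [set x | c <= f x]) ->
    (forall x, 0 <= f x <= M) ->
    ((L f)%:E <= \int[P]_x (f x)%:E)%E).
Proof.
move=> hT cT; have [P PE] := exists_probability_outer_content L hT cT.
by exists P; split; [exact: (regular_outer_content cT PE)|exact: le_mean_integral].
Qed.

(** * Weak-star topologies and compactness of the unit balls *)

Lemma initial_cvg (S : choiceType) (T : topologicalType) (f : S -> T)
    (F : set_system S) (s : S) : Filter F ->
  f @ F --> f s -> F --> (s : initial_topology f).
Proof.
move=> FF fF A [_ [[B oB <-] Bs] BA]; apply: filterS BA _.
by apply: fF; exact: open_nbhs_nbhs.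
Qed.

Section pairing_topology.
Variables (D : choiceType) (E : Type) (K : topologicalType) (ev : D -> E -> K).
Local Notation W := (initial_topology (ev : D -> {ptws E -> K})).

Lemma pairing_cvg (F : set_system D) (d : D) : Filter F ->
  (forall e, (fun d' => ev d' e) @ F --> ev d e) -> F --> (d : W).
Proof.
move=> FF h; apply: initial_cvg.
apply/cvg_sup => e; apply: initial_cvg; exact: h.
Qed.

Lemma pairing_continuous e : continuous (fun d : W => ev d e).
Proof.
move=> d A Ad.
have h : nbhs (ev d : {ptws E -> K}) [set g | A (g e)].
  have /cvg_sup/(_ e) h : nbhs (ev d : {ptws E -> K}) --> (ev d : {ptws E -> K}) by exact: cvg_id.
  have := @initial_continuous _ _ (fun g : E -> K => g e) (ev d) A Ad.
  exact: h.
exact: (@initial_continuous _ _ (ev : D -> {ptws E -> K}) d _ h).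
Qed.

End pairing_topology.

Lemma hausdorff_separated (T V : topologicalType) (J : Type) (g : J -> T -> V) :
  hausdorff_space V -> (forall j, continuous (g j)) ->
  (forall x y, (forall j, g j x = g j y) -> x = y) -> hausdorff_space T.
Proof.
move=> hV gc gsep p q pq; apply: gsep => j; apply: hV => A B Ap Bq.
have [z [Az Bz]] := pq _ _ (gc j p A Ap) (gc j q B Bq).
by exists (g j z).
Qed.

Section scalar_limits.
Variables (R : realType) (k : scalar_kind).
Local Notation K := (scalars R k).

Lemma cvg_nrmP (V : normedModType K) (T : Type) (F : set_system T) (f : T -> V) (l : V) :
  Filter F -> f @ F --> l <-> forall e : R, 0 < e -> \forall t \near F, nrm (f t - l) < e.
Proof.
move=> FF; split=> [/cvgrPdist_lt h e e0|h].
  have e0' : 0 < of_real k e.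
    rewrite lt_def -[X in _ != X](of_real0 R k) (inj_eq (@of_real_inj R k)) gt_eqF//=.
    by rewrite -[X in X <= _](of_real0 R k) ler_of_real ltW.
  have := h _ e0'; apply: filterS => t; rewrite -nrmE nrmB !lt_def.
  by rewrite (inj_eq (@of_real_inj R k)) ler_of_real.
apply/cvgrPdist_lt => e e0.
have eE : of_real k (real_part e) = e by rewrite real_partK// ltW.
have e0' : 0 < real_part e.
  by move: e0; rewrite -eE of_realK -[X in X < _](of_real0 R k) !lt_def
    (inj_eq (@of_real_inj R k)) ler_of_real.
have := h _ e0'; apply: filterS => t; rewrite -eE -nrmE nrmB of_realK !lt_def.
by rewrite (inj_eq (@of_real_inj R k)) ler_of_real.
Qed.

End scalar_limits.

(** Compactness of the segment gives a cluster point, and along an ultrafilter a cluster point is a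
    limit. *)
Lemma ultra_lim_real (R : realType) (T : Type) (F : set_system T) (f : T -> R) (M : R) :
  UltraFilter F -> (\forall t \near F, `|f t| <= M) ->
  exists l : R, forall e, 0 < e -> \forall t \near F, `|f t - l| < e.
Proof.
move=> UF fM.
have [|l [_ lF]] := @segment_compact R (- M) M (f @ F) _.
  by apply: filterS fM => t; rewrite /= in_itv/= -ler_norml.
exists l => e e0.
have [//|nF] := in_ultra_setVsetC [set t | `|f t - l| < e] UF.
have [|z [nz zl]] := lF (~` [set z | `|z - l| < e]) (ball l e) nF; first exact: nbhsx_ballx.
by move: zl; rewrite /ball/= distrC => zl; exfalso; exact: nz.
Qed.

Lemma ultra_lim (R : realType) (k : scalar_kind) (T : Type) (F : set_system T)
    (f : T -> (scalars R k)^o) (M : R) :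
  UltraFilter F -> (\forall t \near F, nrm (f t) <= M) ->
  exists l, forall e, 0 < e -> \forall t \near F, nrm (f t - l) < e.
Proof.
case: k f => f UF fM; first exact: ultra_lim_real UF fM.
have nE (z : R[i]) : @nrm R ComplexScalars R[i]^o z =
  Num.sqrt (complex.Re z ^+ 2 + complex.Im z ^+ 2) by case: z.
have [l1 h1] : exists l : R, forall e, 0 < e -> \forall t \near F, `|complex.Re (f t) - l| < e.
  apply: (@ultra_lim_real _ _ _ _ M) => //; apply: filterS fM => t; rewrite nE; apply: le_trans.
  by rewrite -sqrtr_sqr ler_wsqrtr// lerDl sqr_ge0.
have [l2 h2] : exists l : R, forall e, 0 < e -> \forall t \near F, `|complex.Im (f t) - l| < e.
  apply: (@ultra_lim_real _ _ _ _ M) => //; apply: filterS fM => t; rewrite nE; apply: le_trans.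
  by rewrite -sqrtr_sqr ler_wsqrtr// lerDr sqr_ge0.
exists (Complex l1 l2) => e e0; have e2 : 0 < e / 2 by rewrite divr_gt0.
apply: filterS2 (h1 _ e2) (h2 _ e2) => t t1 t2; rewrite nE.
have -> : complex.Re (f t - Complex l1 l2) = complex.Re (f t) - l1 by case: (f t).
have -> : complex.Im (f t - Complex l1 l2) = complex.Im (f t) - l2 by case: (f t).
rewrite -[ltRHS]ger0_norm ?ltW// -sqrtr_sqr ltr_sqrt ?exprn_gt0//.
rewrite -(real_normK (num_real (_ - l1))) -(real_normK (num_real (_ - l2))).
have := normr_ge0 (complex.Re (f t) - l1); have := normr_ge0 (complex.Im (f t) - l2).
nra.
Qed.

Section limits_of_functionals.
Variables (R : realType) (k : scalar_kind).
Local Notation K := (scalars R k).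
Variables (T : Type) (F : set_system T).
Hypothesis PF : ProperFilter F.

Lemma nrm_lim_le (V : normedModType K) (f : T -> V) l M :
  (forall e, 0 < e -> \forall t \near F, nrm (f t - l) < e) ->
  (\forall t \near F, nrm (f t) <= M) -> nrm l <= M.
Proof.
move=> fl fM; apply/ler_addgt0Pr => e e0; near F => t.
have t1 : nrm (f t - l) < e by near: t; exact: fl.
have t2 : nrm (f t) <= M by near: t.
have := ler_nrmD (f t) (l - f t); rewrite addrC subrK nrmB => h.
by rewrite (le_trans h)// lerD// ltW.
Unshelve. all: by end_near. Qed.

Lemma lim_linear (f g h : T -> K^o) (a : K) lf lg lh :
  (forall e, 0 < e -> \forall t \near F, nrm (f t - lf) < e) ->
  (forall e, 0 < e -> \forall t \near F, nrm (g t - lg) < e) ->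
  (forall e, 0 < e -> \forall t \near F, nrm (h t - lh) < e) ->
  (forall t, h t = a *: f t + g t) -> lh = a *: lf + lg.
Proof.
move=> fl gl hl hE; apply/eqP; rewrite -subr_eq0; apply/eqP/nrm0_eq0/eqP.
rewrite eq_le nrm_ge0 andbT; apply/ler_addgt0Pr => e e0; rewrite add0r.
pose A := nrm (a : K^o) + 2.
have a0 := nrm_ge0 (a : K^o).
have A0 : 0 < A by rewrite /A; lra.
have eA : 0 < e / A by rewrite divr_gt0.
near F => t.
have t1 : nrm (f t - lf) < e / A by near: t; exact: fl.
have t2 : nrm (g t - lg) < e / A by near: t; exact: gl.
have t3 : nrm (h t - lh) < e / A by near: t; exact: hl.
have -> : lh - (a *: lf + lg) = (lh - h t) + (a *: (f t - lf) + (g t - lg)).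
  rewrite hE; change (lh - (a * lf + lg) =
    (lh - (a * f t + g t)) + (a * (f t - lf) + (g t - lg)) :> K); ring.
apply: (le_trans (ler_nrmD _ _)); rewrite nrmB.
have := ler_nrmD (a *: (f t - lf)) (g t - lg); rewrite nrmZ => h1.
have : nrm (a : K^o) * nrm (f t - lf) <= nrm (a : K^o) * (e / A).
  by rewrite ler_wpM2l// ltW.
have : nrm (a : K^o) * (e / A) + e / A + e / A = e.
  rewrite /A; field; lra.
lra.
Unshelve. all: by end_near. Qed.

End limits_of_functionals.

(** Completeness of the scalars, uniformly in the field: a Cauchy sequence is bounded, so it has a
    limit along an ultrafilter containing all tails, and the Cauchy property makes it an ordinary
    limit. *)
Lemma nrm_cauchy_cvg (R : realType) (k : scalar_kind) (u : nat -> (scalars R k)^o) :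
  (forall e, 0 < e -> exists N : nat, forall i j, (N <= i)%N -> (N <= j)%N ->
    nrm (u i - u j) < e) ->
  exists l, forall e, 0 < e -> \forall j \near \oo, nrm (u j - l) < e.
Proof.
move=> uC; have [G [UG sG]] := ultraFilterLemma (@eventually_filter).
have [N1 hN1] := uC 1 ltr01.
have uM : \forall j \near G, nrm (u j) <= nrm (u N1) + 1.
  apply: sG; exists N1 => // j /= N1j.
  have := ler_nrmD (u N1) (u j - u N1); rewrite addrC subrK => h.
  by rewrite (le_trans h)// lerD2l ltW// hN1.
have [l hl] := ultra_lim UG uM; exists l => e e0.
have e2 : 0 < e / 2 by rewrite divr_gt0.
have [N hN] := uC _ e2; exists N => // j /= Nj.
near G => i.
have i1 : nrm (u i - l) < e / 2 by near: i; exact: hl.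
have i2 : (N <= i)%N by near: i; apply: sG; exists N.
have := ler_nrmD (u j - u i) (u i - l); rewrite addrA subrK => h.
by have := hN _ _ Nj i2; lra.
Unshelve. all: by end_near. Qed.

Section ctensor_theory.
Variables (R : realType) (k : scalar_kind) (n : nat).
Local Notation K := (scalars R k).
Variables (X : 'I_n.+1 -> completeNormedModType K).
Local Notation XX := (forall i, X i).
Local Notation tensor := (mform X -> K^o).

Lemma nrm_tensor_le_bound (phi : bmform X) : exists2 M, 0 <= M &
  forall u : tensor, is_tensor u -> nrm (u phi : K^o) <= M * proj_norm u.
Proof.
have [M hM] := bmform_bounded phi.
have M0 : 0 < `|M| + 1 by have := normr_ge0 M; lra.
exists (`|M| + 1) => [|u tu]; first exact: ltW.
rewrite mulrC -ler_pdivrMr//; apply: le_proj_norm => // s su.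
rewrite (representsE su) ler_pdivrMr// mulrC; apply: (le_trans (ler_nrm_sum _ _ _)).
rewrite /seq_cost big_distrr/=; apply: ler_sum => x _; apply: (le_trans (hM x)).
rewrite ler_wpM2r ?prod_nrm_ge0// (le_trans (ler_norm _))// lerDl//.
Qed.

(** Justifies the [lim] in [ctensor_pairing], whose value would carry no information without
    convergence. *)
Lemma ctensor_pairing_cvg (phi : bmform X) (u : ctensor X) :
  forall e, 0 < e -> \forall j \near \oo,
    nrm ((u j phi : K^o) - ctensor_pairing phi u) < e.
Proof.
have [M M0 hM] := nrm_tensor_le_bound phi.
have [|l hl] := @nrm_cauchy_cvg R k (fun j => u j phi).
  move=> e e0; have M1 : 0 < M + 1 by lra.
  have [N hN] := ctensor_cauchy u (divr_gt0 e0 M1); exists N => i j Ni Nj.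
  have tij : is_tensor (u i - u j : tensor).
    by apply: is_tensorB; exact: ctensor_tensor.
  apply: le_lt_trans (hM (u i - u j : tensor) tij) _.
  have := hN _ _ Ni Nj; rewrite ltr_pdivlMr// => h.
  by have := proj_norm_ge0 tij; move: h; nra.
suff -> : ctensor_pairing phi u = l by exact: hl.
by apply: (@cvg_lim K^o); [exact: norm_hausdorff|apply/cvg_nrmP].
Qed.

(** The error is uniform over the ball. This carries norming and convergence statements from tensors
    over to the completion. *)
Lemma ctensor_pairing_approx (phi : bmform X) (u : ctensor X) e N :
  bmform_ball phi ->
  (forall i j, (N <= i)%N -> (N <= j)%N -> proj_norm (u i - u j : tensor) < e) ->
  nrm ((u N phi : K^o) - ctensor_pairing phi u) <= e.
Proof.
move=> phi1 hN; rewrite nrmB.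
have c := @ctensor_pairing_cvg phi u.
apply: (@nrm_lim_le _ _ _ \oo _ _ (fun j => (u j phi : K^o) - u N phi)).
  move=> d d0; have := c d d0; apply: filterS => j.
  by rewrite opprB addrA subrK.
exists N => // j /= Nj.
have tij : is_tensor (u j - u N : tensor) by apply: is_tensorB; exact: ctensor_tensor.
by rewrite (le_trans (nrm_tensor_le phi1 tij))// ltW// hN.
Qed.

Lemma ctensor_norm_cvg (u : ctensor X) :
  forall e, 0 < e -> \forall j \near \oo, `|proj_norm (u j) - ctensor_norm u| < e.
Proof.
have [|l hl] := @nrm_cauchy_cvg R RealScalars (fun j => proj_norm (u j)).
  move=> e e0; have [N hN] := ctensor_cauchy u e0; exists N => i j Ni Nj.
  have ti := ctensor_tensor u i; have tj := ctensor_tensor u j.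
  have h1 := proj_normD (is_tensorB ti tj) tj; rewrite subrK in h1.
  have h2 := proj_normD (is_tensorB tj ti) ti; rewrite subrK in h2.
  have := hN _ _ Ni Nj; have := hN _ _ Nj Ni => h3 h4.
  by rewrite -[ltLHS]/(`|proj_norm (u i) - proj_norm (u j)|) ltr_norml; lra.
suff -> : ctensor_norm u = l by exact: hl.
apply: (@cvg_lim R^o); first exact: norm_hausdorff.
by apply/(@cvg_nrmP R RealScalars).
Qed.

(** Constant sequences embed the tensors, so that norming for the completion can be tested on
    them. *)
Definition const_ctensor_subproof (u : tensor) (e : R) : 0 < e -> exists N : nat,
  forall i j : nat, (N <= i)%N -> (N <= j)%N -> proj_norm (u - u : tensor) < e.
Proof. by move=> e0; exists 0 => i j _ _; rewrite subrr proj_norm0. Qed.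

Definition const_ctensor (u : tensor) (tu : is_tensor u) : ctensor X :=
  @CTensor R k n X (fun=> u) (fun=> tu) (const_ctensor_subproof u).

Lemma const_ctensor_pairing (u : tensor) (tu : is_tensor u) (phi : bmform X) :
  ctensor_pairing phi (const_ctensor tu) = u phi.
Proof. by apply: (@cvg_lim K^o); [exact: norm_hausdorff|exact: cvg_cst]. Qed.

Lemma const_ctensor_norm (u : tensor) (tu : is_tensor u) :
  ctensor_norm (const_ctensor tu) = proj_norm u.
Proof. by apply: (@cvg_lim R); [exact: Rhausdorff|exact: (cvg_cst (proj_norm u))]. Qed.

Lemma norming_tensor_norming (S : set (wstar_bmform X)) :
  wstar_compact_norming_bmform S ->
  tensor_norming (fun phi : S => (set_val phi : bmform X)).
Proof.
move=> [S1 _ [S0 Sn]]; split=> [phi|u M tu M0 uM].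
  by apply: S1; rewrite set_valE; exact: set_valP.
rewrite -(const_ctensor_norm tu) Sn; apply: ge_sup.
  by have [s Ss] := S0; eexists; exists s.
move=> _ [phi Sphi <-]; rewrite const_ctensor_pairing.
have := uM (exist _ phi (mem_set Sphi)).
by rewrite set_valE.
Qed.

Lemma bmform_ext (phi psi : bmform X) : (forall x, phi x = psi x) -> phi = psi.
Proof.
case: phi => -[f fm] fb; case: psi => -[g gm] gb /= fg.
have E : f = g by apply: functional_extensionality_dep.
subst g; have E := Prop_irrelevance fm gm; subst gm.
by rewrite (Prop_irrelevance fb gb).
Qed.

Lemma wstar_bmform_hausdorff : hausdorff_space (wstar_bmform X).
Proof.
apply: (@hausdorff_separated _ K (ctensor X)
  (fun u (phi : wstar_bmform X) => ctensor_pairing phi u)).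
- exact: (@norm_hausdorff _ K^o).
- by move=> u; exact: pairing_continuous.
- move=> phi psi h; apply: bmform_ext => x.
  have := h (const_ctensor (is_tensor_tens x)).
  by rewrite !const_ctensor_pairing.
Qed.

Lemma bmform_ball_norming :
  norming (@ctensor_pairing R k n X) (@ctensor_norm R k n X) (@bmform_ball R k n X).
Proof.
have [phi0 phi01 _] := proj_norm_norming (is_tensor0 X).
split; first by exists phi0.
move=> u; set A := [set _ | _ in _].
have Aub c : (\forall j \near \oo, proj_norm (u j) <= c) -> ubound A c.
  move=> hc _ [phi phi1 <-]; apply: (nrm_lim_le _ (ctensor_pairing_cvg phi u)).
  apply: filterS hc => j; apply: le_trans; apply: nrm_tensor_le => //.
  exact: ctensor_tensor.
have near_le e : 0 < e -> \forall j \near \oo, proj_norm (u j) <= ctensor_norm u + e.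
  move=> e0; have := ctensor_norm_cvg u e0; apply: filterS => j.
  by rewrite ltr_norml => /andP[_]; lra.
have A0 : A !=set0 by eexists; exists phi0.
have hA : has_sup A by split => //; eexists; exact: Aub (near_le 1 ltr01).
apply/eqP; rewrite eq_le; apply/andP; split; last first.
  by apply/ler_addgt0Pr => e e0; apply: ge_sup => //; exact: Aub (near_le e e0).
apply/ler_addgt0Pr => e e0; have e2 : 0 < e / 2 by rewrite divr_gt0.
have [N hN] := ctensor_cauchy u e2.
near \oo => j.
have jN : (N <= j)%N by near: j; exists N.
have j1 : `|proj_norm (u j) - ctensor_norm u| < e / 2.
  by near: j; exact: ctensor_norm_cvg.
have [phi phi1 phij] := proj_norm_norming (ctensor_tensor u j).
have := @ctensor_pairing_approx phi u (e / 2) j phi1 => /(_ _)h.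
have {}h : nrm ((u j phi : K^o) - ctensor_pairing phi u) <= e / 2.
  by apply: h => i l ji jl; apply: hN; exact: leq_trans jN _.
have h1 : nrm (ctensor_pairing phi u : K^o) <= sup A.
  by apply: sup_ubound; [exact: hA.2|exists phi].
have := ler_nrmD ((u j phi : K^o) - ctensor_pairing phi u) (ctensor_pairing phi u).
rewrite subrK phij; move: j1; rewrite ltr_norml => /andP[j1 _].
lra.
Unshelve. all: by end_near. Qed.

(** Banach-Alaoglu by ultrafilters: pointwise limits exist by boundedness and form a multilinear
    form in the ball. Convergence on the completion is checked on one approximating tensor, thanks
    to the uniform error. *)
Lemma bmform_ball_compact : compact (@bmform_ball R k n X : set (wstar_bmform X)).
Proof.
rewrite compact_ultra => F UF FB.
have xb (x : XX) : \forall phi \near F, nrm ((phi : bmform X) x : K^o) <= \prod_i nrm (x i).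
  by apply: filterS FB => phi /bmform_ballP.
have /choice[l hl] (x : XX) := ultra_lim UF (xb x).
have lm : multilinear l.
  move=> i x a v w /=.
  apply: (lim_linear _ (hl (dfwith x i v)) (hl (dfwith x i w)) (hl (dfwith x i (a *: v + w)))).
  by move=> phi; exact: (mform_multilinear phi).
have l1 x : nrm (l x) <= \prod_i nrm (x i) by exact: nrm_lim_le _ (hl x) (xb x).
have lb : exists M : R, forall x, nrm (MForm lm x) <= M * \prod_i nrm (x i).
  by exists 1 => x; rewrite mul1r.
pose phi0 : bmform X := BMForm lb.
have phi01 : bmform_ball phi0 by exact/bmform_ballP.
exists phi0; split => //; apply: pairing_cvg => u.
apply/(@cvg_nrmP R k K^o) => e e0.
have e3 : 0 < e / 4 by rewrite divr_gt0.
have [N hN] := ctensor_cauchy u e3.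
have near_u : \forall phi \near F, nrm ((u N (phi : bmform X) : K^o) - u N phi0) < e / 4.
  have [s su] := ctensor_tensor u N.
  have lims : forall d, 0 < d -> \forall phi \near F,
      nrm (\sum_(x <- s) ((phi : bmform X) x : K^o) - \sum_(x <- s) (l x : K^o)) < d.
    elim: s {su} => [|x s ih] d d0.
      by apply: nearW => phi; rewrite !big_nil subrr nrm0.
    have d2 : 0 < d / 2 by rewrite divr_gt0.
    apply: filterS2 (hl x _ d2) (ih _ d2) => phi p1 p2.
    rewrite !big_cons opprD addrACA (le_lt_trans (ler_nrmD _ _))//.
    lra.
  have := lims _ e3; apply: filterS => phi.
  by rewrite !(representsE su).
apply: filterS2 near_u FB => phi p1 p2.
have h1 := @ctensor_pairing_approx phi u (e / 4) N p2 hN.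
have h2 := @ctensor_pairing_approx phi0 u (e / 4) N phi01 hN.
have -> : (ctensor_pairing phi u : K^o) - ctensor_pairing phi0 u =
   ((u N phi : K^o) - u N phi0) - ((u N phi : K^o) - ctensor_pairing phi u) +
   ((u N phi0 : K^o) - ctensor_pairing phi0 u).
  set a : K := ctensor_pairing phi u; set b : K := ctensor_pairing phi0 u.
  set c : K := u N phi; set d : K := u N phi0.
  change (a - b = c - d - (c - a) + (d - b) :> K); ring.
apply: (le_lt_trans (ler_nrmD _ _)).
have := ler_nrmD ((u N phi : K^o) - u N phi0) (- ((u N phi : K^o) - ctensor_pairing phi u)).
rewrite nrmN; lra.
Qed.

Lemma wstar_compact_norming_ball :
  wstar_compact_norming_bmform (@bmform_ball R k n X : set (wstar_bmform X)).
Proof. by split; [|exact: bmform_ball_compact|exact: bmform_ball_norming]. Qed.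

End ctensor_theory.

Section wstar_dual_theory.
Variables (R : realType) (k : scalar_kind).
Local Notation K := (scalars R k).
Variable V : normedModType K.

Lemma wstar_dual_hausdorff : hausdorff_space (wstar_dual V).
Proof.
apply: (@hausdorff_separated _ K V (fun v (f : wstar_dual V) => (f : dual V) v)).
- exact: (@norm_hausdorff _ K^o).
- by move=> v; exact: (@pairing_continuous _ _ K (fun (f : dual V) v => f v)).
- by move=> f g h; apply/val_inj/funext.
Qed.

Lemma dual_ball_compact : compact ([set f : dual V | nrm f <= 1] : set (wstar_dual V)).
Proof.
rewrite compact_ultra => F UF FB.
have vb (v : V) : \forall f \near F, nrm ((f : dual V) v) <= nrm v.
  by apply: filterS FB => f /dual_ballP.
have /choice[l hl] (v : V) := ultra_lim UF (vb v).
have ll : linear l.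
  move=> a u v; apply: (lim_linear _ (hl u) (hl v) (hl (a *: u + v))).
  by move=> f; exact: dual_linear.
have [|f0 f01 f0E] := dual_of_bound ll.
  by move=> v; exact: nrm_lim_le _ (hl v) (vb v).
exists f0; split => //.
apply: (@pairing_cvg _ _ K (fun (f : dual V) v => f v)) => v.
by apply/(@cvg_nrmP R k K^o) => e e0; rewrite f0E; exact: hl.
Qed.

Lemma norming_dual_norming_family (L : set (wstar_dual V)) :
  wstar_compact_norming_dual L ->
  dual_norming_family (fun f : L => (set_val f : dual V)).
Proof.
move=> [L1 _ [L0 Ln]]; split=> [f|v M M0 vM].
  by apply: L1; rewrite set_valE; exact: set_valP.
rewrite Ln; apply: ge_sup; first by have [f Lf] := L0; eexists; exists f.
by move=> _ [f Lf <-]; have := vM (exist _ f (mem_set Lf)); rewrite set_valE.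
Qed.

End wstar_dual_theory.

Lemma wstar_compact_norming_bidual_ball (R : realType) (k : scalar_kind)
    (V : normedModType (scalars R k)) :
  wstar_compact_norming_dual
    ([set f : dual (dual V) | nrm f <= 1] : set (wstar_dual (dual V))).
Proof.
split => //; first exact: dual_ball_compact.
split; first by exists (0 : dual (dual V)); rewrite /= nrm0.
move=> y; set A := [set _ | _ in _].
have Aub : ubound A (nrm y) by move=> _ [f f1 <-]; exact: (dual_ballP f).1.
have A0 : A !=set0.
  by eexists; exists (0 : dual (dual V)) => //; rewrite /= nrm0.
apply/eqP; rewrite eq_le ge_sup// andbT; apply: nrm_le_bidual => f f1.
by apply: sup_ubound; [exists (nrm y)|exists f].
Qed.

Section nonempty_set_type_theory.
Variables (T : topologicalType) (S : set T) (S0 : S !=set0).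
Local Notation W := (nonempty_set_type S0).

Lemma set_val_continuous : continuous (fun w : W => set_val (w : S)).
Proof. exact: (@initial_continuous (set_type S) T set_val). Qed.

Lemma continuous_set_val (V : topologicalType) (g : T -> V) :
  continuous g -> continuous (fun w : W => g (set_val (w : S))).
Proof.
move=> gc w A Aw.
exact: (@initial_continuous (set_type S) T set_val w _ (gc (set_val (w : S)) A Aw)).
Qed.

Lemma nonempty_set_type_hausdorff : hausdorff_space T -> hausdorff_space W.
Proof.
move=> hT; apply: (@hausdorff_separated W T unit (fun _ (w : W) => set_val (w : S))) => //.
- by move=> _; exact: set_val_continuous.
- by move=> x y /(_ tt)/val_inj.
Qed.

Lemma nonempty_set_type_compact : compact S -> compact [set: W].
Proof.
move=> cS F PF _.
pose v (w : W) : T := set_val (w : S).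
have vS w : S (v w) by rewrite /v set_valE; exact: set_valP.
have [|s [Ss sF]] := cS (v @ F) _.
  by rewrite -[_ S]/(F (v @^-1` S)); apply: filterE => w; exact: vS.
pose w : W := exist _ s (mem_set Ss); exists w; split => // A B FA.
move=> [_ [[U oU <-] Us] UB].
have [|_ [[a Aa <-] Ua]] := sF (v @` A) U _ (open_nbhs_nbhs (conj oU Us)).
  by rewrite -[_ (_ @` _)]/(F (v @^-1` (v @` A))); apply: filterS FA => a Aa; exists a.
by exists a; split => //; exact: UB.
Qed.

End nonempty_set_type_theory.

(** * Domination by regular measures is equivalent to (p,q)-domination *)

Lemma lnorm_hoelder (R : realType) (p q : \bar R) (m : nat) (a b : 'I_m -> R) :
  (1 <= p)%E -> (1 <= q)%E -> (p^-1 + q^-1 <= 1)%E ->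
  (forall i, 0 <= a i) -> (forall i, 0 <= b i) ->
  lnorm (hoelder_conjugate (third_exponent p q)) (fun i => a i * b i) <=
  lnorm p a * lnorm q b.
Proof.
move=> p1 q1 pq1 a0 b0.
have [[pE qE ->]|[s [-> s1 sip]]] := third_exponent_cases p1 q1 pq1.
  apply/lnorm_pinfty_le => [|i]; first by rewrite mulr_ge0 ?lnorm_ge0.
  by rewrite ler_pM// lnorm_le_coord.
have s0 : 0 < s by rewrite (lt_le_trans ltr01).
(* At exponent [+oo] the sum carries no information ([0 `^ 0 = 1]) and the
   maximum enters as a constant. *)
have split_lnorm (r : \bar R) (c : 'I_m -> R) : (1 <= r)%E -> (forall i, 0 <= c i) ->
    exists (d : R) (A : 'I_m -> R), [/\ 0 <= d, forall i, 0 <= A i,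
      forall i, c i <= d * A i `^ exponent_inv r &
      d * (\sum_i A i) `^ exponent_inv r = lnorm r c].
  move=> r1 c0; have [rE|[r' rE r'1]] := ge1_cases r1.
    exists (lnorm r c), (fun=> 0); rewrite rE /= !powRr0 !mulr1; split => //.
    - exact: (lnorm_ge0 +oo%E).
    - by move=> i; apply: (@lnorm_le_coord R +oo%E m c i); rewrite ?leey.
  have r'0 : 0 < r' by rewrite (lt_le_trans ltr01).
  exists 1, (fun i => c i `^ r'); rewrite rE /= mul1r; split => //.
  - by move=> i; exact: powR_ge0.
  - by move=> i; rewrite mul1r powRKV.
have [d [A [d0 A0 aA dA]]] := split_lnorm p a p1 a0.
have [e [B [e0 B0 bB eB]]] := split_lnorm q b q1 b0.
have ip0 := exponent_inv_ge0 p1; have iq0 := exponent_inv_ge0 q1.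
rewrite lnorm_fin_le ?mulr_ge0 ?lnorm_ge0// -dA -eB.
apply: (@le_trans _ _ (\sum_i (d * e) `^ s *
    (A i `^ (s * exponent_inv p) * B i `^ (s * exponent_inv q)))).
  apply: ler_sum => i _; rewrite [s * exponent_inv p]mulrC [s * exponent_inv q]mulrC !powRrM.
  rewrite -!powRM ?mulr_ge0 ?powR_ge0//.
  rewrite ge0_ler_powR ?nnegrE ?mulr_ge0 ?powR_ge0//; first exact: ltW.
  by rewrite mulrACA ler_pM.
rewrite -big_distrr/=.
apply: (@le_trans _ _ ((d * e) `^ s * ((\sum_i A i) `^ (s * exponent_inv p) *
   (\sum_i B i) `^ (s * exponent_inv q)))).
  by rewrite ler_wpM2l ?powR_ge0// hoelder_sum// mulr_ge0// ltW.
rewrite [s * exponent_inv p]mulrC [s * exponent_inv q]mulrC !powRrM.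
by rewrite -!powRM ?mulr_ge0 ?powR_ge0// mulrACA.
Qed.

Lemma ge1_third_exponent (R : realType) (p q : \bar R) :
  (1 <= p)%E -> (1 <= q)%E -> (p^-1 + q^-1 <= 1)%E ->
  (1 <= hoelder_conjugate (third_exponent p q))%E.
Proof.
move=> p1 q1 pq1; have [[_ _ ->]|[s [-> s1 _]]] := third_exponent_cases p1 q1 pq1.
  by rewrite leey.
by rewrite lee_fin.
Qed.

Lemma lnormZ (R : realType) (p : \bar R) (m : nat) (c : R) (a : 'I_m -> R) :
  (1 <= p)%E -> 0 <= c -> (forall i, 0 <= a i) ->
  lnorm p (fun i => c * a i) = c * lnorm p a.
Proof.
move=> /ge1_cases[->|[p' -> p1]] c0 a0.
  rewrite /=; elim/big_rec2: _ => [|i x y _ ->]; first by rewrite mulr0.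
  by rewrite maxr_pMr.
have p0 : 0 < p' by rewrite (lt_le_trans ltr01).
rewrite /=; under eq_bigr do rewrite powRM//.
by rewrite -big_distrr/= powRM ?powR_ge0 ?sum_powR_ge0// powRKV.
Qed.

(** The pointwise bound on the sum makes every integral finite, which allows the return to real
    numbers; total mass one preserves the bound. *)
Lemma probability_integral_sum (R : realType) d (W : measurableType d)
    (P : probability W R) (m : nat) (g : 'I_m -> W -> R) (B : R) :
  (forall i w, 0 <= g i w) -> (forall i, measurable_fun setT (g i)) ->
  (forall w, \sum_i g i w <= B) ->
  exists2 A : 'I_m -> R, forall i, 0 <= A i /\ (\int[P]_w (g i w)%:E = (A i)%:E)%E &
    0 <= B -> \sum_i A i <= B.
Proof.
move=> g0 mg gB; have mE i : measurable_fun setT (fun w => (g i w)%:E).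
  exact/measurable_EFinP.
have gi i w : g i w <= B.
  by apply: le_trans (gB w); rewrite (bigD1 i)//= lerDl sumr_ge0.
have cst_int (c : R) : (\int[P]_w (c%:E) = c%:E)%E.
  by rewrite integral_cst//= probability_setT mule1.
have int0 i : (0 <= \int[P]_w (g i w)%:E)%E.
  by apply: integral_ge0 => w _; rewrite lee_fin.
have int_fin i : (\int[P]_w (g i w)%:E)%E \is a fin_num.
  rewrite ge0_fin_numE// (@le_lt_trans _ _ (B%:E))// ?ltry// -[leRHS]cst_int.
  apply: ge0_le_integral => //.
  - by move=> w _; rewrite lee_fin.
  - by move=> w _; rewrite lee_fin.
exists (fun i => fine (\int[P]_w (g i w)%:E)%E) => [i|B0].
  by rewrite fine_ge0// fineK.
rewrite -lee_fin -sumEFin; under eq_bigr do rewrite fineK//.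
rewrite -ge0_integral_sum//; last by move=> i w _; rewrite lee_fin.
rewrite -[leRHS]cst_int; apply: ge0_le_integral => //.
- by move=> w _; apply: sume_ge0 => i _; rewrite lee_fin.
- exact: emeasurable_sum.
- by move=> w _; rewrite sumEFin lee_fin.
Qed.

Section regular_domination.
Variables (R : realType) (k : scalar_kind) (n : nat).
Local Notation K := (scalars R k).
Variables (X : 'I_n.+1 -> completeNormedModType K).
Variables (Y : completeNormedModType K).
Local Notation XX := (forall i, X i).

Lemma closed_superlevel_powR (T : topologicalType) (g : T -> K^o) (p c : R) :
  0 < p -> (forall e (t : T), 0 < e -> \forall u \near t, nrm (g u - g t) < e) ->
  closed [set t | c <= nrm (g t) `^ p].
Proof.
move=> p0 gc; have [c0|c0] := leP c 0.
  rewrite (_ : [set _ | _] = setT); first exact: closedT.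
  by apply/seteqP; split => // t _ /=; rewrite (le_trans c0)// powR_ge0.
rewrite (_ : [set _ | _] = [set t | c `^ p^-1 <= nrm (g t)]); last first.
  by apply/funext => t; rewrite /= ler_powRV ?nrm_ge0// ltW.
rewrite closedE => t /= nt; rewrite leNgt; apply/negP => h.
have e0 : 0 < c `^ p^-1 - nrm (g t) by rewrite subr_gt0.
apply: nt; apply: filterS (gc _ t e0) => u gu; apply/negP; rewrite -ltNge.
have := ler_nrmD (g u - g t) (g t); rewrite subrK; lra.
Qed.

Section on_compact_sets.
Variables (S : set (wstar_bmform X)) (S0 : S !=set0).
Variables (L : set (wstar_dual (dual Y))) (L0 : L !=set0).
Hypotheses (hS : wstar_compact_norming_bmform S) (hL : wstar_compact_norming_dual L).

Let phi (w : nonempty_set_type S0) : bmform X := set_val (w : S).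
Let f (w : nonempty_set_type L0) : dual (dual Y) := set_val (w : L).

Let phiN : tensor_norming phi.
Proof. exact: norming_tensor_norming hS. Qed.

Let fN : dual_norming_family f.
Proof. exact: norming_dual_norming_family hL. Qed.

Let closed_phi x z (p c : R) : 0 < p ->
  closed [set w | c <= nrm ((phi w x : K^o) - phi w z) `^ p].
Proof.
move=> p0; apply: (@closed_superlevel_powR _ (fun w => (phi w x : K^o) - phi w z)) => // e w e0.
pose u := const_ctensor (is_tensor_diff x z).
have uc := @continuous_set_val _ S S0 _ _
  (@pairing_continuous _ _ K (@ctensor_pairing R k n X) u).
have /(@cvg_nrmP R k K^o) /(_ e e0) := uc w.
by apply: filterS => w'; rewrite !const_ctensor_pairing.
Qed.

Let closed_f y (q c : R) : 0 < q -> closed [set w | c <= nrm (f w y) `^ q].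
Proof.
move=> q0; apply: (@closed_superlevel_powR _ (fun w => f w y)) => // e w e0.
have uc := @continuous_set_val _ L L0 _ _
  (@pairing_continuous _ _ K (fun (g : dual (dual Y)) v => g v) y).
by have /(@cvg_nrmP R k K^o) /(_ e e0) := uc w.
Qed.

Variables (p q : \bar R) (T : XX -> Y).
Hypotheses (p1 : (1 <= p)%E) (q1 : (1 <= q)%E) (pq1 : (p^-1 + q^-1 <= 1)%E).

Lemma integral_bound_of_dominated C : multilinear T ->
  dominated_bound p q T C -> integral_bound p q T S0 L0 C.
Proof.
move=> Tm TC; split; first exact: TC.1.
have [M [G MG]] := mean_domination phiN fN p1 q1 pq1 Tm TC point point.
have [mu [mur muM]] := mean_representation M
  (nonempty_set_type_hausdorff (@wstar_bmform_hausdorff _ _ _ _))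
  (nonempty_set_type_compact (let: And3 _ cS _ := hS in cS)).
have [nu [nur nuG]] := mean_representation G
  (nonempty_set_type_hausdorff (@wstar_dual_hausdorff _ _ _))
  (nonempty_set_type_compact (let: And3 _ cL _ := hL in cL)).
exists mu, nu; split => // x z y.
have pow_le (a : R) (b : \bar R) (r : R) : 0 < r -> 0 <= a -> (a%:E <= b)%E ->
    ((a `^ r^-1)%:E <= b `^ r^-1)%E.
  move=> r0 a0 ab; rewrite -poweR_EFin gt0_ler_poweR ?invr_ge0//; first exact: ltW.
  - by rewrite in_itv/= lee_fin a0 leey.
  - by rewrite in_itv/= leey (le_trans _ ab).
have hp : ((mean_factor phi p M x z)%:E <= multilinear_factor mu p x z)%E.
  rewrite /mean_factor /multilinear_factor.
  have [->|[p' -> p'1]] := ge1_cases p1 => //.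
  have p'0 : 0 < p' by rewrite (lt_le_trans ltr01).
  have fb := bounded_mean_factor phiN x z (ltW p'0).
  apply: pow_le => //; first by apply: mean_ge0 => // w; exact: powR_ge0.
  have [B hB] := fb.
  apply: (muM _ B) => [c|w]; first exact: closed_phi.
  by rewrite powR_ge0/= (le_trans _ (hB w))// ler_norm.
have hq : ((mean_dual_factor f q G y)%:E <= dual_factor nu q y)%E.
  rewrite /mean_dual_factor /dual_factor.
  have [->|[q' -> q'1]] := ge1_cases q1 => //.
  have q'0 : 0 < q' by rewrite (lt_le_trans ltr01).
  have fb := bounded_mean_dual_factor fN y (ltW q'0).
  apply: pow_le => //; first by apply: mean_ge0 => // w; exact: powR_ge0.
  have [B hB] := fb.
  apply: (nuG _ B) => [c|w]; first exact: closed_f.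
  by rewrite powR_ge0/= (le_trans _ (hB w))// ler_norm.
apply: (@le_trans _ _ (C * mean_factor phi p M x z * mean_dual_factor f q G y)%:E).
  by rewrite lee_fin.
have C0 : 0 <= C by apply: ltW; exact: TC.1.
rewrite !EFinM; apply: lee_pmul => //.
- by rewrite mule_ge0// lee_fin// mean_factor_ge0.
- by rewrite lee_fin mean_dual_factor_ge0.
- by apply: lee_wpmul2l => //; rewrite lee_fin.
Qed.

(** For finite p, integrate over S the inequality that defines the weak norm, as S lies in the ball.
    For p = [+oo], a form in the ball attains each projective norm. *)
Lemma lnorm_multilinear_factor (mu : probability (borel_type S0) R) (m : nat)
    (x z : 'I_m -> XX) : exists2 a : 'I_m -> R,
  forall i, 0 <= a i /\ multilinear_factor mu p (x i) (z i) = (a i)%:E &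
  lnorm p a <= weak_proj_norm p x z.
Proof.
have wp0 := weak_proj_norm_ge0 x z p1.
rewrite /multilinear_factor; have [->|[p' pE p'1]] := ge1_cases p1.
  exists (fun i => proj_norm (tens_diff (x i) (z i))) => [i|].
    by split => //; apply: proj_norm_ge0; exact: is_tensor_diff.
  apply/lnorm_pinfty_le => [|i]; first by apply: weak_proj_norm_ge0; rewrite leey.
  have [psi psi1 <-] := proj_norm_norming (is_tensor_diff (x i) (z i)).
  apply: le_trans (weak_proj_normP x z (leey 1) psi1).
  exact: (@lnorm_le_coord R +oo%E m (fun i => nrm ((psi (x i) : K^o) - psi (z i))) i
    (leey 1) (nrm_ge0 _)).
rewrite pE in wp0 *; have p'0 : 0 < p' by rewrite (lt_le_trans ltr01).
have [|||A hA AB] := @probability_integral_sum R _ _ mu m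
  (fun i w => nrm ((phi w (x i) : K^o) - phi w (z i)) `^ p') (weak_proj_norm p'%:E x z `^ p').
- by move=> i w; exact: powR_ge0.
- by move=> i; apply: measurable_superlevel_borel => c; exact: closed_phi.
- move=> w; rewrite -lnorm_fin_le//; apply: weak_proj_normP; first by rewrite lee_fin.
  exact: phiN.1.
exists (fun i => A i `^ p'^-1) => [i|].
  have [_ ->] := hA i; rewrite poweR_EFin powR_ge0//.
rewrite lnorm_fin_le//; under eq_bigr => i _ do rewrite powRVK ?(hA i).1//.
by apply: AB; exact: powR_ge0.
Qed.

Lemma lnorm_dual_factor (nu : probability (borel_type L0) R) (m : nat)
    (y : 'I_m -> dual Y) : exists2 b : 'I_m -> R,
  forall i, 0 <= b i /\ dual_factor nu q (y i) = (b i)%:E &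
  lnorm q b <= weak_norm q y.
Proof.
have wq0 := weak_norm_ge0 y q1.
rewrite /dual_factor; have [->|[q' qE q'1]] := ge1_cases q1.
  exists (fun i => nrm (y i)) => [i|]; first by split => //; exact: nrm_ge0.
  apply/lnorm_pinfty_le => [|i]; first by apply: weak_norm_ge0; rewrite leey.
  apply: nrm_le_bidual => g g1; apply: le_trans (weak_normP y (leey 1) g1).
  exact: (@lnorm_le_coord R +oo%E m (fun i => nrm (g (y i))) i (leey 1) (nrm_ge0 _)).
rewrite qE in wq0 *; have q'0 : 0 < q' by rewrite (lt_le_trans ltr01).
have [|||A hA AB] := @probability_integral_sum R _ _ nu m
  (fun i w => nrm (f w (y i)) `^ q') (weak_norm q'%:E y `^ q').
- by move=> i w; exact: powR_ge0.
- by move=> i; apply: measurable_superlevel_borel => c; exact: closed_f.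
- move=> w; rewrite -lnorm_fin_le//; apply: weak_normP; first by rewrite lee_fin.
  exact: fN.1.
exists (fun i => A i `^ q'^-1) => [i|].
  have [_ ->] := hA i; rewrite poweR_EFin powR_ge0//.
rewrite lnorm_fin_le//; under eq_bigr => i _ do rewrite powRVK ?(hA i).1//.
by apply: AB; exact: powR_ge0.
Qed.

Lemma dominated_of_integral_bound C :
  integral_bound p q T S0 L0 C -> dominated_bound p q T C.
Proof.
move=> [C0 [mu [nu [_ _ h]]]]; split => // m x z y.
have [a ha wa] := lnorm_multilinear_factor mu x z.
have [b hb wb] := lnorm_dual_factor nu y.
apply: (@le_trans _ _ (C * (lnorm p a * lnorm q b))); last first.
  by rewrite -mulrA ler_wpM2l ?(ltW C0)// ler_pM// lnorm_ge0.
have := lnorm_hoelder p1 q1 pq1 (fun i => (ha i).1) (fun i => (hb i).1).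
have := ltW C0.
move: (ge1_third_exponent p1 q1 pq1); set s := hoelder_conjugate _ => s1 C0' hab.
apply: (@le_trans _ _ (C * lnorm s (fun i => a i * b i))); last by rewrite ler_wpM2l.
rewrite -lnormZ//; last by move=> i; rewrite mulr_ge0 ?(ha i).1 ?(hb i).1.
apply: lnorm_le_mono => // i; rewrite nrm_ge0/= mulrA -lee_fin.
by have := h (x i) (z i) (y i); rewrite (ha i).2 (hb i).2 -!EFinM.
Qed.

End on_compact_sets.
End regular_domination.

(** * The Banach space of bounded scalar functions *)

Section bounded_scalar_functions.
Variables (R : realType) (k : scalar_kind) (I : Type).
Local Notation K := (scalars R k).

Definition bfun_pred : {pred I -> K^o} :=
  [pred f | `[< exists M : R, forall i, nrm (f i) <= M >]].

Record bfun := BFun { bfun_fun :> I -> K^o ; _ : bfun_fun \in bfun_pred }.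

HB.instance Definition _ := [isSub for bfun_fun].
HB.instance Definition _ := [Equality of bfun by <:].
HB.instance Definition _ := [Choice of bfun by <:].

Lemma bfunP (f : bfun) : exists M : R, forall i, nrm (f i) <= M.
Proof. by case: f => f /= /[!inE]. Qed.

Lemma bfun_submod_closed : submod_closed bfun_pred.
Proof.
split=> [|a f g]; rewrite !inE.
  by exists 0 => i; rewrite /= nrm0.
move=> [M fM] [N gN]; exists (nrm (a : K^o) * M + N) => i.
apply: (le_trans (ler_nrmD (a *: f i) (g i))).
by rewrite nrmZ lerD// ler_wpM2l// nrm_ge0.
Qed.

HB.instance Definition _ :=
  GRing.isSubmodClosed.Build K (I -> K^o) bfun_pred bfun_submod_closed.
HB.instance Definition _ := [SubChoice_isSubLmodule of bfun by <:].

(* [0] is added so that the supremum is also meaningful for empty [I]. *)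
Definition bfun_norm (f : bfun) : R := sup [set r | r = 0 \/ exists i, r = nrm (f i)].

Lemma bfun_norm_has_sup (f : bfun) : has_sup [set r | r = 0 \/ exists i, r = nrm (f i)].
Proof.
split; first by exists 0; left.
have [M fM] := bfunP f; exists `|M| => _ [->|[i ->]] //.
by rewrite (le_trans (fM i))// ler_norm.
Qed.

Lemma bfun_norm_ge0 (f : bfun) : 0 <= bfun_norm f.
Proof. by apply: sup_ubound; [exact: (bfun_norm_has_sup f).2|left]. Qed.

Lemma bfun_normP (f : bfun) i : nrm (f i) <= bfun_norm f.
Proof. by apply: sup_ubound; [exact: (bfun_norm_has_sup f).2|right; exists i]. Qed.

Lemma bfun_norm_le (f : bfun) M : 0 <= M -> (forall i, nrm (f i) <= M) -> bfun_norm f <= M.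
Proof.
move=> M0 fM; apply: ge_sup; first exact: (bfun_norm_has_sup f).1.
by move=> _ [->|[i ->]].
Qed.

Lemma bfun_normD (f g : bfun) : bfun_norm (f + g) <= bfun_norm f + bfun_norm g.
Proof.
apply: bfun_norm_le => [|i]; first by rewrite addr_ge0 ?bfun_norm_ge0.
by rewrite (le_trans (ler_nrmD (f i) (g i)))// lerD// bfun_normP.
Qed.

Lemma bfun_normZ a (f : bfun) : bfun_norm (a *: f) = nrm (a : K^o) * bfun_norm f.
Proof.
have le b (g : bfun) : bfun_norm (b *: g) <= nrm (b : K^o) * bfun_norm g.
  apply: bfun_norm_le => [|i]; first by rewrite mulr_ge0 ?nrm_ge0 ?bfun_norm_ge0.
  change (nrm (b *: g i) <= nrm (b : K^o) * bfun_norm g).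
  by rewrite nrmZ ler_wpM2l ?nrm_ge0// bfun_normP.
apply/eqP; rewrite eq_le le/=.
have [->|a0] := eqVneq a 0; first by rewrite (nrm0 K^o) mul0r bfun_norm_ge0.
have a_gt0 : 0 < nrm (a : K^o) by rewrite lt_def nrm_ge0 (nrm_eq0 (a : K^o)) a0.
have := le a^-1 (a *: f).
by rewrite scalerA mulVf// scale1r nrm_scalarV ler_pdivlMl.
Qed.

Lemma bfun_norm0_eq0 (f : bfun) : bfun_norm f = 0 -> f = 0.
Proof.
move=> f0; apply/val_inj/funext => i /=; apply: nrm0_eq0.
by apply/eqP; rewrite eq_le nrm_ge0 andbT -f0 bfun_normP.
Qed.

Let normD (f g : bfun) :
  of_real k (bfun_norm (f + g)) <= of_real k (bfun_norm f) + of_real k (bfun_norm g).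
Proof. by rewrite -of_realD ler_of_real bfun_normD. Qed.

Let normZ (a : K) (f : bfun) :
  of_real k (bfun_norm (a *: f)) = `|a| * of_real k (bfun_norm f).
Proof. by rewrite bfun_normZ of_realM nrmE. Qed.

Let norm0_eq0 (f : bfun) : of_real k (bfun_norm f) = 0 -> f = 0.
Proof. by rewrite -(of_real0 R k) => /of_real_inj/bfun_norm0_eq0. Qed.

HB.instance Definition _ := Lmodule_isNormed.Build K bfun normD normZ norm0_eq0.

Lemma bfun_nrmE (f : bfun) : nrm f = bfun_norm f.
Proof. exact: of_realK. Qed.

(* The pointwise limits are taken along an ultrafilter refining [F]. *)
Let bfun_cauchy_cvg (F : set_system bfun) : ProperFilter F -> cauchy F -> cvg F.
Proof.
move=> PF FC.
have FC' (e : R) : 0 < e -> exists f : bfun, \forall g \near F, nrm (g - f) < e.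
  move=> e0; have e0' : 0 < of_real k e.
    rewrite lt_def -[X in _ != X](of_real0 R k) (inj_eq (@of_real_inj R k)) gt_eqF//=.
    by rewrite -[X in X <= _](of_real0 R k) ler_of_real ltW.
  have [f Ff] := (cauchyP _).1 FC _ e0'.
  exists f; apply: filterS Ff => g.
  rewrite -ball_normE/= -nrmE nrmB !lt_def (inj_eq (@of_real_inj R k)) ler_of_real//.
have [G [UG sG]] := ultraFilterLemma PF.
have [f1 hf1] := FC' 1 ltr01.
have bd i : \forall g \near G, nrm ((g : bfun) i) <= nrm f1 + 1.
  apply: sG; apply: filterS hf1 => g g1.
  have := bfun_normP g i; rewrite -bfun_nrmE => /le_trans; apply.
  by have := ler_nrmD (g - f1) f1; rewrite subrK; lra.
have /choice[l hl] i := ultra_lim UG (bd i).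
have lb : l \in bfun_pred.
  rewrite !inE; exists (nrm f1 + 1) => i; exact: nrm_lim_le _ (hl i) (bd i).
pose lf : bfun := BFun lb.
apply/cvg_ex; exists lf; apply/(@cvg_nrmP R k bfun _ _ id) => e e0.
have e2 : 0 < e / 3 by rewrite divr_gt0.
have [f hf] := FC' _ e2.
apply: filterS (hf) => g gf.
have flf i : nrm (f i - l i) <= e / 3.
  rewrite nrmB; apply: (@nrm_lim_le R k bfun G _ K^o (fun h : bfun => h i - f i)).
    move=> d d0; apply: filterS (hl i d d0) => h.
    by rewrite opprB addrA subrK.
  apply: sG; apply: filterS (hf) => h hhf.
  by have := bfun_normP (h - f) i; rewrite -bfun_nrmE => /le_trans; apply; exact: ltW.
have : nrm (g - lf) <= e / 3 + e / 3.
  rewrite bfun_nrmE; apply: bfun_norm_le => [|i]; first by lra.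
  change (nrm (g i - l i) <= e / 3 + e / 3).
  have -> : g i - l i = (g i - f i) + (f i - l i) by rewrite addrA subrK.
  apply: (le_trans (ler_nrmD _ _)); apply: lerD => //.
  by have := bfun_normP (g - f) i; rewrite -bfun_nrmE => /le_trans; apply; exact: ltW.
move=> /le_lt_trans; apply; lra.
Qed.

HB.instance Definition _ := Uniform_isComplete.Build bfun bfun_cauchy_cvg.

End bounded_scalar_functions.

(** * Minkowski's inequality for means and the resulting seminorms *)

Section mean_minkowski.
Variables (R : realType) (I : Type) (L : mean R I) (p : R).
Hypothesis p1 : 1 <= p.
Implicit Types f g : I -> R.

Let p0 : 0 < p. Proof. exact: lt_le_trans p1. Qed.

Lemma bounded_real_powR f : (forall i, 0 <= f i) -> bounded_real f ->
  bounded_real (fun i => f i `^ p).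
Proof.
move=> f0 [M fM]; apply: (@bounded_real_ge0 _ _ _ (`|M| `^ p)) => i.
rewrite powR_ge0 ge0_ler_powR ?nnegrE ?(ltW p0)//.
by rewrite -[f i]ger0_norm// (le_trans (fM i))// ler_norm.
Qed.

(** Convexity of the p-th power at r/a and s/b with weights a/(a+b) and b/(a+b). With a and b bounds
    for the two p-norms, taking means yields Minkowski's inequality. *)
Lemma powR_convex_le (a b r s : R) : 0 < a -> 0 < b -> 0 <= r -> 0 <= s ->
  (r + s) `^ p <=
  (a + b) `^ p * (a / (a + b) * (r / a) `^ p + b / (a + b) * (s / b) `^ p).
Proof.
move=> a0 b0 r0 s0; have ab0 : 0 < a + b by rewrite addr_gt0.
have t01 : 0 <= a / (a + b) <= 1.
  by rewrite (divr_ge0 (ltW a0) (ltW ab0))/= ler_pdivrMr// mul1r lerDl ltW.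
pose t : {i01 R} := Itv01 (andP t01).1 (andP t01).2.
have := convex_powR p1 t (x := r / a) (y := s / b).
rewrite !inE /= !in_itv/= !andbT => /(_ (divr_ge0 r0 (ltW a0)) (divr_ge0 s0 (ltW b0))).
rewrite [X in _ <= X -> _]convRE [X in X `^ _ <= _ -> _]convRE /= /unstable.onem.
have -> : 1 - a / (a + b) = b / (a + b) by field; rewrite gt_eqF.
have -> : a / (a + b) * (r / a) + b / (a + b) * (s / b) = (r + s) / (a + b).
  by field; rewrite !gt_eqF.
move=> h; have P0 : 0 < (a + b) `^ p by rewrite powR_gt0.
rewrite -(ler_pM2l P0) in h; apply: le_trans h.
have {1}-> : r + s = (a + b) * ((r + s) / (a + b)) by rewrite mulrC divfK// gt_eqF.
by rewrite powRM ?(ltW ab0)// divr_ge0 ?(ltW ab0)// addr_ge0.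
Qed.

Section two_functions.
Variables f g : I -> R.
Hypotheses (f0 : forall i, 0 <= f i) (g0 : forall i, 0 <= g i).
Hypotheses (fb : bounded_real f) (gb : bounded_real g).

Let scaled_bounded (h : I -> R) c : (forall i, 0 <= h i) -> bounded_real h -> 0 < c ->
  bounded_real (fun i => (h i / c) `^ p).
Proof.
move=> h0 hb c0; apply: bounded_real_powR => [i|]; first by rewrite divr_ge0// ltW.
have -> : (fun i => h i / c) = (fun i => c^-1 * h i) by apply/funext => i; rewrite mulrC.
exact: bounded_realZ.
Qed.

Let scaled_le1 (h : I -> R) c : (forall i, 0 <= h i) -> bounded_real h -> 0 < c ->
  L (fun i => h i `^ p) <= c `^ p -> L (fun i => (h i / c) `^ p) <= 1.
Proof.
move=> h0 hb c0 hc; have hpb := bounded_real_powR h0 hb.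
have -> : (fun i => (h i / c) `^ p) = (fun i => (c^-1 `^ p) * h i `^ p).
  by apply/funext => i; rewrite mulrC powRM// invr_ge0 ltW.
have cp : 0 <= c^-1 `^ p by exact: powR_ge0.
rewrite meanZ//; apply: (le_trans (ler_wpM2l cp hc)).
by rewrite -powRM ?invr_ge0 ?(ltW c0)// mulVf ?gt_eqF// powR1.
Qed.

Lemma mean_powRD_le (a b : R) : 0 < a -> 0 < b ->
  L (fun i => f i `^ p) <= a `^ p -> L (fun i => g i `^ p) <= b `^ p ->
  L (fun i => (f i + g i) `^ p) <= (a + b) `^ p.
Proof.
move=> a0 b0 La Lb; have ab0 : 0 < a + b by rewrite addr_gt0.
have {}La := scaled_le1 f0 fb a0 La; have {}Lb := scaled_le1 g0 gb b0 Lb.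
have fab := scaled_bounded f0 fb a0; have gbb := scaled_bounded g0 gb b0.
have Db : bounded_real (fun i => a / (a + b) * (f i / a) `^ p + b / (a + b) * (g i / b) `^ p).
  by apply: bounded_realD; exact: bounded_realZ.
apply: (@le_trans _ _ (L (fun i => (a + b) `^ p *
    (a / (a + b) * (f i / a) `^ p + b / (a + b) * (g i / b) `^ p)))).
  apply: ler_mean.
  - apply: bounded_real_powR => [i|]; [by rewrite addr_ge0|exact: bounded_realD].
  - exact: bounded_realZ.
  - by move=> i; exact: powR_convex_le.
rewrite meanZ// ler_piMr ?powR_ge0//.
rewrite meanD; [|exact: bounded_realZ|exact: bounded_realZ].
rewrite (meanZ L _ fab) (meanZ L _ gbb).
have aab : 0 <= a / (a + b) by rewrite divr_ge0// ltW.
have bab : 0 <= b / (a + b) by rewrite divr_ge0// ltW.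
have ab1 : a / (a + b) + b / (a + b) = 1 by rewrite -mulrDl divff// gt_eqF.
by rewrite -[leRHS]ab1 lerD// ler_piMr.
Qed.

Lemma mean_minkowski : L (fun i => (f i + g i) `^ p) `^ p^-1 <=
  L (fun i => f i `^ p) `^ p^-1 + L (fun i => g i `^ p) `^ p^-1.
Proof.
have pow0 (h : I -> R) : (forall i, 0 <= h i) -> bounded_real h ->
    0 <= L (fun i => h i `^ p).
  by move=> h0 hb; apply: mean_ge0 => [|i]; [exact: bounded_real_powR|exact: powR_ge0].
(* The summands e/2 keep both bounds positive, since either p-norm may vanish. *)
apply/ler_addgt0Pr => e e0; have e2 : 0 < e / 2 by rewrite divr_gt0.
have half (u v : R) : u + v + e = (u + e / 2) + (v + e / 2) by field.
rewrite half {half}.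
have fg0 i : 0 <= f i + g i by rewrite addr_ge0.
have pos (u : R) : 0 < u `^ p^-1 + e / 2 by rewrite ltr_wpDl ?powR_ge0.
have powle (h : I -> R) : (forall i, 0 <= h i) -> bounded_real h ->
    L (fun i => h i `^ p) <= (L (fun i => h i `^ p) `^ p^-1 + e / 2) `^ p.
  by move=> h0 hb; rewrite -ler_powRV ?(ltW (pos _))// ?lerDl ?(ltW e2)//; exact: pow0.
rewrite ler_powRV//; last 2 first.
- exact/pow0/bounded_realD.
- by rewrite addr_ge0// ltW.
by apply: mean_powRD_le => //; exact: powle.
Qed.

End two_functions.
End mean_minkowski.

Section mean_norms.
Variables (R : realType) (k : scalar_kind) (n : nat).
Local Notation K := (scalars R k).
Variables (X : 'I_n.+1 -> completeNormedModType K) (Y : normedModType K).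
Local Notation XX := (forall i, X i).
Local Notation tensor := (mform X -> K^o).
Variables (I I' : Type) (phi : I -> bmform X) (f : I' -> dual (dual Y)).
Hypotheses (phiN : tensor_norming phi) (fN : dual_norming_family f).
Variables (p q : \bar R) (L : mean R I) (G : mean R I').
Hypotheses (p1 : (1 <= p)%E) (q1 : (1 <= q)%E).

(** The L_p seminorm of the mean, extended to all tensors; on a difference of elementary tensors it
    is [mean_factor]. *)
Definition tensor_mean_norm (u : tensor) : R :=
  if p is p'%:E then L (fun i => nrm (u (phi i) : K^o) `^ p') `^ p'^-1
  else proj_norm u.

Lemma bounded_tensor (u : tensor) : is_tensor u ->
  bounded_real (fun i => nrm (u (phi i) : K^o)).
Proof.
move=> tu; apply: (@bounded_real_ge0 _ _ _ (proj_norm u)) => i.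
by rewrite nrm_ge0/=; apply: nrm_tensor_le => //; exact: phiN.1.
Qed.

Lemma tensor_mean_norm_seminorm : tensor_seminorm tensor_mean_norm.
Proof.
rewrite /tensor_mean_norm; have [->|[p' -> p'1]] := ge1_cases p1.
  exact: proj_norm_seminorm.
have p'0 : 0 < p' by rewrite (lt_le_trans ltr01).
have pb u : is_tensor u -> bounded_real (fun i => nrm (u (phi i) : K^o) `^ p').
  move=> tu; apply: bounded_real_powR => // [i|]; first exact: nrm_ge0.
  exact: bounded_tensor.
have Lp0 u : is_tensor u -> 0 <= L (fun i => nrm (u (phi i) : K^o) `^ p').
  by move=> tu; apply: mean_ge0 => [|i]; [exact: pb|exact: powR_ge0].
split=> [u v tu tv|l u tu|x].
- apply: le_trans (mean_minkowski L p'1 (fun i => nrm_ge0 _) (fun i => nrm_ge0 _)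
    (bounded_tensor tu) (bounded_tensor tv)).
  have fgb : bounded_real (fun i => (nrm (u (phi i) : K^o) + nrm (v (phi i) : K^o)) `^ p').
    apply: bounded_real_powR => // [i|]; first by rewrite addr_ge0 ?nrm_ge0.
    by apply: bounded_realD; exact: bounded_tensor.
  rewrite ge0_ler_powR ?nnegrE ?invr_ge0 ?(ltW p'0)//.
  + exact/Lp0/is_tensorD.
  + by apply: mean_ge0 => // i; exact: powR_ge0.
  apply: ler_mean => //; first exact/pb/is_tensorD.
  move=> i; rewrite ge0_ler_powR ?nnegrE ?addr_ge0 ?nrm_ge0 ?(ltW p'0)//.
  exact: ler_nrmD.
- have -> : (fun i => nrm ((l *: u : tensor) (phi i) : K^o) `^ p') =
      (fun i => nrm (l : K^o) `^ p' * nrm (u (phi i) : K^o) `^ p').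
    apply/funext => i; rewrite -powRM ?nrm_ge0//; congr (_ `^ _).
    exact: (nrmZ l (u (phi i) : K^o)).
  rewrite meanZ; last exact: pb.
  by rewrite powRM ?powR_ge0 ?Lp0// powRKV// nrm_ge0.
- rewrite ler_powRV ?prod_nrm_ge0//; last exact/Lp0/is_tensor_tens.
  apply: mean_le_cst; first exact/pb/is_tensor_tens.
  move=> i; rewrite ge0_ler_powR ?nnegrE ?nrm_ge0 ?prod_nrm_ge0 ?(ltW p'0)//.
  exact/(bmform_ballP (phi i)).1/phiN.1.
Qed.

Lemma lnorm_mean_factor (m : nat) (x z : 'I_m -> XX) :
  lnorm p (fun i => mean_factor phi p L (x i) (z i)) <= weak_proj_norm p x z.
Proof.
have wp0 := weak_proj_norm_ge0 x z p1.
rewrite /mean_factor; have [->|[p' pE p'1]] := ge1_cases p1.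
  apply/lnorm_pinfty_le => [|i]; first by apply: weak_proj_norm_ge0; rewrite leey.
  have [psi psi1 <-] := proj_norm_norming (is_tensor_diff (x i) (z i)).
  apply: le_trans (weak_proj_normP x z (leey 1) psi1).
  exact: (@lnorm_le_coord R +oo%E m (fun i => nrm ((psi (x i) : K^o) - psi (z i))) i
    (leey 1) (nrm_ge0 _)).
rewrite pE in wp0 *; have p'0 : 0 < p' by rewrite (lt_le_trans ltr01).
have fb i := bounded_mean_factor phiN (x i) (z i) (ltW p'0).
rewrite lnorm_fin_le//.
under eq_bigr => i _.
  rewrite powRVK//; last by apply: mean_ge0 => // j; exact: powR_ge0.
  over.
rewrite -mean_sum//; apply: mean_le_cst; first exact: bounded_real_sum.
move=> i; rewrite -lnorm_fin_le//; apply: weak_proj_normP; first by rewrite lee_fin.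
exact: phiN.1.
Qed.

Lemma lnorm_mean_dual_factor (m : nat) (y : 'I_m -> dual Y) :
  lnorm q (fun i => mean_dual_factor f q G (y i)) <= weak_norm q y.
Proof.
have wq0 := weak_norm_ge0 y q1.
rewrite /mean_dual_factor; have [->|[q' qE q'1]] := ge1_cases q1.
  apply/lnorm_pinfty_le => [|i]; first by apply: weak_norm_ge0; rewrite leey.
  apply: nrm_le_bidual => g g1; apply: le_trans (weak_normP y (leey 1) g1).
  exact: (@lnorm_le_coord R +oo%E m (fun i => nrm (g (y i))) i (leey 1) (nrm_ge0 _)).
rewrite qE in wq0 *; have q'0 : 0 < q' by rewrite (lt_le_trans ltr01).
have fb i := bounded_mean_dual_factor fN (y i) (ltW q'0).
rewrite lnorm_fin_le//.
under eq_bigr => i _.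
  rewrite powRVK//; last by apply: mean_ge0 => // j; exact: powR_ge0.
  over.
rewrite -mean_sum//; apply: mean_le_cst; first exact: bounded_real_sum.
move=> i; rewrite -lnorm_fin_le//; apply: weak_normP; first by rewrite lee_fin.
exact: fN.1.
Qed.

Lemma mean_dual_factor_le (y : dual Y) : mean_dual_factor f q G y <= nrm y.
Proof.
rewrite /mean_dual_factor; have [->|[q' -> q'1]] := ge1_cases q1 => //.
have q'0 : 0 < q' by rewrite (lt_le_trans ltr01).
have fb := bounded_mean_dual_factor fN y (ltW q'0).
rewrite ler_powRV ?nrm_ge0//; last by apply: mean_ge0 => // i; exact: powR_ge0.
apply: mean_le_cst => // i.
by rewrite ge0_ler_powR ?nnegrE ?nrm_ge0 ?(ltW q'0)//; exact/(dual_ballP _).1/fN.1.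
Qed.

End mean_norms.

(** * Factorization through a Lipschitz p-summing operator *)

Section factorization_theory.
Variables (R : realType) (k : scalar_kind) (n : nat).
Local Notation K := (scalars R k).
Variables (X : 'I_n.+1 -> completeNormedModType K) (Y : completeNormedModType K).
Local Notation XX := (forall i, X i).
Variables (p q : \bar R) (T : XX -> Y).
Hypotheses (p1 : (1 <= p)%E) (q1 : (1 <= q)%E) (pq1 : (p^-1 + q^-1 <= 1)%E).

(** Each |y (T x - T z)| is at most the norm of A x - A z times the Lipschitz norm of y composed
    with B; Hoelder's inequality separates these two sequences. *)
Lemma dominated_of_factorization (Z : completeNormedModType K) (A : XX -> Z)
    (B : sigma_op A Y) (c d : R) :
  (forall x, T x = B (to_range A x)) -> lip_summing_bound p A c ->
  summing_bound q (adjoint B) d -> dominated_bound p q T (c * d).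
Proof.
move=> TE [c0 hA] [d0 hB]; split; first exact: mulr_gt0.
move=> m x z y.
have hB' : lnorm q (fun i => nrm (adjoint B (y i))) <= d * weak_norm q y.
  have [qE|[q' qE q'1]] := ge1_cases q1; last by move: hB; rewrite qE; exact.
  have wq0 := weak_norm_ge0 y q1; move: hB wq0; rewrite qE => hB wq0.
  apply/lnorm_pinfty_le => [|i]; first by rewrite mulr_ge0// ltW.
  apply: (le_trans (hB (y i))); rewrite ler_wpM2l ?(ltW d0)//.
  apply: nrm_le_bidual => g g1; apply: le_trans (weak_normP y (leey 1) g1).
  exact: (@lnorm_le_coord R +oo%E m (fun i => nrm (g (y i))) i (leey 1) (nrm_ge0 _)).
have := lnorm_hoelder p1 q1 pq1 (fun i => nrm_ge0 (A (x i) - A (z i)))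
  (fun i => nrm_ge0 (adjoint B (y i))).
move=> h; apply: le_trans (le_trans h _); last first.
  have -> : c * d * weak_proj_norm p x z * weak_norm q y =
    (c * weak_proj_norm p x z) * (d * weak_norm q y) by rewrite -!mulrA; congr (_ * _); rewrite mulrCA.
  by rewrite ler_pM ?lnorm_ge0//; exact: hA.
apply: lnorm_le_mono; first exact: ge1_third_exponent.
move=> i; rewrite nrm_ge0/= !TE dualB mulrC sigma_op_nrmE.
by have [_ /(_ (to_range A (x i)) (to_range A (z i)))] := lip_normP (adjoint B (y i)).
Qed.

Section from_domination.
Variable C : R.
Hypotheses (Tm : multilinear T) (TC : dominated_bound p q T C).

Let ball := {phi : bmform X | bmform_ball phi}.
Let dball := {f : dual (dual Y) | nrm f <= 1}.
Let phi (i : ball) : bmform X := sval i.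
Let f (i : dball) : dual (dual Y) := sval i.

Let phiN : tensor_norming phi.
Proof.
split=> [i|u M tu M0 uM]; first exact: svalP i.
have [psi psi1 <-] := proj_norm_norming tu; exact: (uM (exist _ psi psi1)).
Qed.

Let fN : dual_norming_family f.
Proof.
split=> [i|y M M0 yM]; first exact: svalP i.
by apply: nrm_le_bidual => g g1; exact: (yM (exist _ g g1)).
Qed.

(* The seminorm [N] on tensors is the sup over the forms dominated by it, so
   [x |-> (psi x)_psi] realizes it inside a space of bounded functions; this
   replaces the closure of the range of [x |-> (phi x)_phi] in [L_p(mu)]. *)
Lemma factorization_of_dominated :
  exists (Z : completeNormedModType K) (A : XX -> Z) (B : sigma_op A Y),
    [/\ multilinear A, lip_summing_bound p A 1, summing_bound q (adjoint B) C &
      forall x, T x = B (to_range A x)].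
Proof.
have C0 := TC.1.
have [psi0 psi01 _] := proj_norm_norming (is_tensor0 X).
have f00 : nrm (0 : dual (dual Y)) <= 1 by rewrite nrm0.
have [L [G LG]] := mean_domination phiN fN p1 q1 pq1 Tm TC
  (exist _ psi0 psi01) (exist _ 0 f00).
pose N := tensor_mean_norm phi p L.
have sN : tensor_seminorm N by exact: tensor_mean_norm_seminorm.
pose J := {psi : bmform X | bmform_ball psi /\
  forall v : mform X -> K^o, is_tensor v -> nrm (v psi : K^o) <= N v}.
have Ab (x : XX) : (fun j : J => (sval j : bmform X) x : K^o) \in @bfun_pred R k J.
  rewrite !inE; exists (\prod_i nrm (x i)) => j.
  exact: ((bmform_ballP (sval j)).1 (svalP j).1 x).
pose A (x : XX) : bfun R k J := BFun (Ab x).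
have Am : multilinear A.
  move=> i x a u v; apply/val_inj/funext => j.
  exact: (mform_multilinear (sval j : bmform X)).
(* Hahn-Banach provides a form in [J] attaining [N] at the difference, so [A] represents [N] without
   loss of constant. *)
have AN x z : nrm (A x - A z) = N (tens_diff x z).
  have AE (j : J) : (A x - A z) j = tens_diff x z (sval j : bmform X) by [].
  rewrite bfun_nrmE; apply/eqP; rewrite eq_le; apply/andP; split.
    apply: bfun_norm_le => [|j]; first exact: mean_factor_ge0.
    by rewrite AE; apply: (svalP j).2; exact: is_tensor_diff.
  have [psi [psi1 psiN <-]] := tensor_hahn_banach sN (is_tensor_diff x z).
  exact: (bfun_normP (A x - A z) (exist _ psi (conj psi1 psiN))).
have LG' x z (y : dual Y) : nrm (y (T x - T z)) <=
    C * nrm (A x - A z) * mean_dual_factor f q G y by rewrite AN; exact: LG.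
have Tlip x z : nrm (T x - T z) <= C * nrm (A x - A z).
  apply: nrm_le_dual => y y1; apply: (le_trans (LG' x z y)).
  rewrite ler_piMr ?mulr_ge0 ?nrm_ge0 ?(ltW C0)//.
  by rewrite (le_trans _ y1)//; exact: mean_dual_factor_le.
(* The choice of preimage does not matter: by [Tlip], points with equal image under [A] have equal
   image under [T]. *)
have /choice[sel selE] (a : range A) : exists x, a = to_range A x := to_range_surj a.
pose B0 (a : range A) : Y := T (sel a).
have B0E x : B0 (to_range A x) = T x.
  apply/eqP; rewrite -subr_eq0; apply/eqP/nrm0_eq0/eqP; rewrite eq_le nrm_ge0 andbT.
  apply: (le_trans (Tlip _ _)).
  have -> : A (sel (to_range A x)) = A x.
    by have := congr1 val (selE (to_range A x)).
  by rewrite subrr nrm0 mulr0.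
have B0P : B0 \in @sigma_op_pred R k n X _ A Y.
  rewrite !inE; split.
    exists C; split=> [|a b]; first exact: ltW.
    rewrite (selE a) (selE b); move: (sel a) (sel b) => x z.
    by rewrite !B0E; exact: Tlip.
  move=> i x a u v /=; rewrite !B0E; exact: Tm.
exists (bfun R k J), A, (SigmaOp B0P); split => //.
  split=> // m x z; rewrite mul1r.
  under eq_fun do rewrite AN.
  exact: (lnorm_mean_factor phiN).
(* For fixed y the domination inequality is a Lipschitz estimate for y composed with B. All of C
   goes to the adjoint, as [A] has constant 1. *)
have adj y : nrm (adjoint (SigmaOp B0P) y) <= C * mean_dual_factor f q G y.
  rewrite sigma_op_nrmE; apply: lip_norm_le; split=> [|a b].
    by rewrite mulr_ge0 ?mean_dual_factor_ge0// ltW.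
  rewrite (selE a) (selE b); move: (sel a) (sel b) => x z.
  rewrite /= !B0E -dualB mulrAC; exact: LG'.
split => //; have h (m : nat) (y : 'I_m -> dual Y) :
    lnorm q (fun i => nrm (adjoint (SigmaOp B0P) (y i))) <= C * weak_norm q y.
  apply: (@le_trans _ _ (C * lnorm q (fun i => mean_dual_factor f q G (y i)))).
    rewrite -lnormZ ?(ltW C0)//; last by move=> i; exact: mean_dual_factor_ge0.
    by apply: lnorm_le_mono => // i; rewrite nrm_ge0/=; exact: adj.
  by rewrite ler_wpM2l ?(ltW C0)//; exact: (lnorm_mean_dual_factor fN).
have [qE|[q' qE _]] := ge1_cases q1; last by move: h; rewrite qE; exact.
move=> {h}; move: adj; rewrite qE => adj y; exact: adj.
Qed.

End from_domination.
End factorization_theory.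

(** * The equivalences and the equality of the infima *)

Lemma le_mul_inf (R : realType) (P Q : set R) (v : R) : P !=set0 -> Q !=set0 ->
  (forall a, P a -> 0 < a) -> (forall b, Q b -> 0 < b) ->
  (forall a b, P a -> Q b -> v <= a * b) -> v <= inf P * inf Q.
Proof.
move=> P0 Q0 Pp Qp h.
have hQ a : P a -> v <= a * inf Q.
  move=> Pa; have a0 := Pp _ Pa; rewrite -ler_pdivrMl//; apply: lb_le_inf => // b Qb.
  by rewrite ler_pdivrMl//; exact: h.
have Q_ge0 : 0 <= inf Q by apply: lb_le_inf => // b /Qp/ltW.
(* Division by the second infimum fails when it is 0, but then any a in [P] already gives v <= 0. *)
have [Q_eq0|Q_neq0] := eqVneq (inf Q) 0.
  by have [a Pa] := P0; have := hQ a Pa; rewrite Q_eq0 !mulr0.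
have Q_gt0 : 0 < inf Q by rewrite lt_def Q_neq0.
rewrite -ler_pdivrMr//; apply: lb_le_inf => // a Pa.
by rewrite ler_pdivrMr//; exact: hQ.
Qed.

Theorem theorem3p3 (R : realType) (k : scalar_kind) (n : nat)
    (X : 'I_n.+1 -> completeNormedModType (scalars R k))
    (Y : completeNormedModType (scalars R k)) (p q : \bar R)
    (T : (forall i, X i) -> Y) :
  (1 <= p)%E -> (1 <= q)%E -> (p^-1 + q^-1 <= 1)%E -> multilinear T ->
  [/\ dominated p q T <->
        (forall (S : set (wstar_bmform X)) (L : set (wstar_dual (dual Y)))
            (S0 : S !=set0) (L0 : L !=set0),
          wstar_compact_norming_bmform S -> wstar_compact_norming_dual L ->
          exists C, integral_bound p q T S0 L0 C),
      dominated p q T <->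
        (exists (Z : completeNormedModType (scalars R k))
            (A : (forall i, X i) -> Z) (B : sigma_op A Y),
          factorization p q T B) &
      dominated p q T ->
        (forall (S : set (wstar_bmform X)) (L : set (wstar_dual (dual Y)))
            (S0 : S !=set0) (L0 : L !=set0),
          wstar_compact_norming_bmform S -> wstar_compact_norming_dual L ->
          dominated_norm p q T = inf [set C | integral_bound p q T S0 L0 C]) /\
        dominated_norm p q T =
          inf [set c | exists (Z : completeNormedModType (scalars R k))
                 (A : (forall i, X i) -> Z) (B : sigma_op A Y),
               factorization p q T B /\
               c = lip_summing_norm p A * summing_norm q (adjoint B)]].
Proof.
move=> p1 q1 pq1 Tm.
(* Equality of the whole sets of constants, for every admissible pair, gives both the equivalence
   with (ii) and the first formula for the norm. *)
have dominatedE (S : set (wstar_bmform X)) (L : set (wstar_dual (dual Y)))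
    (S0 : S !=set0) (L0 : L !=set0) :
    wstar_compact_norming_bmform S -> wstar_compact_norming_dual L ->
    [set C | dominated_bound p q T C] = [set C | integral_bound p q T S0 L0 C].
  move=> hS hL; apply/seteqP; split=> C /=.
    exact: integral_bound_of_dominated.
  exact: dominated_of_integral_bound.
have fact C : dominated_bound p q T C ->
    exists (Z : completeNormedModType (scalars R k)) (A : (forall i, X i) -> Z)
      (B : sigma_op A Y), factorization p q T B /\
      lip_summing_norm p A * summing_norm q (adjoint B) <= C.
  move=> TC; have [Z [A [B [Am A1 BC TE]]]] := factorization_of_dominated p1 q1 pq1 Tm TC.
  exists Z, A, B; split; first by split => //; [exists 1|exists C].
  rewrite -[leRHS]mul1r; apply: ler_pM.
  - by apply: lb_le_inf; [exists 1|move=> a []/ltW].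
  - by apply: lb_le_inf; [exists C|move=> b []/ltW].
  - by apply: ge_inf => //; exists 0 => a []/ltW.
  - by apply: ge_inf => //; exists 0 => b []/ltW.
have factC (Z : completeNormedModType (scalars R k)) (A : (forall i, X i) -> Z)
    (B : sigma_op A Y) : factorization p q T B ->
    dominated_norm p q T <= lip_summing_norm p A * summing_norm q (adjoint B).
  move=> [Am [a0 Aa] [b0 Bb] TE]; apply: le_mul_inf.
  - by exists a0.
  - by exists b0.
  - by move=> a [].
  - by move=> b [].
  move=> a b Pa Qb; apply: ge_inf; first by exists 0 => c []/ltW.
  exact: dominated_of_factorization TE Pa Qb.
split.
- split=> [[C TC] S L S0 L0 hS hL|h].
    by exists C; have := dominatedE S L S0 L0 hS hL => /seteqP[+ _]; apply.
  (* Statement (ii) speaks of all admissible pairs, so an instance is required: the two unit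
     balls. *)
  have hS := wstar_compact_norming_ball X.
  have hL := @wstar_compact_norming_bidual_ball R k Y.
  have [_ _ [S0 _]] := hS; have [_ _ [L0 _]] := hL.
  have [C TC] := h _ _ S0 L0 hS hL.
  by exists C; have := dominatedE _ _ S0 L0 hS hL => /seteqP[_]; apply.
- split=> [[C /fact[Z [A [B [fB _]]]]]|[Z [A [B [Am [a Aa] [b Bb] TE]]]]].
    by exists Z, A, B.
  by exists (a * b); exact: dominated_of_factorization TE Aa Bb.
- move=> [C TC]; split=> [S L S0 L0 hS hL|].
    by rewrite /dominated_norm (dominatedE S L S0 L0 hS hL).
  set F := [set c | _].
  have F0 c : F c -> 0 <= c.
    move=> [Z [A [B [[Am [a Aa] [b Bb] TE] ->]]]]; rewrite mulr_ge0//.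
    + by apply: lb_le_inf; [exists a|move=> a' []/ltW].
    + by apply: lb_le_inf; [exists b|move=> b' []/ltW].
  apply/eqP; rewrite eq_le; apply/andP; split.
    apply: lb_le_inf; last by move=> c [Z [A [B [fB ->]]]]; exact: factC.
    by have [Z [A [B [fB _]]]] := fact C TC; eexists; exists Z, A, B.
  apply: lb_le_inf; first by exists C.
  move=> c /fact[Z [A [B [fB hc]]]]; apply: le_trans hc; apply: ge_inf.
    by exists 0 => d /F0.
  by exists Z, A, B.
Qed.
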